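(* Let $(S,D)$ be a formal smooth surface pair with closed point $P$, let $C\subset S$ be a nonempty reduced algebroid curve not containing $D$, and let $w=C.D$ (so $w\ge 1$). Then the functor $\underline{\mathcal{D}ef}^{\,w}_{C\to(S\supset D\supset P)}$ of deformations with constant intersection multiplicity $w$ has a smooth formal semiuniversal deformation space, isomorphic to the completion at $0$ of $\mathcal{O}_S/I^{\mathrm{ea}}_{\log D}(C)$ regarded as an affine space. Moreover, if $S=\operatorname{Spec}\mathbb{C}[[x,y]]$, $D=\mathbf{V}(y)$ and $C=\mathbf{V}(F)$ with $F=yf(x,y)+x^w$, if the residue classes of $f_1,\dots,f_k\in\mathbb{C}[[x,y]]$ form a basis of $\mathbb{C}[[x,y]]/I^{\mathrm{ea}}_{\log D}(C)$, and if $t_1,\dots,t_k$ denote formal coordinate functions, then a formal semiuniversal deformation (over $\mathbb{C}[[t_1,\dots,t_k]]$) is given by $$y\Bigl(f+\sum_{i=1}^k t_if_i\Bigr)+x^w .$$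
   Context: A formal smooth surface is a scheme $S\cong\operatorname{Spec}\mathbb{C}[[x,y]]$ and a formal smooth curve is a scheme isomorphic to $\operatorname{Spec}\mathbb{C}[[x]]$, over $\mathbb{C}$; $\mathcal{O}_S$ denotes the coordinate ring. A formal smooth surface pair $(S,D)$ is a formal smooth surface $S$ with a closed subscheme $D\subset S$ that is a formal smooth curve; $P$ denotes the closed point. $\mathbf{V}(\cdot)$ is the closed subscheme defined by given functions and $\mathbf{I}_Z$ is the ideal of $Z$. An algebroid curve in $S$ is $C=\mathbf{V}(F)$ with $0\neq F\in\mathcal{O}_S$. $C.D=\dim_{\mathbb{C}}\mathcal{O}_S/(\mathbf{I}_C+\mathbf{I}_D)$. Ideals: choose coordinates with $D=\mathbf{V}(y)$, $P=\mathbf{V}(x,y)$. For $C=\mathbf{V}(F)$ put $I^{\mathrm{ea}}_{D,P}(C)=\langle x\partial_xF,\ y\partial_xF,\ y\partial_yF,\ F\rangle$ (independent of choices), and $I^{\mathrm{ea}}_{\log D}(C)=I^{\mathrm{ea}}_{D,P}(C):\mathbf{I}_D$ (ideal quotient). Functor: let $\mathcal{A}_{\mathbb{C}}$ be the category of local artinian $\mathbb{C}$-algebras with residue field $\mathbb{C}$ and local $\mathbb{C}$-homomorphisms. A deformation of $C\to(S\supset D\supset P)$ over $A\in\mathcal{A}_{\mathbb{C}}$ consists of flat deformations $\mathcal{C}$ of $C$ and $\mathcal{S}$ of $S$ over $A$, a subscheme $\mathcal{D}\subset\mathcal{S}$ flat over $A$, a section $\mathcal{P}\subset\mathcal{D}$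 over $A$, and a morphism $\tilde\iota:\mathcal{C}\to\mathcal{S}$ over $A$, such that on the closed fibers $\mathcal{D}$, $\mathcal{P}$, $\tilde\iota$ restrict to $D$, $P$ and the inclusion $C\hookrightarrow S$. An isomorphism of two such deformations is a pair of isomorphisms $\mathcal{C}\to\mathcal{C}'$, $\mathcal{S}\to\mathcal{S}'$ over $A$ deforming the identities, commuting with $\tilde\iota,\tilde\iota'$, and sending $\mathcal{D},\mathcal{P}$ to $\mathcal{D}',\mathcal{P}'$. $\underline{\mathcal{D}ef}_{C\to(S\supset D\supset P)}(A)$ is the set of isomorphism classes. For a positive integer $m\le C.D$, $\underline{\mathcal{D}ef}^{\,m}_{C\to(S\supset D\supset P)}(A)$ is the subset of classes with $\mathcal{C}|_{\mathcal{D}}\supseteq m\mathcal{P}$, where $\mathcal{P}$ is regarded as a Cartier divisor on $\mathcal{D}$. An equation $\tilde F$ lifting $F$ stands for the deformation $\mathbf{V}(\tilde F)\subset S_A$ with $\mathcal{S}=S_A$, $\mathcal{D}=D_A$, $\mathcal{P}=P_A$ the trivial families. Semiuniversality: for a functor $G:\mathcal{A}_{\mathbb{C}}\to(\mathrm{Set})$, a complete local noetherian $\mathbb{C}$-algebra $R$ with residue field $\mathbb{C}$ and $\hat\xi\in\varprojlim_I G(R/I)$ ($I$ ranging over ideals of finite colength), $\hat\xi$ is formally semiuniversal if the induced morphism $h_R=\operatorname{Hom}(R,-)\to G$ is smooth (i.e. $h_R(B)\to h_R(A)\times_{G(A)}G(B)$ is surjective for every surjection $B\to A$ in $\mathcal{A}_{\mathbb{C}}$)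 and bijective on $\mathbb{C}[\epsilon]$, $\epsilon^2=0$. Then $\operatorname{Spec}R$ is called a formal semiuniversal deformation space. *)

(* Defs.v *)
From HB Require Import structures.
From mathcomp Require Import all_boot all_order all_algebra.
From mathcomp Require Import boolp classical_sets reals complex.
From mathcomp Require Import mpoly.

Set Implicit Arguments.
Unset Strict Implicit.
Unset Printing Implicit Defensive.

Import GRing.Theory.
Local Open Scope classical_set_scope.
Local Open Scope ring_scope.

(******************************************************************************)
(* Every scheme below is affine (a flat deformation of an affine scheme over  *)
(* an artinian base is affine), so schemes are given by their coordinate      *)
(* rings, closed immersions by surjections and subschemes by ideals.          *)
(*   mps n R                  == R[[X_0, ..., X_(n-1)]]                       *)
(*   in_AC A                  == A is an object of the category A_K           *)
(*   deform OS OC A           == data (S, D, P, C, iota) over A, without the  *)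
(*                               conditions, which are is_deform              *)
(*   ACfunctor K              == a functor A_K -> Set, see there              *)
(*   Defm delta rho m         == the functor of isomorphism classes of        *)
(*                               deformations of C -> (S > D > P) such that   *)
(*                               C|D contains mP                              *)
(*   formally_semiuniversal G R xi                                            *)
(*                            == xi, in the limit of the G(R/I), is formally  *)
(*                               semiuniversal                                *)
(******************************************************************************)

Record mps (n : nat) (R : Type) := MPS { mps_coef : 'X_{1..n} -> R }.

Section PowerSeries.
Variables (n : nat) (R : comNzRingType).
Implicit Types f g h : mps n R.

HB.instance Definition _ := gen_eqMixin (mps n R).
HB.instance Definition _ := gen_choiceMixin (mps n R).

Local Notation "f .[[ m ]]" := (mps_coef f m%MM) (at level 2, m at level 200).

Lemma mpsP f g : (forall m, f.[[m]] = g.[[m]]) <-> f = g.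
Proof.
by split=> [|->//]; case: f g => [u] [v] /= uv; congr MPS; apply/funext.
Qed.

Definition mps_add f g := MPS (fun m => f.[[m]] + g.[[m]]).
Definition mps_opp f := MPS (fun m => - f.[[m]]).
Definition mps_zero : mps n R := MPS (fun=> 0).

Fact mps_addA : associative mps_add.
Proof. by move=> f g h; apply/mpsP => m /=; rewrite addrA. Qed.
Fact mps_addC : commutative mps_add.
Proof. by move=> f g; apply/mpsP => m /=; rewrite addrC. Qed.
Fact mps_add0 : left_id mps_zero mps_add.
Proof. by move=> f; apply/mpsP => m /=; rewrite add0r. Qed.
Fact mps_addN : left_inverse mps_zero mps_opp mps_add.
Proof. by move=> f; apply/mpsP => m /=; rewrite addNr. Qed.

HB.instance Definition _ :=
  Algebra.isZmodule.Build (mps n R) mps_addA mps_addC mps_add0 mps_addN.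

(* The index set is that of mcoeffM: pairs of monomials of degree <= deg m.   *)
Definition mps_mul f g := MPS (fun m =>
  \sum_(k : 'X_{1..n < (mdeg m).+1, (mdeg m).+1} | m == (k.1 + k.2)%MM)
    f.[[k.1]] * g.[[k.2]]).
Definition mps_one : mps n R := MPS (fun m => (m == 0%MM)%:R).

(* The part of f of degree < d.                                               *)
Definition mps_trunc d f : {mpoly R[n]} :=
  \sum_(m : 'X_{1..n < d}) f.[[m]] *: 'X_[m].

Lemma mcoeff_trunc d f m : (mdeg m < d)%N -> (mps_trunc d f)@_m = f.[[m]].
Proof. exact: mcoeff_mpoly. Qed.

Lemma mdeg_leD (m k1 k2 : 'X_{1..n}) : m = (k1 + k2)%MM ->
  (mdeg k1 <= mdeg m)%N /\ (mdeg k2 <= mdeg m)%N.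
Proof. by move=> ->; rewrite mdegD leq_addr leq_addl. Qed.

Lemma mps_mulE f g m d d' : (mdeg m < d)%N -> (mdeg m < d')%N ->
  (mps_mul f g).[[m]] = (mps_trunc d f * mps_trunc d' g)@_m.
Proof.
move=> md md'; rewrite mcoeffM; apply: eq_bigr => -[k1 k2] /= /eqP/mdeg_leD[k1m k2m].
by rewrite !mcoeff_trunc // (leq_ltn_trans _ md, leq_ltn_trans _ md').
Qed.

Lemma eq_mcoeffM (p p' q q' : {mpoly R[n]}) m :
  (forall k, mdeg k <= mdeg m -> p@_k = p'@_k)%N ->
  (forall k, mdeg k <= mdeg m -> q@_k = q'@_k)%N ->
  (p * q)@_m = (p' * q')@_m.
Proof.
move=> pp qq; rewrite !mcoeffM; apply: eq_bigr => -[k1 k2] /= /eqP/mdeg_leD[k1m k2m].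
by rewrite pp ?qq.
Qed.

Fact mps_mulA : associative mps_mul.
Proof.
move=> f g h; apply/mpsP => m.
rewrite !(@mps_mulE _ _ m (mdeg m).+1 (mdeg m).+1) //.
set T := mps_trunc _.
transitivity ((T f * (T g * T h))@_m).
  apply: eq_mcoeffM => // k km; rewrite mcoeff_trunc //.
  by rewrite (@mps_mulE _ _ _ (mdeg m).+1 (mdeg m).+1).
rewrite mulrA; apply: eq_mcoeffM => // k km; rewrite mcoeff_trunc //.
by rewrite (@mps_mulE _ _ _ (mdeg m).+1 (mdeg m).+1).
Qed.

Fact mps_mulC : commutative mps_mul.
Proof.
move=> f g; apply/mpsP => m.
by rewrite !(@mps_mulE _ _ m (mdeg m).+1 (mdeg m).+1) // mulrC.
Qed.

Fact mps_mul1 : left_id mps_one mps_mul.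
Proof.
move=> f; apply/mpsP => m.
rewrite (@mps_mulE _ _ m (mdeg m).+1 (mdeg m).+1) //.
rewrite (@eq_mcoeffM _ 1 _ (mps_trunc (mdeg m).+1 f)) ?mul1r ?mcoeff_trunc //.
by move=> k km; rewrite mcoeff_trunc // mcoeff1.
Qed.

Fact mps_mulDl : left_distributive mps_mul mps_add.
Proof.
move=> f g h; apply/mpsP => m /=; rewrite -big_split /=.
by apply: eq_bigr => k _; rewrite mulrDl.
Qed.

Fact mps_one_neq0 : mps_one != 0.
Proof.
by apply/eqP => /mpsP/(_ 0%MM) /=; rewrite eqxx => /eqP; rewrite oner_eq0.
Qed.

HB.instance Definition _ := GRing.Zmodule_isComNzRing.Build (mps n R)
  mps_mulA mps_mulC mps_mul1 mps_mulDl mps_one_neq0.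

Definition mps_scale (a : R) f := MPS (fun m => a * f.[[m]]).

Fact mps_scaleA a b f : mps_scale a (mps_scale b f) = mps_scale (a * b) f.
Proof. by apply/mpsP => m /=; rewrite mulrA. Qed.
Fact mps_scale1 : left_id 1 mps_scale.
Proof. by move=> f; apply/mpsP => m /=; rewrite mul1r. Qed.
Fact mps_scaleDr : right_distributive mps_scale +%R.
Proof. by move=> a f g; apply/mpsP => m /=; rewrite mulrDr. Qed.
Fact mps_scaleDl f : {morph mps_scale^~ f : a b / a + b}.
Proof. by move=> a b; apply/mpsP => m /=; rewrite mulrDl. Qed.
Fact mps_scaleAl a f g : mps_scale a (f * g) = mps_scale a f * g.
Proof.
apply/mpsP => m /=; rewrite big_distrr /=.
by apply: eq_bigr => k _; rewrite mulrA.
Qed.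

HB.instance Definition _ := GRing.Zmodule_isLmodule.Build R (mps n R)
  mps_scaleA mps_scale1 mps_scaleDr mps_scaleDl.
HB.instance Definition _ :=
  GRing.Lmodule_isLalgebra.Build R (mps n R) mps_scaleAl.
HB.instance Definition _ := GRing.Lalgebra_isComAlgebra.Build R (mps n R).

Definition mpsX (i : 'I_n) : mps n R := MPS (fun m => (m == U_(i)%MM)%:R).

Definition mps_deriv (i : 'I_n) f :=
  MPS (fun m => f.[[m + U_(i)]] *+ (m i).+1).

End PowerSeries.

Definition kerset (U V : nmodType) (f : U -> V) : set U := [set u | f u = 0].

Section Ideals.
Variable R : comNzRingType.
Implicit Types I J : set R.

Definition is_ideal I :=
  [/\ I 0, (forall a b, I a -> I b -> I (a + b))
    & (forall a b, I b -> I (a * b))].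

Definition ideal_gen (S : set R) : set R := smallest is_ideal S.

Definition ideal_add I J : set R := [set a + b | a in I & b in J].

Definition ideal_mul I J : set R := ideal_gen [set a * b | a in I & b in J].

Definition ideal_pow I (n : nat) : set R := iter n (ideal_mul I) setT.

Definition colon I J : set R := [set a | forall b, J b -> I (a * b)].

(* The set of non-units; it is the maximal ideal when R is local.             *)
Definition maxid : set R := [set a | ~ exists b, a * b = 1].

Definition is_local := is_ideal maxid.

Definition artinian := forall I : nat -> set R,
  (forall n, is_ideal (I n)) -> (forall n, I n.+1 `<=` I n) ->
  exists N, forall n, (N <= n)%N -> I n = I N.

Definition noetherian :=
  forall I, is_ideal I -> exists s : seq R, I = ideal_gen [set` s].

(* R -> lim_n R / maxid^n is injective and surjective.                        *)
Definition complete_local :=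
  \bigcap_n ideal_pow maxid n = [set 0] /\
  forall s : nat -> R, (forall n, ideal_pow maxid n (s n.+1 - s n)) ->
    exists r, forall n, ideal_pow maxid n (r - s n).

Definition reduced := forall (a : R) n, a ^+ n = 0 -> a = 0.

End Ideals.
Arguments maxid : clear implicits.
Arguments is_local : clear implicits.
Arguments artinian : clear implicits.
Arguments noetherian : clear implicits.
Arguments complete_local : clear implicits.
Arguments reduced : clear implicits.

Definition basis_mod (K : fieldType) (V : lmodType K) (I : set V) (k : nat)
    (f : 'I_k -> V) :=
  (forall c : 'I_k -> K, I (\sum_i c i *: f i) -> forall i, c i = 0) /\
  (forall v, exists c : 'I_k -> K, I (v - \sum_i c i *: f i)).

(* dim_K (V / I) = k *)
Definition codim (K : fieldType) (V : lmodType K) (I : set V) (k : nat) :=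
  exists f : 'I_k -> V, basis_mod I f.

(* The element sum_i n_i (x) m_i of N (x)_A M vanishes iff every bilinear map *)
(* kills it, by the universal property of N (x)_A M.                          *)
Definition tensor_eq0 (A : comNzRingType) (N M : lmodType A)
    (s : seq (N * M)) :=
  forall (P : lmodType A) (b : {bilinear N -> M -> P}),
    \sum_(nm <- s) b nm.1 nm.2 = 0.

(* - (x)_A M preserves injections.                                            *)
Definition flat (A : comNzRingType) (M : lmodType A) :=
  forall (N N' : lmodType A) (j : {linear N -> N'}), injective j ->
  forall s : seq (N * M),
    tensor_eq0 [seq (j nm.1, nm.2) | nm <- s] -> tensor_eq0 s.

Definition residue_field_is (K : fieldType) (A : comAlgType K) :=
  forall a : A, exists c : K, maxid A (a - c%:A).

Definition in_AC (K : fieldType) (A : comAlgType K) :=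
  [/\ is_local A, artinian A & residue_field_is A].

Definition complete_local_noetherian (K : fieldType) (R : comAlgType K) :=
  [/\ is_local R, noetherian R, complete_local R & residue_field_is R].

Definition local_hom (R R' : comNzRingType) (u : R -> R') :=
  forall r, maxid R r -> maxid R' (u r).

Definition surj (T T' : Type) (f : T -> T') := forall y, exists x, f x = y.

Definition alg_iso (K : fieldType) (A B : comAlgType K) :=
  exists f : {lrmorphism A -> B}, bijective f.

(* b : B -> B' lies over phi : A -> A' and makes B' = B (x)_A A' (the pushout *)
(* in commutative rings; the zero ring can be left out of the test objects T).*)
Definition cocartesian (A A' : comNzRingType) (phi : A -> A')
    (B : comAlgType A) (B' : comAlgType A') (b : {rmorphism B -> B'}) :=
  (forall a, b a%:A = (phi a)%:A) /\
  forall (T : comNzRingType) (g : {rmorphism B -> T}) (h : {rmorphism A' -> T}),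
    (forall a, g a%:A = h (phi a)) ->
    exists u : {rmorphism B' -> T},
      [/\ forall x, u (b x) = g x, forall a, u a%:A = h a
        & forall u' : {rmorphism B' -> T},
            (forall x, u' (b x) = g x) -> (forall a, u' a%:A = h a) ->
            u' =1 u].

(* pi : B -> B0 identifies the K-algebra B0 with B / maxid A B.               *)
Definition closed_fibre (K : fieldType) (A : comAlgType K) (B : comAlgType A)
    (B0 : comAlgType K) (pi : {rmorphism B -> B0}) :=
  [/\ forall c : K, pi (c%:A)%:A = c%:A, surj pi
    & kerset pi = ideal_gen [set a%:A | a in maxid A]].

Definition dual_numbers (K : fieldType) : comAlgType K :=
  {poly %/ ('X^2 : {poly K})}.

(* A functor G : A_K -> Set: G(A) is the subset Gelt of the type Gobj A       *)
(* and Gmap p restricts to G(p) : G(A) -> G(B). Only the values at objects    *)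
(* and morphisms of A_K matter.                                               *)
Record ACfunctor (K : fieldType) := MkACfunctor {
  Gobj : comAlgType K -> Type;
  Gelt : forall A, Gobj A -> Prop;
  Gmap : forall A B : comAlgType K, {lrmorphism A -> B} -> Gobj A -> Gobj B
}.

Section Semiuniversal.
Variables (K : fieldType) (G : ACfunctor K) (R : comAlgType K).

(* A quotient R / I by an ideal of finite colength is the same thing as a     *)
(* surjection q from R onto an object A of A_K (I = ker q), so families       *)
(* (xi_I in G(R / I))_I are indexed by these surjections.                     *)
Definition formal_family := forall A : comAlgType K, {lrmorphism R -> A} -> Gobj G A.

Variable xi : formal_family.

Definition in_limit :=
  (forall (A : comAlgType K) (q : {lrmorphism R -> A}), in_AC A -> surj q -> Gelt (xi q)) /\
  (forall (A B : comAlgType K) (q : {lrmorphism R -> A}) (q' : {lrmorphism R -> B})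
      (p : {lrmorphism A -> B}), in_AC A -> in_AC B -> surj q -> surj q' ->
    (forall r, p (q r) = q' r) -> xi q' = Gmap p (xi q)).

(* c is the image of u under the map h_R(A) -> G(A) induced by xi.            *)
Definition induced (A : comAlgType K) (u : {lrmorphism R -> A}) (c : Gobj G A) :=
  exists (A0 : comAlgType K) (q : {lrmorphism R -> A0})
      (i : {lrmorphism A0 -> A}),
    [/\ in_AC A0, surj q, forall r, i (q r) = u r & c = Gmap i (xi q)].

Definition smooth_map :=
  forall (B A : comAlgType K) (p : {lrmorphism B -> A}),
    in_AC B -> in_AC A -> local_hom p -> surj p ->
  forall (u : {lrmorphism R -> A}) (c : Gobj G B),
    local_hom u -> Gelt c -> induced u (Gmap p c) ->
  exists v : {lrmorphism R -> B},
    [/\ local_hom v, forall r, p (v r) = u r & induced v c].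

Definition bijective_on_dual_numbers :=
  forall c : Gobj G (dual_numbers K), Gelt c ->
  exists u : {lrmorphism R -> dual_numbers K},
    [/\ local_hom u, induced u c
      & forall u' : {lrmorphism R -> dual_numbers K},
          local_hom u' -> induced u' c -> u' =1 u].

Definition formally_semiuniversal :=
  [/\ complete_local_noetherian R, in_limit, smooth_map
    & bijective_on_dual_numbers].

End Semiuniversal.
Arguments formally_semiuniversal {K} G R xi.

Section Deformations.
Variables (K : fieldType) (OS OD OC : comAlgType K).
Variables (delta : {lrmorphism OS -> OD}) (rho : {lrmorphism OS -> OC}).

(* O_S, O_D, O_C of the families, D -> S, iota : C -> S, the section P of D,  *)
(* and the identifications of the closed fibres of S and C.                   *)
Record deform (A : comAlgType K) := Deform {
  dS : comAlgType A;
  dD : comAlgType A;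
  dC : comAlgType A;
  toD : {lrmorphism dS -> dD};
  toC : {lrmorphism dS -> dC};
  sec : {lrmorphism dD -> A | *%R};
  fibS : {rmorphism dS -> OS};
  fibC : {rmorphism dC -> OC}
}.
Arguments toD {A} d.
Arguments toC {A} d.
Arguments sec {A} d.
Arguments fibS {A} d.
Arguments fibC {A} d.

Definition idD A (x : deform A) : set (dS x) := kerset (toD x).
Definition idP A (x : deform A) : set (dS x) :=
  [set s | sec x (toD x s) = 0].
Arguments idD {A} x.
Arguments idP {A} x.

Definition is_deform A (x : deform A) :=
  [/\ [/\ flat (dS x), flat (dD x) & flat (dC x)],
      surj (toD x),
      closed_fibre (fibS x) /\ closed_fibre (fibC x),
      fibS x @` idD x = kerset delta /\ fibS x @` idP x = maxid OS
    & forall s, fibC x (toC x s) = rho (fibS x s)].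

Definition deform_iso A (x x' : deform A) :=
  exists (alpha : {lrmorphism dS x -> dS x'})
         (beta : {lrmorphism dC x -> dC x'}),
    [/\ bijective alpha /\ bijective beta,
        (forall s, fibS x' (alpha s) = fibS x s) /\
        (forall c, fibC x' (beta c) = fibC x c),
        forall s, beta (toC x s) = toC x' (alpha s)
      & alpha @` idD x = idD x' /\ alpha @` idP x = idP x'].

(* Isomorphism classes are predicates; classical_sets' [set] lives in a       *)
(* universe that is too small for them.                                       *)
Definition iso_class A (x : deform A) : deform A -> Prop :=
  fun x' => is_deform x' /\ deform_iso x x'.

(* x' is the pull-back of x along Spec A' -> Spec A.                          *)
Definition base_change (A A' : comAlgType K) (phi : {lrmorphism A -> A'})
    (x : deform A) (x' : deform A') :=
  exists (bS : {rmorphism dS x -> dS x'}) (bC : {rmorphism dC x -> dC x'}),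
    [/\ cocartesian phi bS /\ cocartesian phi bC,
        (forall s, fibS x' (bS s) = fibS x s) /\
        (forall c, fibC x' (bC c) = fibC x c),
        forall s, bC (toC x s) = toC x' (bS s),
        idD x' = ideal_gen (bS @` idD x)
      & forall s, sec x' (toD x' (bS s)) = phi (sec x (toD x s))].

(* iota is a closed immersion, as it is one on the closed fibre, so C|D is    *)
(* the subscheme of D whose ideal is the image in O_D of ker (O_S -> O_C).    *)
(* The ideal of the Cartier divisor mP of D is the m-th power of that of P.   *)
Definition contains_mP (m : nat) A (x : deform A) :=
  toD x @` kerset (toC x) `<=` ideal_pow (kerset (sec x)) m.

Definition pull_back (A A' : comAlgType K) (phi : {lrmorphism A -> A'})
    (c : deform A -> Prop) : deform A' -> Prop :=
  fun x' => is_deform x' /\ exists2 x, c x & base_change phi x x'.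

Definition Defm (m : nat) : ACfunctor K := MkACfunctor
  (fun A c => exists2 x, is_deform x /\ contains_mP m x & c = @iso_class A x)
  pull_back.

(* x is the embedded deformation V(Ft) in the trivial family                  *)
(* S_A > D_A > P_A, where j : O_S -> O_(S_A) is the constant inclusion; the   *)
(* equation Ft may depend on j.                                               *)
Definition embedded_by A (x : deform A)
    (Ft : {rmorphism OS -> dS x} -> dS x) :=
  exists j : {rmorphism OS -> dS x},
    [/\ cocartesian (in_alg A) j, forall s, fibS x (j s) = s,
        idD x = ideal_gen (j @` kerset delta),
        idP x = ideal_gen (j @` maxid OS)
      & surj (toC x) /\ kerset (toC x) = ideal_gen [set Ft j]].

(* (S, D) is a formal smooth surface pair.                                    *)
Definition surface_pair :=
  [/\ alg_iso OS (mps 2 K), surj delta & alg_iso OD (mps 1 K)].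

(* C = V(F) is a nonempty reduced algebroid curve not containing D, and       *)
(* C.D = w.                                                                   *)
Definition curve_on_pair (F : OS) (w : nat) :=
  [/\ F != 0 /\ maxid OS F,
      surj rho /\ kerset rho = ideal_gen [set F],
      reduced OC,
      ~ (kerset rho `<=` kerset delta)
    & codim (ideal_add (kerset rho) (kerset delta)) w].

End Deformations.
Arguments embedded_by {K OS OD OC} delta {A} x Ft.

Definition px (K : fieldType) : mps 2 K := mpsX K ord0.
Definition py (K : fieldType) : mps 2 K := mpsX K ord_max.

(* I^ea_{D,P}(V(G)) in coordinates with D = V(y) and P = V(x, y).             *)
Definition Iea (K : fieldType) (G : mps 2 K) : set (mps 2 K) :=
  ideal_gen [set h | [\/ h = px K * mps_deriv ord0 G,
                         h = py K * mps_deriv ord0 G,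
                         h = py K * mps_deriv ord_max G
                       | h = G]].

(* Phi : O_S -> K[[x,y]] is a choice of coordinates with D = V(y).            *)
Definition coordinates (K : fieldType) (OS OD : comAlgType K)
    (delta : {lrmorphism OS -> OD}) (Phi : {lrmorphism OS -> mps 2 K}) :=
  bijective Phi /\ kerset delta = Phi @^-1` ideal_gen [set py K].

(* I^ea_{log D}(V(F)) = I^ea_{D,P}(V(F)) : I_D, in the coordinates Phi.       *)
Definition Ilog (K : fieldType) (OS OD : comAlgType K)
    (delta : {lrmorphism OS -> OD}) (Phi : {lrmorphism OS -> mps 2 K})
    (F : OS) : set OS :=
  colon (Phi @^-1` Iea (Phi F)) (kerset delta).

(* Main.v *)
(* An object A of A_K has a K-basis e_1, ..., e_r adapted to a flag of ideals
   I_j (spanned by e_j, ..., e_r) with maxid A * I_j contained in I_(j+1).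
   Flatness enters only through this flag: if e_j b lies in I_(j+1) M, then b
   vanishes on the closed fibre. Climbing along the flag, one finds that S is
   deformed to A[[x, y]], with D = V(y) and P = V(x, y), and C to V(G) where G
   lifts F = y f + x^w; the condition that C|D contains wP says that G lies in (x^w, y).

   If G = y (f + sum v_i f_i) + x^w up to e_j h modulo I_(j+1), then h lies in
   (x^w, y), so up to a multiple of F it is y h', and h' is a combination of the
   f_i modulo I^ea_log. An element of y I^ea_log has the form
   xi F_x + y eta F_y + d F with xi in (x, y), and is removed by the coordinate
   change x -> x - e_j xi, y -> y (1 - e_j eta) and by multiplying the equation
   by the unit 1 - e_j d. Hence every deformation is given by some (v_i); doing
   this relatively to the kernel of a surjection B -> A gives smoothness.
   Over K[eps] the same computation read backwards shows that (v_i) is unique,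
   because the f_i are independent modulo I^ea_log.

   The colength of I^ea_log is finite: C being reduced, F_x is not a zero divisor
   modulo F (characteristic 0), and it is integral over K[[y]] modulo F, so a
   power of y lies in (F, F_x). *)

Require Import Defs.
From HB Require Import structures.
From mathcomp Require Import all_boot all_order all_algebra.
From mathcomp Require Import boolp classical_sets reals complex.
From mathcomp Require Import mpoly.
From mathcomp Require Import ring.

Import GRing.Theory.
Local Open Scope classical_set_scope.
Local Open Scope ring_scope.

Set Implicit Arguments.
Unset Strict Implicit.
Unset Printing Implicit Defensive.

(** * Morphisms, ideals and coefficients of power series *)

(** The coordinate ring of a deformed surface is only known to be a flat algebra over [A]. It
    carries no topology, so series cannot be evaluated in it by limits. Evaluation is instead the
    solution of a system psi f = f(0) + sum b_i psi(f_i), where f = f(0) + sum X_i f_i is a fixed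
    splitting; an identity about psi then says that some defect solves the homogeneous system.
    Existence and uniqueness of solutions hold in K[[x, y]] by the order of series and are carried
    up from the closed fibre along the flag; flatness enters in the uniqueness. Once coordinates
    exist, an isomorphism class is determined by an equation, and pull-back applies the ring map to
    its coefficients. Smoothness needs an equation over B whose image over A is exactly the given
    one: the change of coordinates and the unit that relate two equations over A are lifted to B. A
    power of y in (F, F_x) bounds the colength because F_x lies in I^ea_log, as y F_x lies in I^ea,
    and because x^w is congruent to -y f modulo F. *)

Lemma zmod_morphism_of_add (U V : zmodType) (f : U -> V) :
  {morph f : x y / x + y} -> zmod_morphism f.
Proof.
move=> fD x y; apply/eqP.
by rewrite eq_sym subr_eq -fD subrK.
Qed.

Definition mk_rmorph (R S : pzRingType) (f : R -> S)
    (fD : {morph f : x y / x + y}) (fM : {morph f : x y / x * y})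
    (f1 : f 1 = 1) : {rmorphism R -> S} :=
  HB.pack f (GRing.isZmodMorphism.Build R S f (zmod_morphism_of_add fD))
            (GRing.isMonoidMorphism.Build R S f (f1, fM)).

Definition mk_lrmorph (R : nzRingType) (A B : algType R) (f : {rmorphism A -> B})
    (fZ : scalable f) : {lrmorphism A -> B} :=
  HB.pack (f : A -> B) (GRing.RMorphism.class f)
          (GRing.isScalable.Build R A B *:%R f fZ).

Definition mk_lrmorph_reg (R : nzRingType) (A : algType R)
    (f : {rmorphism A -> R}) (fZ : scalable_for *%R f) :
    {lrmorphism A -> R | *%R} :=
  HB.pack (f : A -> R) (GRing.RMorphism.class f)
          (GRing.isScalable.Build R A R *%R f fZ).

Lemma lrmorph_algE (R : nzRingType) (A B : algType R) (f : {lrmorphism A -> B}) c :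
  f c%:A = c%:A.
Proof. by rewrite linearZ /= rmorph1. Qed.

Lemma lrmorph_of_alg (R : nzRingType) (A B : algType R) (f : {rmorphism A -> B}) :
  (forall c, f c%:A = c%:A) -> scalable f.
Proof. by move=> fA c a; rewrite -mulr_algl rmorphM fA mulr_algl. Qed.

Lemma bij_surj (T U : Type) (f : T -> U) : bijective f -> surj f.
Proof. by case=> g _ gK y; exists (g y). Qed.

Lemma inj_surj_bij (T U : Type) (f : T -> U) : injective f -> surj f -> bijective f.
Proof.
move=> fI fS; have [g gK] := choice fS.
by exists g => // x; apply: fI; rewrite gK.
Qed.

Lemma inv_lrmorph (R : nzRingType) (A B : algType R) (f : {lrmorphism A -> B}) :
  bijective f -> exists g : {lrmorphism B -> A}, cancel f g /\ cancel g f.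
Proof.
case=> g fK gK; have fI := can_inj fK.
have gD : {morph g : x y / x + y} by move=> x y; apply: fI; rewrite rmorphD /= !gK.
have gM : {morph g : x y / x * y} by move=> x y; apply: fI; rewrite rmorphM /= !gK.
have g1 : g 1 = 1 by apply: fI; rewrite rmorph1 gK.
have gZ : scalable (mk_rmorph gD gM g1).
  by move=> c x; apply: fI; rewrite linearZ /= !gK.
by exists (mk_lrmorph gZ).
Qed.

Lemma rmorph_factor (A B T : comNzRingType) (p : {rmorphism A -> B})
    (g : {rmorphism A -> T}) :
  surj p -> (forall a, p a = 0 -> g a = 0) ->
  exists h : {rmorphism B -> T}, forall a, h (p a) = g a.
Proof.
move=> pS kpg; have [s sK] := choice pS.
have gE a a' : p a = p a' -> g a = g a'.
  move=> e; apply/subr0_eq; rewrite -rmorphB; apply: kpg.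
  by rewrite rmorphB e subrr.
have hE a : g (s (p a)) = g a by apply: gE; rewrite sK.
have hD : {morph g \o s : x y / x + y}.
  by move=> x y /=; rewrite -rmorphD; apply: gE; rewrite rmorphD !sK.
have hM : {morph g \o s : x y / x * y}.
  by move=> x y /=; rewrite -rmorphM; apply: gE; rewrite rmorphM !sK.
have h1 : (g \o s) 1 = 1 by rewrite /= -(rmorph1 g); apply: gE; rewrite sK rmorph1.
by exists (mk_rmorph hD hM h1) => a /=.
Qed.

Section Ideals.
Variable R : comNzRingType.
Implicit Types (I J : set R).

Lemma ideal0 I : is_ideal I -> I 0. Proof. by case. Qed.
Lemma idealD I a b : is_ideal I -> I a -> I b -> I (a + b).
Proof. by case=> _ h _; apply: h. Qed.
Lemma idealM I a b : is_ideal I -> I b -> I (a * b).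
Proof. by case=> _ _ h; apply: h. Qed.
Lemma idealMr I a b : is_ideal I -> I a -> I (a * b).
Proof. by rewrite mulrC; apply: idealM. Qed.
Lemma idealN I a : is_ideal I -> I a -> I (- a).
Proof. by move=> hI Ia; rewrite -mulN1r; apply: idealM. Qed.
Lemma idealB I a b : is_ideal I -> I a -> I b -> I (a - b).
Proof. by move=> hI Ia Ib; apply: idealD => //; apply: idealN. Qed.
Lemma ideal_sum I (T : Type) (r : seq T) (P : pred T) (F : T -> R) :
  is_ideal I -> (forall i, P i -> I (F i)) -> I (\sum_(i <- r | P i) F i).
Proof.
move=> hI h; apply: (@big_ind _ I) => //; first exact: ideal0.
by move=> a b; apply: idealD.
Qed.

Lemma ideal_genP (S : set R) : is_ideal (ideal_gen S).
Proof.
split=> [I [hI _]|a b Ia Ib I [hI SI]|a b Ib I [hI SI]].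
- exact: ideal0.
- by apply: idealD => //; [apply: Ia|apply: Ib].
- by apply: idealM => //; apply: Ib.
Qed.

Lemma ideal_gen_sub (S : set R) : S `<=` ideal_gen S.
Proof. by move=> a Sa I [_]; apply. Qed.

Lemma ideal_gen_min (S I : set R) : is_ideal I -> S `<=` I -> ideal_gen S `<=` I.
Proof. by move=> hI SI a; apply; split. Qed.

Lemma ideal_gen1P (b a : R) : ideal_gen [set b] a <-> exists c, a = c * b.
Proof.
split=> [|[c ->]]; last by apply: idealM (ideal_genP _) _; apply: ideal_gen_sub.
apply: (@ideal_gen_min [set b] [set a | exists c, a = c * b]) => [|_ ->].
  split=> [|x y [c ->] [d ->]|x y [c ->]].
  - by exists 0; rewrite mul0r.
  - by exists (c + d); rewrite mulrDl.
  - by exists (x * c); rewrite mulrA.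
by exists 1; rewrite mul1r.
Qed.

Lemma ideal_gen_sumP (S : set R) a : ideal_gen S a ->
  exists s : seq (R * R), (forall x, x \in s -> S x.2) /\ a = \sum_(x <- s) x.1 * x.2.
Proof.
apply: (@ideal_gen_min S [set a | exists s : seq (R * R), (forall x, x \in s -> S x.2) /\
  a = \sum_(x <- s) x.1 * x.2]) => [|b Sb].
  split=> [|x y [s [sS ->]] [t [tS ->]]|x y [s [sS ->]]].
  - by exists [::]; rewrite big_nil.
  - exists (s ++ t); rewrite big_cat; split=> // z.
    by rewrite mem_cat => /orP[/sS|/tS].
  - exists [seq (x * z.1, z.2) | z <- s]; split=> [z /mapP[z' /sS z'S ->]//|].
    by rewrite big_map mulr_sumr; apply: eq_bigr => z _; rewrite mulrA.
exists [:: (1, b)]; split=> [x|]; first by rewrite inE => /eqP ->.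
by rewrite big_seq1 mul1r.
Qed.

Lemma ker_ideal (S : comNzRingType) (f : {rmorphism R -> S}) : is_ideal (kerset f).
Proof.
split=> [|a b|a b]; rewrite /kerset /= ?rmorph0 // ?rmorphD ?rmorphM.
  by move=> -> ->; rewrite addr0.
by move=> ->; rewrite mulr0.
Qed.

End Ideals.

Arguments mps_coef : simpl never.

Lemma image_ideal (R S : comNzRingType) (f : {rmorphism R -> S}) (I : set R) :
  surj f -> is_ideal I -> is_ideal (f @` I).
Proof.
move=> fS hI; split=> [|_ _ [u Iu <-] [v Iv <-]|a _ [v Iv <-]].
- by exists 0; rewrite ?rmorph0 //; apply: (ideal0 hI).
- by exists (u + v); rewrite ?rmorphD //; apply: (idealD hI).
- have [b <-] := fS a.
  by exists (b * v); rewrite ?rmorphM //; apply: (idealM _ hI).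
Qed.

Section SeriesCoef.
Variables (n : nat) (A : comNzRingType).
Implicit Types (f g : mps n A) (m : 'X_{1..n}).
Local Notation "f .[[ m ]]" := (mps_coef f m%MM) (at level 2, m at level 200).

Lemma mcoefD f g m : (f + g).[[m]] = f.[[m]] + g.[[m]]. Proof. by []. Qed.
Lemma mcoefN f m : (- f).[[m]] = - f.[[m]]. Proof. by []. Qed.
Lemma mcoefB f g m : (f - g).[[m]] = f.[[m]] - g.[[m]]. Proof. by []. Qed.
Lemma mcoef0 m : (0 : mps n A).[[m]] = 0. Proof. by []. Qed.
Lemma mcoef1 m : (1 : mps n A).[[m]] = (m == 0%MM)%:R. Proof. by []. Qed.
Lemma mcoefZ c f m : (c *: f).[[m]] = c * f.[[m]]. Proof. by []. Qed.
Lemma mcoefA c m : (c%:A : mps n A).[[m]] = c *+ (m == 0%MM).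
Proof. by rewrite mcoefZ mcoef1 mulr_natr. Qed.
Lemma mcoefX i m : (mpsX A i).[[m]] = (m == U_(i)%MM)%:R. Proof. by []. Qed.
Lemma mcoefM f g m : (f * g).[[m]] =
  \sum_(k : 'X_{1..n < (mdeg m).+1, (mdeg m).+1} | m == (k.1 + k.2)%MM)
    f.[[k.1]] * g.[[k.2]].
Proof. by []. Qed.
Lemma mcoef_sum (T : Type) (r : seq T) (P : pred T) (F : T -> mps n A) m :
  (\sum_(i <- r | P i) F i).[[m]] = \sum_(i <- r | P i) (F i).[[m]].
Proof. exact: (big_morph (fun f => f.[[m]])). Qed.

Lemma mpsext f g : (forall m, f.[[m]] = g.[[m]]) -> f = g.
Proof. exact: (mpsP f g).1. Qed.

Lemma mcoefM_ind (L : set A) f g m : L 0 -> (forall a b, L a -> L b -> L (a + b)) ->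
  (forall k1 k2, m = (k1 + k2)%MM -> L (f.[[k1]] * g.[[k2]])) -> L ((f * g).[[m]]).
Proof. by move=> L0 LD h; rewrite mcoefM; apply: big_ind => // k /eqP; apply: h. Qed.

Lemma mcoefM0 f g : (f * g).[[0]] = f.[[0]] * g.[[0]].
Proof.
have d0 : (mdeg (0%MM : 'X_{1..n}) < (mdeg (0%MM : 'X_{1..n})).+1)%N by [].
rewrite mcoefM (bigD1 (BMultinom d0, BMultinom d0)) /= ?addm0 ?eqxx // big1 ?addr0 //.
move=> [k1 k2] /= /andP[]; rewrite eq_sym mnmD_eq0 => /andP[/eqP e1 /eqP e2].
by case/negP; apply/eqP; congr (_, _); apply: val_inj.
Qed.

Lemma mcoefXM i f m : (mpsX A i * f).[[m + U_(i)]] = f.[[m]].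
Proof.
have d1 : (mdeg U_(i)%MM < (mdeg (m + U_(i))).+1)%N by rewrite ltnS mdegD leq_addl.
have d2 : (mdeg m < (mdeg (m + U_(i))).+1)%N by rewrite ltnS mdegD leq_addr.
rewrite mcoefM (bigD1 (BMultinom d1, BMultinom d2)) /=; last by rewrite addmC.
rewrite mcoefX eqxx mul1r big1 ?addr0 // => -[k1 k2] /= /andP[/eqP e k12].
rewrite mcoefX; case: eqP => e1; rewrite ?mul0r //.
case/negP: k12; apply/eqP; congr (_, _); apply: val_inj => //=.
apply/mnmP => j; move/(congr1 (fun z : 'X_{1..n} => z j)): e.
by rewrite e1 !mnmDE addnC => /addnI.
Qed.

Lemma mcoefXM0 i f m : m i = 0%N -> (mpsX A i * f).[[m]] = 0.
Proof.
move=> mi; rewrite mcoefM big1 // => -[k1 k2] /= /eqP e.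
rewrite mcoefX; case: eqP => e1; rewrite ?mul0r //.
by move/(congr1 (fun z : 'X_{1..n} => z i)): e; rewrite mi e1 mnmDE mnm1E eqxx.
Qed.

(** Each nonconstant monomial is charged to the first variable that occurs in it; [mps_tail i]
    collects the monomials charged to [X_i], divided by [X_i]. This makes the splitting [mps_tailE]
    canonical and the tails linear. *)
Definition mps_tail (i : 'I_n) f := MPS (fun m =>
  if [forall j : 'I_n, (j < i)%N ==> (m j == 0%N)] then f.[[m + U_(i)]] else 0).

Lemma mcoef_tail i f m : (mps_tail i f).[[m]] =
  if [forall j : 'I_n, (j < i)%N ==> (m j == 0%N)] then f.[[m + U_(i)]] else 0.
Proof. by []. Qed.

Lemma mnm_split_head m : m != 0%MM ->
  exists i k, m = (k + U_(i))%MM /\ forall j : 'I_n, (j < i)%N -> m j = 0%N.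
Proof.
move=> m0; have [i mi] : exists i, m i != 0%N.
  apply: contrapT => h; case/negP: m0; apply/eqP/mnmP => i; rewrite mnm0E.
  by apply/eqP; apply: contrapT => /negP mi; apply: h; exists i.
case: (@arg_minnP _ i (fun j => m j != 0%N) val mi) => j mj jmin.
exists j, (m - U_(j))%MM; split.
  rewrite submK //; apply/mnm_lepP => l; rewrite mnm1E.
  by case: eqP => // <-; rewrite lt0n.
move=> l lj; apply/eqP; apply: contrapT => /negP /jmin /=.
by rewrite leqNgt lj.
Qed.

Lemma mps_tailE f : f = f.[[0]]%:A + \sum_i mpsX A i * mps_tail i f.
Proof.
apply: mpsext => m; rewrite mcoefD mcoefA mcoef_sum.
have [->|m0] := eqVneq m 0%MM.
  by rewrite mulr1n big1 ?addr0 // => i _; rewrite mcoefXM0 // mnm0E.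
rewrite mulr0n add0r; have [i [k [e mi] ] ] := mnm_split_head m0.
rewrite (bigD1 i) //= [X in _ + X]big1 ?addr0 => [|j ji].
  rewrite e mcoefXM mcoef_tail ifT //; apply/forallP => j; apply/implyP => ji.
  by move: (mi _ ji); rewrite e mnmDE; case: (k j).
case mj: (m j) => [|r]; first by rewrite mcoefXM0.
have -> : m = (m - U_(j) + U_(j))%MM.
  rewrite submK //; apply/mnm_lepP => l; rewrite mnm1E.
  by case: eqP => // <-; rewrite mj.
rewrite mcoefXM mcoef_tail ifF //; apply/negP => /forallP/(_ i).
have ij : (i < j)%N.
  rewrite ltnNge leq_eqVlt; apply/negP => /orP[/eqP /val_inj ji'|/mi]; last by rewrite mj.
  by rewrite ji' eqxx in ji.
rewrite ij mnmBE mnm1E e mnmDE mnm1E eqxx.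
have /negPf -> : j != i by [].
by rewrite subn0 addn1.
Qed.

Lemma mps_tailD i f g : mps_tail i (f + g) = mps_tail i f + mps_tail i g.
Proof. by apply: mpsext => m; rewrite mcoefD !mcoef_tail; case: ifP; rewrite ?addr0. Qed.
Lemma mps_tailZ i c f : mps_tail i (c *: f) = c *: mps_tail i f.
Proof. by apply: mpsext => m; rewrite mcoefZ !mcoef_tail; case: ifP; rewrite ?mulr0. Qed.
Lemma mps_tail0 i : mps_tail i 0 = 0.
Proof. by apply: mpsext => m; rewrite mcoef_tail if_same. Qed.
Lemma mps_tail1 i : mps_tail i 1 = 0.
Proof.
by apply: mpsext => m; rewrite mcoef_tail mcoef1; case: ifP; rewrite // -mdeg_eq0 mdegD mdeg1 addn1. Qed.

(* The part of f in the variables X_i, X_(i+1), ... *)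
Definition mps_above (i : 'I_n) f := MPS (fun m =>
  if [forall j : 'I_n, (j < i)%N ==> (m j == 0%N)] then f.[[m]] else 0).

Lemma mcoef_above i f m : (mps_above i f).[[m]] =
  if [forall j : 'I_n, (j < i)%N ==> (m j == 0%N)] then f.[[m]] else 0.
Proof. by []. Qed.

Lemma mps_tailX i j f : mps_tail j (mpsX A i * f) =
  if (j < i)%N then mpsX A i * mps_tail j f
  else if j == i then mps_above i f else 0.
Proof.
apply: mpsext => m; rewrite mcoef_tail.
case: (ltngtP j i) => ji.
- have nij : i != j by apply/negP => /eqP e; rewrite e ltnn in ji.
  case mi: (m i) => [|r].
    rewrite [RHS]mcoefXM0 // mcoefXM0 ?if_same //.
    by rewrite mnmDE mi mnm1E eq_sym (negPf nij).
  have em : m = (m - U_(i) + U_(i))%MM.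
    rewrite submK //; apply/mnm_lepP => l; rewrite mnm1E.
    by case: eqP => // <-; rewrite mi.
  rewrite [in RHS]em mcoefXM mcoef_tail.
  have -> : (m + U_(j))%MM = (m - U_(i) + U_(j) + U_(i))%MM by rewrite [in LHS]em -!addmA (addmC U_(i)%MM).
  rewrite mcoefXM; congr (if _ then _ else _).
  apply: eq_forallb => l; case lj: (l < j)%N => //=.
  have /negPf il : i != l by apply/eqP => e; move: (ltn_trans lj ji); rewrite e ltnn.
  by rewrite mnmBE mnm1E il subn0.
- have /negPf -> : j != i by apply/eqP => e; rewrite e ltnn in ji.
  case: ifP => // /forallP/(_ i); rewrite ji => /eqP mi; rewrite mcoefXM0 //.
  rewrite mnmDE mi mnm1E; case: eqP => // e; by rewrite e ltnn in ji.
- move/val_inj: ji => ->; rewrite eqxx.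
  by rewrite mcoef_above mcoefXM.
Qed.

Lemma mps_tail_above i j f : mps_tail j (mps_above i f) =
  if (i <= j)%N then mps_tail j f else 0.
Proof.
apply: mpsext => m; rewrite mcoef_tail; case: ifP => [/forallP mj|nmj]; last first.
  by case: ifP => //= _; rewrite mcoef_tail nmj.
rewrite mcoef_above; case: leqP => ij.
  rewrite ifT; last first.
    apply/forallP => l; apply/implyP => li; rewrite mnmDE mnm1E.
    have := mj l; rewrite (leq_trans li ij) /= => /eqP ->.
    have /negPf -> // : j != l by apply/eqP => e; move: (leq_trans li ij); rewrite e ltnn.
  by rewrite mcoef_tail ifT //; apply/forallP.
rewrite ifF //; apply/negP => /forallP/(_ j); rewrite ij.
by rewrite mnmDE mnm1E eqxx addn1.
Qed.

Lemma mcoef_above0 i f : (mps_above i f).[[0]] = f.[[0]].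
Proof.
by rewrite mcoef_above ifT //; apply/forallP => j; apply/implyP => _; rewrite mnm0E.
Qed.

End SeriesCoef.

(** * Evaluation of power series *)

Section Evaluation.
Variables (n : nat) (A : comNzRingType).

(* [tsep] and [tcomp] express that B is separated and complete for the ideal
   generated by the b i, in the form of uniqueness and existence of solutions of
   the systems t s = v s + sum_i b i * t (T i s) indexed by a coalgebra T. *)
Definition tsep (B : comNzRingType) (b : 'I_n -> B) := forall S : set B,
  (forall s, S s -> exists s' : 'I_n -> B, (forall i, S (s' i)) /\ s = \sum_i b i * s' i) ->
  forall s, S s -> s = 0.

Definition tcomp (B : comNzRingType) (b : 'I_n -> B) (I : Type) (T : 'I_n -> I -> I) :=
  forall v : I -> B, exists t : I -> B, forall s, t s = v s + \sum_i b i * t (T i s).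

Lemma tsepF (B : comNzRingType) (b : 'I_n -> B) (I : Type) (T : 'I_n -> I -> I)
    (D : I -> B) : tsep b -> (forall s, D s = \sum_i b i * D (T i s)) ->
  forall s, D s = 0.
Proof.
move=> bS DE s; apply: (bS [set x | exists s, x = D s]); last by exists s.
by move=> _ [u ->]; exists (fun i => D (T i u)); split=> [i|//]; exists (T i u).
Qed.

(** psi solves the system psi f = f(0) + sum b_i psi(tail_i f), indexed by the series themselves.
    Additivity, scaling and multiplicativity hold because each defect solves the corresponding
    homogeneous system, whose only solution is 0 by [tsep]. *)
Lemma mps_ev (B : comAlgType A) (b : 'I_n -> B) :
  tsep b -> tcomp b (@mps_tail n A) ->
  exists psi : {lrmorphism mps n A -> B}, forall i, psi (mpsX A i) = b i.
Proof.
move=> bS bC; have [psi psiE] := bC (fun f : mps n A => (mps_coef f 0%MM)%:A : B).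
pose T := @mps_tail n A.
have psi0 : psi 0 = 0.
  apply: (tsepF (T := fun _ => id) (D := fun=> psi 0) bS) tt => _.
  rewrite [LHS]psiE mcoef0 scale0r add0r.
  by apply: eq_bigr => i _; rewrite mps_tail0.
have psiD : {morph psi : f g / f + g}.
  move=> f g; apply/eqP; rewrite -subr_eq0; apply/eqP.
  apply: (tsepF (T := fun i p => (T i p.1, T i p.2))
            (D := fun p => psi (p.1 + p.2) - (psi p.1 + psi p.2)) bS) (f, g).
  move=> {f g} [f g] /=; rewrite (psiE (f + g)) (psiE f) (psiE g) mcoefD scalerDl addrACA.
  rewrite opprD addrACA subrr add0r -big_split -sumrB /=.
  by apply: eq_bigr => i _; rewrite mps_tailD -mulrDr -mulrBr.
have psiZ c f : psi (c *: f) = c *: psi f.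
  apply/eqP; rewrite -subr_eq0; apply/eqP.
  apply: (tsepF (T := T) (D := fun f => psi (c *: f) - c *: psi f) bS).
  move=> {}f /=; rewrite (psiE (c *: f)) (psiE f) mcoefZ scalerDr scalerA.
  rewrite opprD addrACA subrr add0r scaler_sumr -sumrB.
  by apply: eq_bigr => i _; rewrite mps_tailZ scalerAr -mulrBr.
have psi1 : psi 1 = 1.
  rewrite psiE mcoef1 eqxx scale1r big1 ?addr0 // => i _.
  by rewrite mps_tail1 psi0 mulr0.
(* For j < i the j-th tail of X_i f is X_i times the j-th tail of f, so the defect obeys a recursion
   over j < i; the coalgebra sends the other indices to 0. The remaining terms, those of
   [mps_above i f], agree on both sides. *)
have psiX i f : psi (mpsX A i * f) = b i * psi f.
  apply/eqP; rewrite -subr_eq0; apply/eqP.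
  apply: (tsepF (T := fun j g => if (j < i)%N then T j g else 0)
            (D := fun f => psi (mpsX A i * f) - b i * psi f) bS).
  move=> {}f.
  have aboveE : psi (mps_above i f) = (mps_coef f 0%MM)%:A +
      \sum_(j < n | ~~ (j < i)%N) b j * psi (T j f).
    rewrite psiE mcoef_above0; congr (_ + _); rewrite [RHS]big_mkcond.
    by apply: eq_bigr => j _; rewrite mps_tail_above -leqNgt; case: leqP => // _; rewrite psi0 mulr0.
  have XE : psi (mpsX A i * f) =
      \sum_(j < n | (j < i)%N) b j * psi (mpsX A i * T j f) + b i * psi (mps_above i f).
    rewrite psiE mcoefM0 mcoefX eq_sym mnm1_eq0 mul0r scale0r add0r.
    rewrite (bigID (fun j : 'I_n => (j < i)%N)) /=; congr (_ + _).
      by apply: eq_bigr => j ji; rewrite mps_tailX ji.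
    rewrite (bigD1 i) ?ltnn //= mps_tailX ltnn eqxx big1 ?addr0 // => j /andP[nji ji].
    by rewrite mps_tailX (negPf ji) (negPf nji) psi0 mulr0.
  have fE : psi f = (mps_coef f 0%MM)%:A + \sum_(j < n | (j < i)%N) b j * psi (T j f) +
      \sum_(j < n | ~~ (j < i)%N) b j * psi (T j f).
    by rewrite psiE (bigID (fun j : 'I_n => (j < i)%N)) /= addrA.
  rewrite XE fE aboveE [RHS](bigID (fun j : 'I_n => (j < i)%N)) /=.
  rewrite [X in _ = _ + X]big1 => [|j /negPf ->]; last by rewrite mulr0 psi0 mulr0 subr0 mulr0.
  have -> : \sum_(j < n | (j < i)%N) b j * (psi (mpsX A i * (if (j < i)%N then T j f else 0)) -
      b i * psi (if (j < i)%N then T j f else 0)) =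
      \sum_(j < n | (j < i)%N) b j * psi (mpsX A i * T j f) -
      b i * \sum_(j < n | (j < i)%N) b j * psi (T j f).
    rewrite mulr_sumr -sumrB; apply: eq_bigr => j ji; rewrite ji mulrBr.
    by rewrite (mulrCA (b i)).
  by ring.
have psi_sum (F : 'I_n -> mps n A) : psi (\sum_i F i) = \sum_i psi (F i).
  exact: (big_morph psi psiD psi0).
have psiM : {morph psi : f g / f * g}.
  move=> f g; apply/eqP; rewrite -subr_eq0; apply/eqP.
  apply: (tsepF (T := T) (D := fun f => psi (f * g) - psi f * psi g) bS) => {}f.
  rewrite {1}(mps_tailE f) (psiE f) !mulrDl !mulr_algl psiD psiZ.
  rewrite opprD addrACA subrr add0r !mulr_suml psi_sum -sumrB.
  by apply: eq_bigr => i _; rewrite -mulrA psiX -mulrA -mulrBr.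
exists (@mk_lrmorph _ _ _ (mk_rmorph psiD psiM psi1) psiZ) => i /=.
by rewrite -[mpsX A i]mulr1 psiX psi1 mulr1.
Qed.

(** The difference of the two maps solves the homogeneous system, so separation of the target for
    the images of the variables takes the place of continuity. *)
Lemma mps_hom_eq (T : comNzRingType) (g h : {rmorphism mps n A -> T}) :
  tsep (fun i => g (mpsX A i)) -> (forall c, g c%:A = h c%:A) ->
  (forall i, g (mpsX A i) = h (mpsX A i)) -> g =1 h.
Proof.
move=> gS hA gX f; apply/eqP; rewrite -subr_eq0; apply/eqP.
apply: (tsepF (T := @mps_tail n A) (D := fun f => g f - h f) gS) => {}f.
rewrite {1 2}(mps_tailE f) !rmorphD hA opprD addrACA subrr add0r.
rewrite !rmorph_sum -sumrB.
by apply: eq_bigr => i _; rewrite !rmorphM -gX -mulrBr.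
Qed.
End Evaluation.

(** * Order of power series: limits, completeness, separation *)

Section Filtration.
Variables (n : nat) (A : comNzRingType).
Implicit Types (f g : mps n A) (m : 'X_{1..n}).
Local Notation "f .[[ m ]]" := (mps_coef f m%MM) (at level 2, m at level 200).

Definition mps_ge d f := forall m, (mdeg m < d)%N -> f.[[m]] = 0.

Lemma mps_ge0 f : mps_ge 0 f. Proof. by []. Qed.
Lemma mps_ge_0 d : mps_ge d 0. Proof. by []. Qed.
Lemma mps_geD d f g : mps_ge d f -> mps_ge d g -> mps_ge d (f + g).
Proof. by move=> hf hg m md; rewrite mcoefD hf ?hg ?addr0. Qed.
Lemma mps_geN d f : mps_ge d f -> mps_ge d (- f).
Proof. by move=> hf m md; rewrite mcoefN hf ?oppr0. Qed.
Lemma mps_geB d f g : mps_ge d f -> mps_ge d g -> mps_ge d (f - g).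
Proof. by move=> hf hg; apply/mps_geD/mps_geN. Qed.
Lemma mps_ge_sum d (T : Type) (r : seq T) (P : pred T) (F : T -> mps n A) :
  (forall i, P i -> mps_ge d (F i)) -> mps_ge d (\sum_(i <- r | P i) F i).
Proof.
move=> h; apply: (big_ind (mps_ge d)) => //.
by move=> f g; apply: mps_geD.
Qed.
Lemma mps_ge_le d e f : (d <= e)%N -> mps_ge e f -> mps_ge d f.
Proof. by move=> de hf m md; rewrite hf // (leq_trans md). Qed.
Lemma mps_geM d e f g : mps_ge d f -> mps_ge e g -> mps_ge (d + e) (f * g).
Proof.
move=> hf hg m md; apply: (mcoefM_ind (L := [set 0])) => //.
  by move=> a b -> ->; rewrite addr0.
move=> k1 k2 e12; case: (ltnP (mdeg k1) d) => h1; first by rewrite hf ?mul0r.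
rewrite /= hg ?mulr0 //; rewrite -(ltn_add2l (mdeg k1)) -mdegD -e12.
by rewrite (leq_trans md) // leq_add2r.
Qed.
Lemma mps_geMl d f g : mps_ge d g -> mps_ge d (f * g).
Proof. by rewrite -[d in mps_ge d (_ * _)]add0n; apply: mps_geM. Qed.
Lemma mps_ge1 f : f.[[0]] = 0 -> mps_ge 1 f.
Proof. by move=> f0 m; rewrite ltnS leqn0 mdeg_eq0 => /eqP ->. Qed.
Lemma mps_ge_ext f : (forall d, mps_ge d f) -> f = 0.
Proof. by move=> h; apply: mpsext => m; rewrite (h (mdeg m).+1). Qed.
Lemma mps_ge_tail d i f : mps_ge d.+1 f -> mps_ge d (mps_tail i f).
Proof.
move=> hf m md; rewrite mcoef_tail; case: ifP => // _; rewrite hf //.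
by rewrite mdegD mdeg1 addn1.
Qed.

(** The coefficient at m no longer changes from the term of index deg m + 1 on, and is read off
    there. *)
Lemma mps_lim (s : nat -> mps n A) : (forall k, mps_ge k (s k.+1 - s k)) ->
  exists l, forall k, mps_ge k (l - s k).
Proof.
move=> hs; exists (MPS (fun m => (s (mdeg m).+1).[[m]])) => k m mk.
apply/eqP; rewrite mcoefB subr_eq0; apply/eqP; rewrite [LHS]/mps_coef.
elim: k mk => // k IHk; rewrite ltnS leq_eqVlt => /orP[/eqP -> //|mk].
rewrite IHk //; apply/esym/eqP; rewrite -subr_eq0 -mcoefB; apply/eqP.
exact: hs.
Qed.

(** Fixed point of a contraction: the b_i have no constant term, so the operator [F] raises the
    order of differences by one, and its iterates converge. *)
Lemma mps_tcomp n' (b : 'I_n' -> mps n A) (I : Type) (T : 'I_n' -> I -> I) :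
  (forall i, (b i).[[0]] = 0) -> tcomp b T.
Proof.
move=> b0 v; pose F (u : I -> mps n A) s := v s + \sum_i b i * u (T i s).
pose t k := iter k F (fun=> 0).
have FE u u' s : F u s - F u' s = \sum_i b i * (u (T i s) - u' (T i s)).
  rewrite opprD addrACA subrr add0r -sumrB.
  by apply: eq_bigr => i _; rewrite mulrBr.
have Fge k u u' : (forall s, mps_ge k (u s - u' s)) -> forall s, mps_ge k.+1 (F u s - F u' s).
  move=> h s; rewrite FE; apply: mps_ge_sum => i _.
  by rewrite -add1n; apply: mps_geM => //; apply: mps_ge1.
have tge k s : mps_ge k (t k.+1 s - t k s).
  by elim: k s => // k IHk s; apply: Fge.
have [l lE] := choice (fun s => mps_lim (fun k => tge k s)).
exists l => s; apply/eqP; rewrite -subr_eq0; apply/eqP; apply: mps_ge_ext => k.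
have -> : l s - (v s + \sum_i b i * l (T i s)) = (l s - t k.+1 s) - (F l s - t k.+1 s).
  by rewrite opprB addrA subrK.
apply: mps_geB; first exact: mps_ge_le (leqnSn k) (lE _ _).
by apply: mps_ge_le (leqnSn k) _; apply: Fge.
Qed.

(** A relative form of separation, by induction on the degree of the coefficient: a coefficient of
    b_i s'_i involves only coefficients of s'_i of smaller degree. L = 0 gives [tsep]; other ideals
    L give the estimates for substitutions. *)
Lemma mps_sep_mod n' (b : 'I_n' -> mps n A) (L : set A) (S : set (mps n A)) :
  is_ideal L -> (forall i, (b i).[[0]] = 0) ->
  (forall s, S s -> exists s' : 'I_n' -> mps n A,
     (forall i, S (s' i)) /\ forall m, L ((s - \sum_i b i * s' i).[[m]])) ->
  forall s, S s -> forall m, L (s.[[m]]).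
Proof.
move=> hL b0 hS s Ss m; have [d] := ubnP (mdeg m); elim: d s Ss m => // d IHd s Ss m md.
have [s' [s'S +] ] := hS s Ss => /(_ m) h.
rewrite -(subrK (\sum_i b i * s' i) s) mcoefD; apply: idealD => //.
rewrite mcoef_sum; apply: ideal_sum => // i _.
apply: mcoefM_ind => [|x y|k1 k2 e]; [exact: ideal0|exact: idealD|].
have [->|k10] := eqVneq k1 0%MM; first by rewrite b0 mul0r; apply: ideal0.
apply: idealM => //; apply: IHd => //; rewrite -(ltn_add2l (mdeg k1)) -mdegD -e.
rewrite (leq_trans md) // -[X in (X < _)%N]add0n -addSn leq_add2r lt0n mdeg_eq0 //.
Qed.

Lemma is_ideal0 (R : comNzRingType) : is_ideal [set 0 : R].
Proof. by split=> // [a b -> ->|a b ->]; rewrite /= ?addr0 ?mulr0. Qed.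

Lemma mps_tsep n' (b : 'I_n' -> mps n A) : (forall i, (b i).[[0]] = 0) -> tsep b.
Proof.
move=> b0 S hS s Ss; apply: mpsext => m.
apply: (mps_sep_mod (b := b) (S := S) (@is_ideal0 _)) => // {m Ss}s /hS[s' [s'S ->] ].
by exists s'; split=> // m; rewrite subrr.
Qed.

Lemma mps_subst n' (b : 'I_n' -> mps n A) : (forall i, (b i).[[0]] = 0) ->
  exists psi : {lrmorphism mps n' A -> mps n A}, forall i, psi (mpsX A i) = b i.
Proof. by move=> b0; apply: mps_ev; [apply: mps_tsep|apply: mps_tcomp]. Qed.

Lemma mcoefX0 (i : 'I_n) : (mpsX A i).[[0]] = 0.
Proof. by rewrite mcoefX eq_sym mnm1_eq0. Qed.

Lemma mps_inv f c : f.[[0]] * c = 1 -> exists g, f * g = 1.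
Proof.
(* The geometric series in 1 - c f, obtained as the solution of t = 1 + (1 - c f) t. *)
move=> fc; have [t tE] : exists t : unit -> mps n A, forall s,
    t s = 1 + \sum_(i < 1) (1 - c *: f) * t s.
  apply: (@mps_tcomp 1 (fun=> 1 - c *: f) unit (fun _ => id)) => i.
  by rewrite mcoefB mcoefZ mcoef1 eqxx mulrC fc subrr.
exists (c *: t tt); have := tE tt; rewrite big_ord1 mulrBl mul1r => e.
rewrite -scalerAr scalerAl.
by apply: (addrI (t tt - c *: f * t tt)); rewrite subrK addrC.
Qed.

Lemma mps_maxid (f : mps n A) : maxid _ f <-> ~ exists c, f.[[0]] * c = 1.
Proof.
split=> [h [c /mps_inv[g fg] ]|h [g fg] ]; first by apply: h; exists g.
by apply: h; exists (g.[[0]]); rewrite -mcoefM0 fg mcoef1 eqxx.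
Qed.

End Filtration.

Lemma maxid_field (K : fieldType) (a : K) : (~ exists c, a * c = 1) <-> a = 0.
Proof.
split=> [h|-> [c]]; last by rewrite mul0r => /esym/eqP; rewrite oner_eq0.
by apply: contrapT => /eqP a0; apply: h; exists a^-1; rewrite mulfV.
Qed.

Lemma mps_maxid_field n (K : fieldType) (f : mps n K) : maxid _ f <-> mps_coef f 0%MM = 0.
Proof. by rewrite mps_maxid maxid_field. Qed.

Lemma mps_domain_inv n (K : fieldType) (f : mps n K) : mps_coef f 0%MM <> 0 -> exists g, f * g = 1.
Proof. by move=> f0; apply: (@mps_inv _ _ _ (mps_coef f 0%MM)^-1); rewrite mulfV //; apply/eqP. Qed.

Definition coefs_in n (A : comNzRingType) (L : set A) : set (mps n A) :=
  [set f | forall m, L (mps_coef f m)].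

Section Derivation.
Variables (n : nat) (A : comNzRingType).
Implicit Types (f g : mps n A).

Lemma mcoef_deriv i f m : mps_coef (mps_deriv i f) m = mps_coef f (m + U_(i))%MM *+ (m i).+1.
Proof. by []. Qed.

Lemma mps_derivD i f g : mps_deriv i (f + g) = mps_deriv i f + mps_deriv i g.
Proof. by apply: mpsext => m; rewrite mcoefD !mcoef_deriv mcoefD mulrnDl. Qed.
Lemma mps_derivZ i c f : mps_deriv i (c *: f) = c *: mps_deriv i f.
Proof. by apply: mpsext => m; rewrite mcoefZ !mcoef_deriv mcoefZ mulrnAr. Qed.
Lemma mps_deriv0 i : mps_deriv i (0 : mps n A) = 0.
Proof. by apply: mpsext => m; rewrite mcoef_deriv mul0rn. Qed.
Lemma mps_derivA i c : mps_deriv i (c%:A : mps n A) = 0.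
Proof.
apply: mpsext => m; rewrite mcoef_deriv mcoefA -mdeg_eq0 mdegD mdeg1 addn1.
by rewrite mulr0n mul0rn.
Qed.

Lemma mps_derivX i j f :
  mps_deriv i (mpsX A j * f) = f *+ (i == j) + mpsX A j * mps_deriv i f.
Proof.
apply: mpsext => m; rewrite mcoef_deriv mcoefD.
have cMn (c : nat) g : mps_coef (g *+ c) m = mps_coef g m *+ c.
  by elim: c => // c IHc; rewrite !mulrSr mcoefD IHc.
rewrite cMn.
have [<-|ij] := eqVneq i j.
  rewrite mcoefXM mulr1n.
  case mi: (m i) => [|r]; first by rewrite mcoefXM0 ?addr0.
  have em : m = (m - U_(i) + U_(i))%MM.
    rewrite submK //; apply/mnm_lepP => l; rewrite mnm1E.
    by case: eqP => // <-; rewrite mi.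
  rewrite [in RHS]em mcoefXM mcoef_deriv -em mulrS; congr (_ + _ *+ _).
  by rewrite mnmBE mi mnm1E eqxx subn1.
rewrite mulr0n add0r.
case mj: (m j) => [|r].
  by rewrite !mcoefXM0 ?mul0rn // mnmDE mj mnm1E (negPf ij).
have em : m = (m - U_(j) + U_(j))%MM.
  rewrite submK //; apply/mnm_lepP => l; rewrite mnm1E.
  by case: eqP => // <-; rewrite mj.
rewrite [in RHS]em mcoefXM mcoef_deriv.
have -> : (m + U_(i))%MM = (m - U_(j) + U_(i) + U_(j))%MM.
  by rewrite [in LHS]em -!addmA (addmC U_(j)%MM).
by rewrite mcoefXM mnmBE mnm1E eq_sym (negPf ij) subn0.
Qed.

(** The defect of the product rule satisfies D f = sum X_j D(tail_j f), hence vanishes by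
    separation; this avoids convolution sums of coefficients. *)
Lemma mps_derivM i f g :
  mps_deriv i (f * g) = f * mps_deriv i g + g * mps_deriv i f.
Proof.
apply/eqP; rewrite -subr_eq0; apply/eqP.
apply: (tsepF (b := mpsX A) (T := @mps_tail n A) (D := fun f => mps_deriv i (f * g) -
   (f * mps_deriv i g + g * mps_deriv i f))).
  by apply: mps_tsep => j; apply: mcoefX0.
move=> {}f; rewrite {1 2 3}(mps_tailE f).
have dsum (F : 'I_n -> mps n A) : mps_deriv i (\sum_j F j) = \sum_j mps_deriv i (F j).
  exact: (big_morph _ (mps_derivD i) (mps_deriv0 i)).
rewrite !mulrDl !mulr_algl !mps_derivD mps_derivZ mps_derivA add0r.
rewrite !mulr_suml !dsum !mulr_sumr.
have -> : \sum_j mpsX A j * (mps_deriv i (mps_tail j f * g) -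
      (mps_tail j f * mps_deriv i g + g * mps_deriv i (mps_tail j f))) =
    \sum_j mps_deriv i (mpsX A j * mps_tail j f * g) -
   (\sum_j mpsX A j * mps_tail j f * mps_deriv i g +
     \sum_j g * mps_deriv i (mpsX A j * mps_tail j f)).
  rewrite -big_split -sumrB /=; apply: eq_bigr => j _.
  rewrite -(mulrA (mpsX A j) _ g) !mps_derivX; case: (i == j); rewrite ?mulr1n ?mulr0n; ring.
ring.
Qed.

End Derivation.

Section MapSeries.
Variables (n : nat) (A A' : comNzRingType) (phi : {rmorphism A -> A'}).

Definition map_mps (f : mps n A) : mps n A' := MPS (fun m => phi (mps_coef f m)).

Fact map_mps_zmod : zmod_morphism map_mps.
Proof. by move=> f g; apply: mpsext => m; rewrite /mps_coef /= -rmorphB. Qed.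
Fact map_mps_monoid : monoid_morphism map_mps.
Proof.
split=> [|f g]; apply: mpsext => m; rewrite ?mcoef1 ?mcoefM [LHS]/mps_coef /=.
  by rewrite mcoef1 rmorph_nat.
by rewrite mcoefM rmorph_sum; apply: eq_bigr => k _; rewrite rmorphM.
Qed.
HB.instance Definition _ :=
  GRing.isZmodMorphism.Build (mps n A) (mps n A') map_mps map_mps_zmod.
HB.instance Definition _ :=
  GRing.isMonoidMorphism.Build (mps n A) (mps n A') map_mps map_mps_monoid.

Lemma mcoef_map f m : mps_coef (map_mps f) m = phi (mps_coef f m).
Proof. by []. Qed.

Lemma map_mpsA c : map_mps c%:A = (phi c)%:A.
Proof. by apply: mpsext => m; rewrite mcoef_map !mcoefA rmorphMn. Qed.
Lemma map_mpsZ c f : map_mps (c *: f) = phi c *: map_mps f.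
Proof. by rewrite -mulr_algl rmorphM /= map_mpsA mulr_algl. Qed.
Lemma map_mpsX i : map_mps (mpsX A i) = mpsX A' i.
Proof. by apply: mpsext => m; rewrite mcoef_map !mcoefX rmorph_nat. Qed.
Lemma map_mps_deriv i f : map_mps (mps_deriv i f) = mps_deriv i (map_mps f).
Proof. by apply: mpsext => m; rewrite mcoef_map !mcoef_deriv rmorphMn. Qed.
Lemma map_mps_surj : surj phi -> surj map_mps.
Proof.
move=> /choice[s sK] g; exists (MPS (fun m => s (mps_coef g m))).
by apply: mpsext => m; rewrite mcoef_map /mps_coef sK.
Qed.
End MapSeries.
Arguments map_mps {n A A'} phi f.

(** * Artinian algebras and flatness *)

Section Span.
Variables (K : fieldType) (V : lmodType K).

Definition subspace (W : set V) :=
  [/\ W 0, (forall u v, W u -> W v -> W (u + v)) & forall c u, W u -> W (c *: u)].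

Fixpoint lspan (s : seq V) : set V :=
  if s is e :: s' then [set v | exists c, lspan s' (v - c *: e)] else [set 0].

Lemma lspanS (s : seq V) : subspace (lspan s).
Proof.
elim: s => [|e s [s0 sD sZ]] /=.
  by split=> // [u v -> ->|c u ->]; rewrite ?addr0 ?scaler0.
split=> [|u v [c hc] [d hd]|k u [c hc]].
- by exists 0; rewrite scale0r subr0.
- by exists (c + d); rewrite scalerDl opprD addrACA; apply: sD.
- by exists (k * c); rewrite -scalerA -scalerBr; apply: sZ.
Qed.

Lemma lspanB (s : seq V) u v : lspan s u -> lspan s v -> lspan s (u - v).
Proof.
by have [_ sD sZ] := lspanS s => su sv; apply: sD => //; rewrite -scaleN1r; apply: sZ.
Qed.

Lemma lspan_cons e s : lspan s `<=` lspan (e :: s).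
Proof. by move=> v sv; exists 0; rewrite scale0r subr0. Qed.

Lemma lspan_head e s : lspan (e :: s) e.
Proof. by exists 1; rewrite scale1r subrr; have [] := lspanS s. Qed.

Lemma lspan_mem s e : e \in s -> lspan s e.
Proof.
elim: s => // a s IHs; rewrite inE => /orP[/eqP ->|/IHs]; first exact: lspan_head.
exact: lspan_cons.
Qed.

Lemma lspan_min s (W : set V) : subspace W -> (forall e, e \in s -> W e) -> lspan s `<=` W.
Proof.
case=> W0 WD WZ; elim: s => [|e s IHs] sW v /=; first by move=> ->.
case=> c hc; rewrite -(subrK (c *: e) v); apply: WD; last by apply/WZ/sW/mem_head.
by apply: IHs hc => u us; apply: sW; rewrite inE us orbT.
Qed.

Lemma lspan_coord s v : lspan s v ->
  exists c : nat -> K, v = \sum_(i < size s) c i *: s`_i.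
Proof.
elim: s v => [|e s IHs] v /=; first by move=> ->; exists (fun=> 0); rewrite big_ord0.
case=> c /IHs[d dE]; exists (fun i => if i is i'.+1 then d i' else c).
by rewrite big_ord_recl /= -[LHS](subrK (c *: e)) addrC dE.
Qed.

(** Induction on the spanning list: of two nested subspaces, the smaller equals the larger if both
    meet the span of [s] in the same subspace and both or neither contain a vector with nonzero
    [e]-coordinate. Each of these data stabilises along the chain. *)
Lemma lspan_dcc (s : seq V) (W : nat -> set V) :
  (forall k, subspace (W k)) -> (forall k, W k `<=` lspan s) ->
  (forall k, W k.+1 `<=` W k) -> exists N, forall k, (N <= k)%N -> W k = W N.
Proof.
elim: s W => [|e s IHs] W WS Ws Wd.
  have W0 k : W k = [set 0].
    by apply/seteqP; split=> [v /Ws //|v ->]; have [] := WS k.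
  by exists 0%N => k _; rewrite !W0.
have Wle k l : (k <= l)%N -> W l `<=` W k.
  elim: l => [|l IHl]; first by rewrite leqn0 => /eqP ->.
  by rewrite leq_eqVlt => /orP[/eqP ->//|kl] v /Wd; apply: IHl.
have WB k u v : W k u -> W k v -> W k (u - v).
  by have [_ D Z] := WS k => Wu Wv; apply: D => //; rewrite -scaleN1r; apply: Z.
have [|||N1 hN1] := IHs (fun k => W k `&` lspan s).
- move=> k; have [a b c] := WS k; have [a' b' c'] := lspanS s.
  by split=> // [u v [? ?] [? ?]|d u [? ?]]; split; [apply: b|apply: b'|apply: c|apply: c'].
- by move=> k v [].
- by move=> k v [/Wd].
pose P k := exists v, W k v /\ exists2 c, c != 0 & lspan s (v - c *: e).
have Pd k l : (k <= l)%N -> P l -> P k by move=> kl [v [Wv ?]]; exists v; split=> //; apply: Wle Wv.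
have [N2 hN2] : exists N2, forall k, (N2 <= k)%N -> P N2 -> P k.
  have [h|/existsNP[N2 h]] := pselect (forall k, P k); first by exists 0%N.
  by exists N2 => k _ h'.
exists (maxn N1 N2) => k; rewrite geq_max => /andP[k1 k2]; apply/seteqP; split.
  by apply: Wle; rewrite geq_max k1.
move=> v Wv; have [c hc] := Ws _ _ Wv.
have W12 : W (maxn N1 N2) `&` lspan s `<=` W k.
  by rewrite (hN1 _ (leq_maxl _ _)) -(hN1 _ k1) => u [].
have [c0|c0] := eqVneq c 0.
  by apply: W12; split=> //; move: hc; rewrite c0 scale0r subr0.
have [u [Wu [d d0 hd]]] : P k.
  by apply: hN2 => //; apply: Pd (leq_maxr N1 N2) _; exists v; split=> //; exists c.
have [_ kD kZ] := WS k.
rewrite -(subrK ((c / d) *: u) v); apply: kD; last exact: kZ.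
apply: W12; split.
  apply: WB => //; have [_ _ Z] := WS (maxn N1 N2); apply: Z.
  by apply: Wle Wu; rewrite geq_max k1.
have -> : v - (c / d) *: u = (v - c *: e) - (c / d) *: (u - d *: e).
  by rewrite scalerBr scalerA divfK // opprB addrA subrK.
by apply: lspanB => //; have [_ _ Z] := lspanS s; apply: Z.
Qed.

End Span.

Section ArtinStructure.
Variables (K : fieldType) (A : comAlgType K).

Lemma ideal_subspace (I : set A) : is_ideal I -> subspace I.
Proof.
move=> hI; split=> [|u v|c u Iu]; [exact: ideal0|exact: idealD|].
by rewrite -mulr_algl; apply: idealM.
Qed.

Lemma alg_not_maxid (c : K) : c != 0 -> ~ maxid A c%:A.
Proof.
move=> c0; apply; exists (c^-1)%:A.
by rewrite -scalerAl mul1r scalerA mulfV // scale1r.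
Qed.

Lemma AC_residue : in_AC A -> exists res : {rmorphism A -> K},
  (forall c, res c%:A = c) /\ forall a, maxid A a <-> res a = 0.
Proof.
case=> hm _ /choice[r hr].
have rE a c : maxid A (a - c%:A) -> r a = c.
  move=> ac; apply: contrapT => /eqP; rewrite -subr_eq0 => /alg_not_maxid; apply.
  have -> : (r a - c)%:A = (a - c%:A) - (a - (r a)%:A).
    by rewrite scalerBl opprB [RHS]addrC addrA subrK.
  exact: (idealB hm).
have rD : {morph r : a b / a + b}.
  move=> a b; apply: rE; rewrite scalerDl opprD addrACA.
  exact: (idealD hm).
have rM : {morph r : a b / a * b}.
  move=> a b; apply: rE.
  have -> : a * b - (r a * r b)%:A = a * (b - (r b)%:A) + (r b)%:A * (a - (r a)%:A).
    by rewrite mulrC [r a * _]mulrC -scalerA -[r b *: (_ *: _)]mulr_algl; ring.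
  by apply: (idealD hm); apply: (idealM _ hm).
have r1 : r 1 = 1 by apply: rE; rewrite scale1r subrr; apply: (ideal0 hm).
exists (mk_rmorph rD rM r1); split=> [c|a] /=.
  by apply: rE; rewrite subrr; apply: (ideal0 hm).
split=> [ma|ra]; first by apply: rE; rewrite scale0r subr0.
by have := hr a; rewrite ra scale0r subr0.
Qed.

Lemma artinian_min (F : set (set A)) : artinian A -> (forall I, F I -> is_ideal I) ->
  (exists I, F I) -> exists I, F I /\ forall J, F J -> J `<=` I -> J = I.
Proof.
move=> art Fid [I0 FI0]; apply: contrapT => h.
have step (I : {I | F I}) : exists J : {I | F I}, sval J `<=` sval I /\ sval J <> sval I.
  apply: contrapT => h'; apply: h; exists (sval I); split; first exact: svalP.
  move=> J FJ JI; apply: contrapT => nJI; apply: h'.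
  by exists (exist _ J FJ).
have [g gE] := choice step.
have [N hN] := art (fun k => sval (iter k g (exist _ I0 FI0)))
  (fun k => Fid _ (svalP _)) (fun k => (gE _).1).
by have := (gE (iter N g (exist _ I0 FI0))).2; apply; apply: (hN N.+1).
Qed.

Lemma ideal_mulP (I J : set A) : is_ideal (ideal_mul I J).
Proof. exact: ideal_genP. Qed.

Lemma ideal_powP (I : set A) k : is_ideal (ideal_pow I k).
Proof. by case: k => [|k]; [split|apply: ideal_mulP]. Qed.

Lemma ideal_powS_sub (I : set A) k : ideal_pow I k.+1 `<=` ideal_pow I k.
Proof.
apply: ideal_gen_min; first exact: ideal_powP.
by move=> _ [a Ia [b Ib <-]]; apply: idealM => //; apply: ideal_powP.
Qed.

(** Let L = m L be the stable power. If L were nonzero, take I minimal among the ideals with I L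
    nonzero, and a in I with a L nonzero. Then a m lies in I and (a m) L = a L is nonzero, so a m =
    I and a = a m' with m' in m; since 1 - m' is a unit, a = 0. *)
Lemma artin_nilpotent : is_local A -> artinian A ->
  exists N, ideal_pow (maxid A) N = [set 0].
Proof.
move=> hm art.
have [N hN] := art _ (ideal_powP (maxid A)) (@ideal_powS_sub _).
set L := ideal_pow (maxid A) N.
have mL : ideal_mul (maxid A) L = L by apply: (hN N.+1).
exists N; apply: contrapT => L0.
have [l [Ll l0]] : exists l, L l /\ l <> 0.
  apply: contrapT => h; apply: L0; apply/seteqP; split=> [x Lx|_ ->].
    by apply: contrapT => x0; apply: h; exists x.
  by apply: ideal0; apply: ideal_powP.
pose F := [set I : set A | is_ideal I /\ exists a, I a /\ exists l, L l /\ a * l <> 0].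
have [||I [[hI [a [Ia [l' [Ll' al']]]]] Imin]] := @artinian_min F art.
- by move=> I [].
- by exists setT; split; [split|exists 1; split=> //; exists l; rewrite mul1r].
pose J := [set x | exists2 m, maxid A m & x = a * m].
have hJ : is_ideal J.
  split=> [|x y [m hm1 ->] [m' hm2 ->]|x y [m hm1 ->]].
  - by exists 0; rewrite ?mulr0 //; apply: (ideal0 hm).
  - by exists (m + m'); rewrite ?mulrDr //; apply: (idealD hm).
  - by exists (x * m); rewrite 1?mulrCA //; apply: (idealM _ hm).
have JI : J = I.
  apply: Imin => [|_ [m _ ->]]; last exact: idealMr.
  split=> //; apply: contrapT => h; apply: al'.
  have : L `<=` [set x | a * x = 0].
    rewrite -mL; apply: ideal_gen_min.
      split=> [|x y /= ax ay|x y /= ay]; rewrite /mkset ?mulr0 // ?mulrDr ?ax ?ay ?addr0 //.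
      by rewrite mulrCA ay mulr0.
    move=> _ [m hm1 [x Lx <-]] /=; apply: contrapT => amx; apply: h.
    by exists (a * m); split; [exists m|exists x; rewrite -mulrA].
  exact.
have [m hm1 am] : J a by rewrite JI.
have [[b mb]|nu] := pselect (exists b, (1 - m) * b = 1).
  apply: al'; rewrite -[a]mulr1 -mb mulrA mulrBr mulr1 -am subrr !mul0r //.
have : maxid A 1 by rewrite -(subrK m 1); apply: (idealD hm).
by apply; exists 1; rewrite mulr1.
Qed.

(* If no finite family spanned I modulo J, an infinite independent family would
   give a strictly descending chain of ideals between J and I. *)
Lemma artin_layer (I J : set A) (res : {rmorphism A -> K}) :
  artinian A -> (forall c, res c%:A = c) -> is_ideal I -> is_ideal J ->
  (forall a x, res a = 0 -> I x -> J (a * x)) -> J `<=` I ->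
  exists s : seq A, (forall e, e \in s -> I e) /\
    forall x, I x -> exists2 v, lspan s v & J (x - v).
Proof.
move=> art resA hI hJ mIJ JI; apply: contrapT => nfd.
pose P (s : seq A) x := exists2 v, lspan s v & J (x - v).
have PS s : subspace (P s).
  have [s0 sD sZ] := lspanS s; have [J0 JD JZ] := ideal_subspace hJ.
  split=> [|x y [u su Ju] [v sv Jv]|c x [u su Ju]].
  - by exists 0 => //; rewrite subr0.
  - by exists (u + v); [apply: sD|rewrite opprD addrACA; apply: JD].
  - by exists (c *: u); [apply: sZ|rewrite -scalerBr; apply: JZ].
have step (s : seq A) : exists x, (forall e, e \in s -> I e) -> I x /\ ~ P s x.
  apply: contrapT => /forallNP h; apply: nfd; exists s; split.
    move=> e es; apply: contrapT => nIe; apply: (h 0) => sI; case: nIe; exact: sI.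
  move=> x Ix; apply: contrapT => nP; apply: (h x) => _.
  by split=> // -[v sv Jv]; apply: nP; exists v.
have [g gE] := choice step.
pose S k := iter k (fun s => g s :: s) [::]; pose v k := g (S k).
have SI k : forall e, e \in S k -> I e.
  elim: k => // k IHk e; rewrite inE => /orP[/eqP ->|/IHk //].
  by have [] := gE (S k) IHk.
have vI k : I (v k) by have [] := gE (S k) (SI k).
have vN k : ~ P (S k) (v k) by have [] := gE (S k) (SI k).
pose U k l := iteri l (fun i (W : set A) => [set x | exists c, W (x - c *: v (k + i)%N)]) J.
have US k l : subspace (U k l).
  elim: l => [|l [U0 UD UZ]]; first exact: ideal_subspace.
  split=> [|x y [c hc] [d hd]|a x [c hc]].
  - by exists 0; rewrite scale0r subr0.
  - by exists (c + d); rewrite scalerDl opprD addrACA; apply: UD.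
  - by exists (a * c); rewrite -scalerA -scalerBr; apply: UZ.
have Ule k l l' : (l <= l')%N -> U k l `<=` U k l'.
  elim: l' => [|l' IHl]; first by rewrite leqn0 => /eqP ->.
  rewrite leq_eqVlt => /orP[/eqP ->//|/IHl h] x /h ?.
  by exists 0; rewrite scale0r subr0.
have UI k l : U k l `<=` I.
  elim: l => [|l IHl] x; first exact: JI.
  case=> c /IHl hc.
  rewrite -(subrK (c *: v (k + l)%N) x); apply: (idealD hI hc).
  by rewrite -mulr_algl; apply: (idealM _ hI).
have UJ k l : J `<=` U k l by apply: (Ule k 0%N).
(* [W k] is J plus the span of all v_i with i >= k. It is an ideal because A is K plus its maximal
   ideal, and the latter carries I into J. *)
pose W k := [set x | exists l, U k l x].
have WI k : is_ideal (W k).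
  split=> [|x y [l hl] [l' hl']|a x [l hl]].
  - by exists 0%N; apply: ideal0.
  - exists (maxn l l'); have [_ D _] := US k (maxn l l').
    by apply: D; [apply: Ule hl; apply: leq_maxl|apply: Ule hl'; apply: leq_maxr].
  - exists l; have [_ D Z] := US k l; rewrite -(subrK (res a)%:A a) mulrDl mulr_algl.
    apply: D; last exact: Z.
    apply: UJ; apply: mIJ; last exact: UI hl.
    by rewrite rmorphB resA subrr.
have Wd k : W k.+1 `<=` W k.
  move=> x [l hl]; exists l.+1; elim: l x hl => [|l IHl] x /=.
    by move=> Jx; exists 0; rewrite scale0r subr0.
  by case=> c /IHl hc; exists c; rewrite addnS -addSn.
have [N hN] := art W WI Wd.
have [l] : W N.+1 (v N).
  by rewrite (hN N.+1) //; exists 1%N, 1; rewrite addn0 scale1r subrr; apply: ideal0.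
have UP l' : U N.+1 l' `<=` P (S (N.+1 + l')%N).
  elim: l' => [|l' IHl] x; first by move=> Jx; exists 0; rewrite ?subr0 //; have [] := lspanS (S (N.+1 + 0)%N).
  case=> c /IHl [u su Ju]; rewrite addnS.
  exists (u + c *: v (N.+1 + l')%N); last by rewrite opprD addrA addrAC.
  by exists c; rewrite addrK.
(* Now v_N is, modulo J, a combination of later v_i. The last nonzero coefficient exhibits its v_i
   as a combination of the preceding ones, against their choice. *)
elim: l => [|l IHl] /=.
  move=> JvN; apply: (vN N); exists 0; rewrite ?subr0 //; by have [] := lspanS (S N).
case=> c; have [->|c0] := eqVneq c 0; first by rewrite scale0r subr0; apply: IHl.
move=> hc; apply: (vN (N.+1 + l)%N).
have [_ PD PZ] := PS (S (N.+1 + l)%N).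
have -> : v (N.+1 + l)%N = c^-1 *: (v N - (v N - c *: v (N.+1 + l)%N)).
  by rewrite opprB addrC subrK scalerA mulVf // scale1r.
apply: (PZ); rewrite -scaleN1r; apply: PD; last by apply/PZ/UP.
exists (v N); last by rewrite subrr; apply: ideal0.
elim: l {IHl hc PZ} => [|l IHl]; first by rewrite addn0; apply: lspan_head.
by rewrite addnS; apply: lspan_cons.
Qed.

(* The list t is such that, for every suffix e :: t', the span of t' is an
   ideal which contains maxid A * e but not e. *)
Fixpoint flag_seq (t : seq A) : Prop :=
  if t is e :: t' then
    [/\ flag_seq t', ~ lspan t' e & forall a, maxid A a -> lspan t' (a * e)]
  else True.

(** The filtration by powers of the maximal ideal is refined, starting from the power that is 0: a
    finite family spanning the next layer is added one element at a time, skipping those already in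
    the span. *)
Lemma AC_flag_seq (res : {rmorphism A -> K}) :
  in_AC A -> (forall c, res c%:A = c) -> (forall a, maxid A a <-> res a = 0) ->
  exists t, flag_seq t /\ lspan t = setT.
Proof.
case=> hm art _ resA resP; have [N hN] := artin_nilpotent hm art.
suff h k : (k <= N)%N -> exists t, flag_seq t /\ lspan t = ideal_pow (maxid A) (N - k).
  by have := h N (leqnn N); rewrite subnn.
elim: k => [|k IHk] kN; first by exists [::]; split; rewrite ?subn0 ?hN.
have [t [ft tE]] := IHk (ltnW kN).
have e : (N - k)%N = (N - k.+1).+1 by rewrite subnS prednK // subn_gt0.
set I := ideal_pow _ (N - k.+1).
have IJ : lspan t `<=` I by rewrite tE e; apply: ideal_powS_sub.
have mIJ a x : maxid A a -> I x -> lspan t (a * x).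
  by move=> ma Ix; rewrite tE e; apply: ideal_gen_sub; exists a => //; exists x.
have hI : is_ideal I by apply: ideal_powP.
have ht : is_ideal (lspan t) by rewrite tE; apply: ideal_powP.
have [|s [sI hs]] := artin_layer art resA hI ht _ IJ.
  by move=> a x /resP; apply: mIJ.
suff h (s' : seq A) : (forall e, e \in s' -> I e) -> exists t', [/\ flag_seq t', lspan t `<=` lspan t',
    lspan t' `<=` I & forall e, e \in s' -> lspan t' e].
  have [t' [ft' tt' t'I st']] := h s sI; exists t'; split=> //.
  apply/seteqP; split=> // x /hs[v sv xv]; rewrite -(subrK v x).
  have [_ D _] := lspanS t'; apply: D; first exact: tt'.
  exact: (lspan_min (lspanS t') st').
elim: s' => [|a s' IHs] sI'; first by exists t; split=> //; apply: subset_refl.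
have [u us'|t' [ft' tt' t'I st']] := IHs; first by apply: sI'; rewrite inE us' orbT.
have Ia : I a by apply/sI'/mem_head.
have [t'a|nt'a] := pselect (lspan t' a).
  by exists t'; split=> // u; rewrite inE => /orP[/eqP ->|/st'].
exists (a :: t'); split=> //.
- by split=> // b mb; apply/tt'/mIJ.
- by move=> x /tt'; apply: lspan_cons.
- apply: lspan_min; first exact: ideal_subspace.
  by move=> u; rewrite inE => /orP[/eqP ->//|/lspan_mem /t'I].
- move=> u; rewrite inE => /orP[/eqP ->|/st']; [exact: lspan_head|exact: lspan_cons].
Qed.

(* e is a K-basis of A with coordinates c, adapted to the filtration by the
   ideals spanned by the final segments of e. *)
Definition flag_basis (res : A -> K) (r : nat) (e : 'I_r -> A) (c : 'I_r -> A -> K) :=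
  [/\ forall a, a = \sum_i c i a *: e i,
      forall i k a b, c i (k *: a + b) = k * c i a + c i b,
      forall i j, c i (e j) = (i == j)%:R
    & forall a (i j : 'I_r), res a = 0 -> (j <= i)%N -> c j (a * e i) = 0].

Lemma flag_seq_indep t (c : nat -> K) : flag_seq t -> \sum_(i < size t) c i *: t`_i = 0 ->
  forall i, (i < size t)%N -> c i = 0.
Proof.
elim: t c => // e t IHt c /= [ft ne me]; rewrite big_ord_recl /= => h.
have c0 : c 0%N = 0.
  apply: contrapT => /eqP c0; apply: ne.
  have -> : e = - (c 0%N)^-1 *: \sum_(i < size t) c (bump 0 i) *: t`_i.
    move/eqP: h; rewrite addr_eq0 => /eqP h.
    by rewrite scaleNr -scalerN -h scalerA mulVf // scale1r.
  have [s0 sD sZ] := lspanS t; apply: (sZ).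
  apply: (@big_ind _ (lspan t)) => // i _; apply: sZ.
  by apply: lspan_mem; apply: mem_nth.
move: h; rewrite c0 scale0r add0r => /(IHt (fun i => c i.+1) ft) h [|i] //.
exact: h.
Qed.

Lemma AC_flag : in_AC A -> exists (res : {rmorphism A -> K}) r (e : 'I_r -> A) c,
  [/\ forall k, res k%:A = k, forall a, maxid A a <-> res a = 0 & flag_basis res e c].
Proof.
move=> AC; have [res [resA resP]] := AC_residue AC.
have [t [ft tT]] := AC_flag_seq AC resA resP.
have tA a : lspan t a by rewrite tT.
have [c cE] := choice (fun a => lspan_coord (tA a)).
have cU a (d : nat -> K) : a = \sum_(i < size t) d i *: t`_i ->
    forall i, (i < size t)%N -> c a i = d i.
  move=> aE i it; apply/eqP; rewrite -subr_eq0; apply/eqP.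
  apply: (@flag_seq_indep t (fun i => c a i - d i)) => //.
  have -> : \sum_(i < size t) (c a i - d i) *: t`_i =
     \sum_(i < size t) c a i *: t`_i - \sum_(i < size t) d i *: t`_i.
    by rewrite -sumrB; apply: eq_bigr => j _; rewrite scalerBl.
  by rewrite -cE -aE subrr.
exists res, (size t), (fun i => t`_i), (fun i a => c a i); split=> //; split=> //.
- move=> i k a b; apply: (cU _ (fun i => k * c a i + c b i)) => //.
  rewrite {1}(cE a) {1}(cE b) scaler_sumr -big_split.
  by apply: eq_bigr => j _; rewrite scalerDl scalerA.
- move=> i j; apply: (cU _ (fun i => (i == j :> nat)%:R)) => //.
  rewrite (bigD1 j) //= eqxx scale1r big1 ?addr0 // => l /negPf lj.
  by rewrite val_eqE lj scale0r.
move=> a i j /resP ma ji.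
(* The flag places a e_i in the span of the later elements; [d'] re-indexes the coordinates there so
   that they start at i + 1. *)
have : lspan (drop i.+1 t) (a * t`_i).
  move: ft; clear -ma; case: i => i /=; elim: t i => // e t IHt [|i] /= it [ft _ me].
    by rewrite drop0; apply: me.
  exact: IHt.
case/lspan_coord => d dE.
pose d' l := if (l <= i)%N then 0 else d (l - i.+1)%N.
rewrite (cU _ d') // /d' ?ji // dE.
have st : size t = (i.+1 + size (drop i.+1 t))%N by rewrite size_drop subnKC.
rewrite -(big_mkord xpredT (fun l => (if (l <= i)%N then 0 else d (l - i.+1)%N) *: t`_l)).
rewrite (@big_cat_nat _ _ _ i.+1) ?ltn_ord //= [X in X + _]big1_seq ?add0r => [|l /andP[_]]; last first.
  by rewrite mem_index_iota => /andP[_ li]; rewrite -ltnS li scale0r.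
transitivity (\sum_(0 + i.+1 <= l < size t) d' l *: t`_l); last by rewrite add0n.
rewrite big_addn size_drop big_mkord; apply: eq_bigr => l _.
by rewrite /d' leqNgt leq_addl /= addnK nth_drop addnC.
Qed.

Lemma AC_span : in_AC A -> exists s : seq A, lspan s = setT.
Proof.
move=> AC; have [res [resA resP]] := AC_residue AC.
by have [t [_ tT]] := AC_flag_seq AC resA resP; exists t.
Qed.

(** Finite dimension gives the descending chain condition, and a scalar plus a nilpotent is either
    nilpotent or a unit, so the non-units are the nilpotents. Serves for images of algebra maps and
    for the dual numbers. *)
Lemma AC_intro (V : lmodType K) (i : {linear A -> V}) (s : seq V) :
  injective i -> (forall a, lspan s (i a)) ->
  (forall a : A, exists c n, (a - c%:A) ^+ n = 0) -> in_AC A.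
Proof.
move=> iI sT nil.
have nilN (a : A) n : a ^+ n = 0 -> maxid A a.
  move=> an [b ab]; have := exprMn_comm n (mulrC a b).
  by rewrite ab an mul0r expr1n => /eqP; rewrite oner_eq0.
have nilP (a : A) : maxid A a -> exists n, a ^+ n = 0.
  move=> ma; have [c [n h]] := nil a.
  have [c0|c0] := eqVneq c 0; first by exists n; rewrite -h c0 scale0r subr0.
  (* Modulo a, the power (a - c)^k is (-c)^k; when it vanishes with c nonzero, a is invertible. *)
  have dvd k : exists q, (a - c%:A) ^+ k = a * q + (- c) ^+ k *: 1.
    elim: k => [|k [q IHk]]; first by exists 0; rewrite mulr0 add0r !expr0 scale1r.
    exists ((a - c%:A) * q + ((- c) ^+ k)%:A).
    rewrite exprS IHk exprS -scalerA -[(- c) *: _ in RHS]mulr_algl scaleNr; ring.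
  have [q] := dvd n; rewrite h => /esym/eqP; rewrite addr_eq0 => /eqP aq.
  case: ma; exists (- ((- c) ^+ n)^-1 *: q).
  rewrite -scalerAr aq scaleNr -scalerN opprK scalerA mulVf ?scale1r //.
  by rewrite expf_neq0 // oppr_eq0.
split.
- split=> [|a b /nilP[n an] /nilP[m bm]|a b /nilP[m bm]].
  + by apply: (nilN _ 1%N); rewrite expr1.
  + apply: (nilN _ (n + m)%N); rewrite exprDn big1 // => l _.
    case: (leqP n (n + m - l)%N) => h.
      by rewrite -(subnK h) exprD an mulr0 mul0r mul0rn.
    have mi : (m <= l)%N by rewrite leqNgt; apply/negP => lm; move: h; rewrite ltnNge -addnBA ?leq_addr // ltnW.
    by rewrite -(subnK mi) [b ^+ _]exprD bm !mulr0 mul0rn.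
  + by apply: (nilN _ m); rewrite exprMn bm mulr0.
- move=> I hI Id.
  have [|k _ [a _ <-] //|k|N hN] := @lspan_dcc K V s (fun k => i @` I k).
  + move=> k; have [I0 ID IZ] := ideal_subspace (hI k).
    split=> [|_ _ [a Ia <-] [b Ib <-]|c _ [a Ia <-]].
    * by exists 0; rewrite ?linear0.
    * by exists (a + b); rewrite ?linearD //; apply: ID.
    * by exists (c *: a); rewrite ?linearZ //; apply: IZ.
  + by move=> _ [a /Id Ia <-]; exists a.
  exists N => k /hN e; apply/seteqP; split=> a Ia.
    have : (i @` I k) (i a) by exists a.
    by rewrite e => -[b Ib /iI <-].
  have : (i @` I N) (i a) by exists a.
  by rewrite -e => -[b Ib /iI <-].
- by move=> a; have [c [n h]] := nil a; exists c; apply: nilN h.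
Qed.

End ArtinStructure.

(** * Consequences and criteria of flatness along a flag *)

Section IdealModule.
Variables (A : comNzRingType) (I : set A).

(** The proof [hI] is an argument so that the submodule structure can be attached to the predicate
    itself; the ideal thus becomes a module to which [flat] applies. *)
Definition ideal_pred (hI : is_ideal I) : {pred A^o} := fun a => `[< I a >].

Variable hI : is_ideal I.

Fact ideal_pred_submod : GRing.submod_closed (ideal_pred hI).
Proof.
split=> [|a u v].
  by apply/asboolP; apply: (ideal0 hI).
move=> /asboolP Iu /asboolP Iv; apply/asboolP; apply: (idealD hI) => //.
exact: (idealM _ hI).
Qed.
HB.instance Definition _ := GRing.isSubmodClosed.Build A A^o (ideal_pred hI) ideal_pred_submod.

Record ideal_module := IdealModule { ideal_val : A^o; _ : ideal_val \in ideal_pred hI }.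
HB.instance Definition _ := [isSub for ideal_val].
HB.instance Definition _ := [Choice of ideal_module by <:].
HB.instance Definition _ := [SubChoice_isSubLmodule of ideal_module by <:].

Lemma ideal_moduleP (n : ideal_module) : I (ideal_val n).
Proof. by apply/asboolP; case: n. Qed.

Lemma ideal_module_of a : I a -> exists n : ideal_module, ideal_val n = a.
Proof. by move=> /asboolP Ia; exists (@IdealModule a Ia). Qed.

Definition ideal_incl : {linear ideal_module -> A^o} := (\val : ideal_module -> A^o).

Lemma ideal_incl_inj : injective ideal_incl. Proof. exact: val_inj. Qed.
End IdealModule.

(* The A-module obtained from a K-vector space by restriction along A -> K. *)
Section ResidueModule.
Variables (K A : comNzRingType) (res : {rmorphism A -> K}) (P : lmodType K).

Definition res_module (_ : A -> K) (V : Type) : Type := V.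
Local Notation M := (res_module res P).
HB.instance Definition _ := GRing.Zmodule.copy M P.

Let scale (a : A) (v : M) : M := res a *: (v : P).
Fact res_scaleA a b v : scale a (scale b v) = scale (a * b) v.
Proof. by rewrite /scale scalerA rmorphM. Qed.
Fact res_scale1 : left_id 1 scale.
Proof. by move=> v; rewrite /scale rmorph1 scale1r. Qed.
Fact res_scaleDr : right_distributive scale +%R.
Proof. by move=> a u v; rewrite /scale -scalerDr. Qed.
Fact res_scaleDl v : {morph scale^~ v : a b / a + b}.
Proof. by move=> a b; rewrite /scale rmorphD scalerDl. Qed.
HB.instance Definition _ := GRing.Zmodule_isLmodule.Build A M
  res_scaleA res_scale1 res_scaleDr res_scaleDl.

End ResidueModule.

Section FlagFiltration.
Variables (K : fieldType) (A : comAlgType K) (res : {rmorphism A -> K}).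
Variables (r : nat) (e : 'I_r -> A) (c : 'I_r -> A -> K).
Hypothesis resA : forall k, res k%:A = k.
Hypothesis fl : flag_basis res e c.

Lemma flag_sum a : a = \sum_i c i a *: e i. Proof. by case: fl. Qed.
Lemma flagZD i k a b : c i (k *: a + b) = k * c i a + c i b. Proof. by case: fl. Qed.
Lemma flagD i a b : c i (a + b) = c i a + c i b.
Proof. by rewrite -[a]scale1r flagZD mul1r scale1r. Qed.
Lemma flag0 i : c i 0 = 0.
Proof. by apply: (addrI (c i 0)); rewrite -flagD !addr0. Qed.
Lemma flagZ i k a : c i (k *: a) = k * c i a.
Proof. by rewrite -[k *: a]addr0 flagZD flag0 addr0. Qed.
Lemma flagN i a : c i (- a) = - c i a.
Proof. by rewrite -scaleN1r flagZ mulN1r. Qed.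
Lemma flagB i a b : c i (a - b) = c i a - c i b.
Proof. by rewrite flagD flagN. Qed.
Lemma flag_fsum i (T : Type) (s : seq T) (Q : pred T) (F : T -> A) :
  c i (\sum_(t <- s | Q t) F t) = \sum_(t <- s | Q t) c i (F t).
Proof. exact: (big_morph _ (flagD i) (flag0 i)). Qed.
Lemma flagE i j : c i (e j) = (i == j)%:R. Proof. by case: fl. Qed.

Lemma flag_mulE x (l j : 'I_r) : (j <= l)%N -> c j (x * e l) = res x * (j == l)%:R.
Proof.
move=> jl; rewrite -(subrK (res x)%:A x) mulrDl flagD mulr_algl flagZ flagE.
case: fl => _ _ _ -> //; last by rewrite rmorphB resA subrr.
by rewrite add0r subrK.
Qed.

Definition flag_ideal (i : nat) : set A := [set a | forall j : 'I_r, (j < i)%N -> c j a = 0].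

(** On the lowest coordinate multiplication acts through the residue field, since x - res x moves
    every e_l strictly up the flag. *)
Lemma flag_mul x a (i : 'I_r) : flag_ideal i a -> c i (x * a) = res x * c i a.
Proof.
move=> Ia; rewrite {1}(flag_sum a) mulr_sumr flag_fsum (bigD1 i) //= big1 => [|l li].
  by rewrite -scalerAr flagZ flag_mulE // eqxx mulr1 addr0 mulrC.
rewrite -scalerAr flagZ; have [il|li'] := leqP i l.
  by rewrite flag_mulE // eq_sym (negPf li) mulr0 mulr0.
by rewrite Ia // mul0r.
Qed.

Lemma flag_ideal_le i j : (i <= j)%N -> flag_ideal j `<=` flag_ideal i.
Proof. by move=> ij a Ia l li; apply: Ia; apply: leq_trans li ij. Qed.

Lemma flag_idealP i : is_ideal (flag_ideal i).
Proof.
split=> [j _|a b Ia Ib j ji|x a Ia j ji]; first exact: flag0.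
  by rewrite flagD Ia ?Ib ?addr0.
rewrite flag_mul ?Ia ?mulr0 //.
exact: flag_ideal_le (ltnW ji) _ Ia.
Qed.

Lemma flag_ideal_max x a i : res x = 0 -> flag_ideal i a -> flag_ideal i.+1 (x * a).
Proof.
move=> rx Ia j; rewrite ltnS leq_eqVlt => /orP[/eqP ji|ji].
  by rewrite flag_mul ?rx ?mul0r // ji.
exact: (idealM x (flag_idealP i) Ia).
Qed.

Lemma flag_ideal_top a : flag_ideal r a -> a = 0.
Proof. by move=> Ia; rewrite (flag_sum a) big1 // => i _; rewrite Ia ?scale0r. Qed.

Lemma flag_e (i : 'I_r) : flag_ideal i (e i).
Proof. by move=> j ji; rewrite flagE; case: eqP ji => // ->; rewrite ltnn. Qed.

(** The submodule I_j M, where I_j is the ideal spanned by e_j and the later basis elements. *)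
Definition flag_sub (M : lmodType A) (j : nat) : set M :=
  [set s | exists v : 'I_r -> M, s = \sum_(i < r | (j <= i)%N) e i *: v i].

(** Let N be the i-th ideal of the flag. The relation e_i b = sum of e_l v_l over l > i holds in M;
    flatness applied to the inclusion of N in A turns it into the vanishing of e_i (x) b - sum e_l
    (x) v_l in N (x) M. The bilinear map (n, m) -> c_i(n) theta(m) sends this tensor to theta(b). *)
Lemma flat_flag (M : lmodType A) (P : lmodType K) (theta : M -> P) :
  flat M -> {morph theta : u v / u + v} ->
  (forall a m, theta (a *: m) = res a *: theta m) ->
  forall (i : 'I_r) b, flag_sub i.+1 (e i *: b) -> theta b = 0.
Proof.
move=> Mflat thD thZ i b [v eb].
have hI := flag_idealP i; pose N := ideal_module hI.
have /choice[nu nuE] : forall l : 'I_r, exists n : N, (i <= l)%N -> ideal_val n = e l.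
  move=> l; have [il|li] := leqP i l; last by exists 0.
  have [n ne] : exists n : N, ideal_val n = e l.
    by apply: ideal_module_of; apply: flag_ideal_le il _ _; apply: flag_e.
  by exists n.
pose s : seq (N * M) := (nu i, b) :: [seq (- nu l, v l) | l : 'I_r <- enum 'I_r & (i < l)%N].
have bE : e i *: b - \sum_(l < r | (i < l)%N) e l *: v l = 0 by rewrite eb subrr.
have h : tensor_eq0 s.
  apply: (Mflat N A^o (ideal_incl hI) (@ideal_incl_inj _ _ hI)) => Q g.
  have gE (a : A^o) m : g a m = g 1 (a *: m).
    by rewrite linearZr_LR -[in LHS](mulr1 a) -linearZl_LR.
  rewrite big_map big_cons big_map big_filter big_enum_cond /=.
  rewrite gE /= nuE //.
  have -> : \sum_(l < r | (i < l)%N) g (- ideal_val (nu l)) (v l) =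
            - g 1 (\sum_(l < r | (i < l)%N) e l *: v l).
    rewrite linear_sumr -sumrN; apply: eq_bigr => l il.
    by rewrite linearNl gE nuE // ltnW.
  by rewrite -linearBr bE linear0r.
pose f0 (n : N) (m : M) : res_module res P := c i (ideal_val n) *: theta m.
have f0b : bilinear_for *:%R *:%R f0.
  split=> [m|n] a u w; rewrite /f0 /=.
    have -> : c i (a * ideal_val u + ideal_val w) = res a * c i (ideal_val u) + c i (ideal_val w).
      by rewrite flagD (@flag_mul a _ i) //; apply: ideal_moduleP.
    by rewrite scalerDl -scalerA.
  by rewrite thD thZ scalerDr !scalerA mulrC -scalerA.
pose f : {bilinear N -> M -> res_module res P} :=
  HB.pack f0 (bilinear_isBilinear.Build A N M (res_module res P) *:%R *:%R f0 f0b).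
have := h _ f; rewrite big_cons big_map big_filter big_enum_cond /= /f0 nuE //.
rewrite flagE eqxx scale1r big1 ?addr0 // => l il.
have -> : ideal_val (- nu l) = - ideal_val (nu l) by exact: (raddfN (ideal_incl hI)).
rewrite flagN nuE ?(ltnW il) // flagE.
have /negPf -> : i != l by apply/eqP => il'; rewrite il' ltnn in il.
by rewrite oppr0 scale0r.
Qed.

End FlagFiltration.

Section Interpolation.
Variables (K : fieldType) (T : Type) (I : eqType) (h : I -> T -> K).

(** Finitely many functions are determined by their values at finitely many points. If the new
    function is not reproduced by the present weights, a point [tau] where it fails is added; the
    correction by [g] does not disturb the earlier functions, whose defect at [tau] is 0. *)
Lemma interpolation (s : seq I) : exists ps : seq (T * (T -> K)),
  forall i, i \in s -> forall t, h i t = \sum_(p <- ps) h i p.1 * p.2 t.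
Proof.
elim: s => [|i0 s [ps IHs]]; first by exists [::].
pose d t := h i0 t - \sum_(p <- ps) h i0 p.1 * p.2 t.
have [d0|/existsNP[tau /eqP dt]] := pselect (forall t, d t = 0).
  exists ps => i; rewrite inE => /orP[/eqP -> t|/IHs //].
  by apply/eqP; rewrite -subr_eq0; apply/eqP; apply: d0.
pose g t := d t / d tau.
exists ((tau, g) :: [seq (p.1, fun t => p.2 t - p.2 tau * g t) | p <- ps]) => i si t.
rewrite big_cons big_map /=.
have -> : \sum_(p <- ps) h i p.1 * (p.2 t - p.2 tau * g t) =
    \sum_(p <- ps) h i p.1 * p.2 t - (\sum_(p <- ps) h i p.1 * p.2 tau) * g t.
  by rewrite mulr_suml -sumrB; apply: eq_bigr => p _; ring.
move: si; rewrite inE => /orP[/eqP ->|/IHs hi].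
  rewrite addrCA -mulrBl -/(d tau) /g mulrCA mulfV // mulr1.
  by rewrite /d addrC subrK.
by rewrite -!hi addrCA subrr addr0.
Qed.
End Interpolation.

Section FlatIntro.
Variables (K : fieldType) (A : comAlgType K) (res : {rmorphism A -> K}).
Variables (r : nat) (e : 'I_r -> A) (c : 'I_r -> A -> K).
Hypothesis fl : flag_basis res e c.

(* A module of all functions T -> A is flat: by interpolation a finite family
   in it lies in the image of a finite free module on which evaluations at
   finitely many points give coordinates. *)
Lemma flat_fun (M : lmodType A) (T : Type) (k : M -> T -> A) :
  (forall a u v t, k (a *: u + v) t = a * k u t + k v t) ->
  (forall u v, (forall t, k u t = k v t) -> u = v) ->
  (forall g, exists u, forall t, k u t = g t) -> flat M.
Proof.
move=> kP kI kS N N' j jI s hs P b.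
have k0 t : k 0 t = 0.
  by apply: (addrI (k 0 t)); have := kP 1 0 0 t; rewrite scaler0 !addr0 mul1r => /esym.
have kD u v t : k (u + v) t = k u t + k v t by rewrite -[u]scale1r kP mul1r scale1r.
have kZ a u t : k (a *: u) t = a * k u t by rewrite -[a *: u]addr0 kP k0 addr0.
pose h (x : (N * M) * 'I_r) t := c x.2 (k x.1.2 t).
have [ps psE] := interpolation h [seq (nm, i) | nm <- s, i <- enum 'I_r].
have [u uE] := choice (fun p : T * (T -> K) => kS (fun t => (p.2 t)%:A)).
have sE nm : nm \in s -> nm.2 = \sum_(p <- ps) k nm.2 p.1 *: u p.
  move=> ns; apply: kI => t.
  rewrite (big_morph (fun v => k v t) (fun u v => kD u v t) (k0 t)).
  rewrite [LHS](flag_sum fl).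
  have -> : \sum_i c i (k nm.2 t) *: e i = \sum_i \sum_(p <- ps) (c i (k nm.2 p.1) * p.2 t) *: e i.
    apply: eq_bigr => i _; rewrite -scaler_suml; congr (_ *: _).
    by apply: (psE (nm, i)); apply: allpairs_f => //; rewrite mem_enum.
  rewrite exchange_big; apply: eq_bigr => p _.
  rewrite kZ uE [X in _ = X * _](flag_sum fl) mulr_suml; apply: eq_bigr => i _.
  by rewrite -scalerAr mulr1 scalerA mulrC.
(* Expanding the second components in the [u p] turns the tensor into a sum of n_p (x) u_p.
   Evaluation at the point p.1 is linear on M, and the hypothesis on s then yields j(n_p) = 0, hence
   n_p = 0. *)
have -> : \sum_(nm <- s) b nm.1 nm.2 = \sum_(p <- ps) b (\sum_(nm <- s) k nm.2 p.1 *: nm.1) (u p).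
  transitivity (\sum_(nm <- s) \sum_(p <- ps) b (k nm.2 p.1 *: nm.1) (u p)).
    rewrite [LHS]big_seq [RHS]big_seq; apply: eq_bigr => nm ns.
    rewrite {1}(sE _ ns) linear_sumr; apply: eq_bigr => p _.
    by rewrite linearZr_LR -linearZl_LR.
  by rewrite exchange_big; apply: eq_bigr => p _; rewrite linear_sumlz.
rewrite big1 // => p _.
suff -> : \sum_(nm <- s) k nm.2 p.1 *: nm.1 = 0 by rewrite linear0l.
apply: jI; rewrite linear0 linear_sum.
pose f0 (n : N') (m : M) : N' := k m p.1 *: n.
have f0b : bilinear_for *:%R *:%R f0.
  split=> [m|n] a x y; rewrite /f0 /=; first by rewrite scalerDr !scalerA mulrC.
  by rewrite kP scalerDl scalerA.
pose f : {bilinear N' -> M -> N'} :=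
  HB.pack f0 (bilinear_isBilinear.Build A N' M N' *:%R *:%R f0 f0b).
have := hs _ f; rewrite big_map /= /f0 => h0.
by rewrite -[RHS]h0; apply: eq_bigr => nm _; rewrite linearZ.
Qed.
End FlatIntro.

Section FlagModules.
Variables (K : fieldType) (A : comAlgType K) (res : {rmorphism A -> K}).
Variables (r : nat) (e : 'I_r -> A) (c : 'I_r -> A -> K).
Hypothesis resA : forall k, res k%:A = k.
Hypothesis fl : flag_basis res e c.
Local Notation flag_sub := (@flag_sub K A r e).

Section OneModule.
Variable M : lmodType A.
Implicit Types s u v : M.

(** The submodule m M, m being the kernel of [res]. *)
Definition max_sub : set M := [set s | exists l : seq (A * M),
  (forall p, p \in l -> res p.1 = 0) /\ s = \sum_(p <- l) p.1 *: p.2].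

Lemma max_subD u v : max_sub u -> max_sub v -> max_sub (u + v).
Proof.
move=> [l [hl ->]] [l' [hl' ->]]; exists (l ++ l'); rewrite big_cat; split=> // p.
by rewrite mem_cat => /orP[/hl|/hl'].
Qed.
Lemma flag_sub0 j : flag_sub j (0 : M).
Proof. by exists (fun=> 0); rewrite big1 // => i _; rewrite scaler0. Qed.
Lemma flag_subD j u v : flag_sub j u -> flag_sub j v -> flag_sub j (u + v).
Proof.
move=> [x ->] [y ->]; exists (fun i => x i + y i); rewrite -big_split.
by apply: eq_bigr => i _; rewrite scalerDr.
Qed.
Lemma flag_subZ j a u : flag_sub j u -> flag_sub j (a *: u).
Proof.
move=> [x ->]; exists (fun i => a *: x i); rewrite scaler_sumr.
by apply: eq_bigr => i _; rewrite !scalerA mulrC.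
Qed.
Lemma flag_subN j u : flag_sub j u -> flag_sub j (- u).
Proof. by rewrite -scaleN1r; apply: flag_subZ. Qed.
Lemma flag_subB j u v : flag_sub j u -> flag_sub j v -> flag_sub j (u - v).
Proof. by move=> hu hv; apply/flag_subD/flag_subN. Qed.

Lemma flag_sub_ideal j a u : flag_ideal c j a -> flag_sub j (a *: u).
Proof.
move=> Ia; exists (fun i => (c i a)%:A *: u); rewrite {1}(flag_sum fl a) scaler_suml.
rewrite [LHS](bigID (fun i : 'I_r => (j <= i)%N)) /= [X in _ + X]big1 ?addr0 => [|i].
  by apply: eq_bigr => i _; rewrite scalerA -scalerAr mulr1.
by rewrite -ltnNge => /Ia ->; rewrite !scale0r.
Qed.

Lemma flag_subT u : flag_sub 0 u.
Proof. by rewrite -[u]scale1r; apply: flag_sub_ideal. Qed.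

Lemma flag_sub_top u : flag_sub r u -> u = 0.
Proof. by case=> v ->; rewrite big1 // => i; rewrite leqNgt ltn_ord. Qed.

Lemma flag_sub_split (j : 'I_r) u : flag_sub j u ->
  exists b v, flag_sub j.+1 v /\ u = e j *: b + v.
Proof.
case=> v ->; exists (v j), (\sum_(i < r | (j < i)%N) e i *: v i); split; first by exists v.
rewrite (bigD1 j) //=; congr (_ + _); apply: eq_bigl => i.
by rewrite [RHS]ltn_neqAle andbC val_eqE eq_sym.
Qed.

Lemma flag_sub_max (j : 'I_r) u : max_sub u -> flag_sub j.+1 (e j *: u).
Proof.
move=> [l [hl ->]]; rewrite scaler_sumr big_seq; apply: (big_ind (flag_sub j.+1)).
- exact: flag_sub0.
- by move=> x y; apply: flag_subD.
move=> p /hl rp; rewrite scalerA mulrC; apply: flag_sub_ideal.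
by apply: (flag_ideal_max resA fl rp); apply: (flag_e fl).
Qed.

Lemma flag_ind (Q : nat -> Prop) : Q 0%N -> (forall j : 'I_r, Q j -> Q j.+1) -> Q r.
Proof.
move=> Q0 QS; suff h j : (j <= r)%N -> Q j by apply: h.
elim: j => // j IHj jr; exact: (QS (Ordinal jr) (IHj (ltnW jr))).
Qed.

End OneModule.

Section Lifting.
Variables (B : comAlgType A) (O : comNzRingType) (pi : {rmorphism B -> O}).
Hypothesis piS : surj pi.
Hypothesis kpi : forall s, pi s = 0 -> max_sub s.
Variables (n : nat) (b : 'I_n -> B).

(** Climb along the flag: if t solves the system up to e_j mu modulo I_(j+1) B, subtract e_j tau,
    where tau lifts a solution over the closed fibre of the system with inhomogeneous term mu. *)
Lemma tcomp_lift (I : Type) (T : 'I_n -> I -> I) : tcomp (pi \o b) T -> tcomp b T.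
Proof.
move=> h v.
pose Q j := exists t : I -> B, forall s, flag_sub j (t s - (v s + \sum_i b i * t (T i s))).
suff [t tE] : Q r.
  by exists t => s; apply/eqP; rewrite -subr_eq0; apply/eqP/flag_sub_top/tE.
apply: flag_ind => [|j [t tE]]; first by exists (fun=> 0) => s; apply: flag_subT.
have /choice[mu muE] := fun s => flag_sub_split (tE s).
have [tau0 tau0E] := h (pi \o mu).
have /choice[tau tauE] := fun s => piS (tau0 s).
exists (fun s => t s - e j *: tau s) => s; have [u [hu uE]] := muE s.
have -> : t s - e j *: tau s - (v s + \sum_i b i * (t (T i s) - e j *: tau (T i s))) =
    u - e j *: (tau s - (mu s + \sum_i b i * tau (T i s))).
  have -> : \sum_i b i * (t (T i s) - e j *: tau (T i s)) =
     \sum_i b i * t (T i s) - e j *: \sum_i b i * tau (T i s).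
    by rewrite scaler_sumr -sumrB; apply: eq_bigr => i _; rewrite mulrBr scalerAr.
  have -> : u = t s - (v s + \sum_i b i * t (T i s)) - e j *: mu s by rewrite uE addrAC subrr add0r.
  by rewrite !scalerBr scalerDr; ring.
apply: flag_subB => //; apply: flag_sub_max; apply: kpi.
rewrite rmorphB rmorphD rmorph_sum tauE tau0E /=.
apply/eqP; rewrite subr_eq0; apply/eqP; congr (_ + _).
by apply: eq_bigr => i _; rewrite rmorphM tauE.
Qed.
End Lifting.

(** If S lies in I_j B, its elements are e_j x modulo I_(j+1) B. By [flat_flag] the images of these
    x in the closed fibre satisfy the homogeneous recursion there, hence vanish, and S lies in
    I_(j+1) B. *)
Lemma tsep_lift (B : comAlgType A) (O : comAlgType K) (pi : {rmorphism B -> O})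
    (n : nat) (b : 'I_n -> B) :
  flat B -> (forall a, pi a%:A = (res a)%:A) -> (forall s, pi s = 0 -> max_sub s) ->
  tsep (pi \o b) -> tsep b.
Proof.
move=> Bflat piA kpi bS S hS.
have piZ a s : pi (a *: s) = res a *: pi s by rewrite -mulr_algl rmorphM piA mulr_algl.
suff h : forall s, S s -> flag_sub r s by move=> s /h /flag_sub_top.
apply: (flag_ind (Q := fun j => forall s, S s -> flag_sub j s)).
  by move=> s _; apply: flag_subT.
move=> j IHj s Ss; have [x [u [hu sE]]] := flag_sub_split (IHj s Ss).
rewrite sE; apply: flag_subD => //; apply: flag_sub_max; apply: kpi.
pose S' : set O := [set y | exists s x, [/\ S s, flag_sub j.+1 (s - e j *: x) & y = pi x]].
apply: (bS S'); last by exists s, x; split=> //; rewrite sE addrC addKr.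
move=> {s x u hu sE Ss} _ [s [x [Ss hx ->]]].
have [s' [Ss' sE]] := hS s Ss.
have /choice[x' x'E] : forall i, exists x', flag_sub j.+1 (s' i - e j *: x').
  move=> i; have [x' [u [hu e']]] := flag_sub_split (IHj _ (Ss' i)).
  by exists x'; rewrite e' addrC addKr.
exists (fun i => pi (x' i)); split=> [i|]; first by exists (s' i), (x' i).
apply/eqP; rewrite -subr_eq0; apply/eqP.
have -> : pi x - \sum_i (pi \o b) i * pi (x' i) = pi (x - \sum_i b i * x' i).
  by rewrite rmorphB rmorph_sum; congr (_ - _); apply: eq_bigr => i _; rewrite rmorphM.
apply: (flat_flag resA fl Bflat (rmorphD pi) piZ (i := j)).
have -> : e j *: (x - \sum_i b i * x' i) =
    - (s - e j *: x) + \sum_i b i * (s' i - e j *: x' i).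
  rewrite opprB scalerBr scaler_sumr {1}sE -addrA; congr (_ + _).
  rewrite -sumrN -sumrN -big_split; apply: eq_bigr => i _ /=.
  by rewrite mulrBr addrA addNr add0r scalerAr.
apply: flag_subD; first exact: flag_subN.
apply: (big_ind (flag_sub j.+1)) => [|y z|i _]; [exact: flag_sub0|exact: flag_subD|].
case: (x'E i) => w ->; exists (fun l => b i * w l); rewrite mulr_sumr.
by apply: eq_bigr => l _; rewrite scalerAr.
Qed.

Section Coordinates.
Variable n : nat.
Implicit Types f : mps n A.

Definition mps_coord i f : mps n K := MPS (fun m => c i (mps_coef f m)).
Local Notation mps_inK := (@map_mps n K A (in_alg A)).

Lemma mcoef_inK g m : mps_coef (mps_inK g) m = (mps_coef g m)%:A. Proof. by []. Qed.
Lemma res_inK g : map_mps res (mps_inK g) = g.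
Proof. by apply: mpsext => m; rewrite mcoef_map mcoef_inK resA. Qed.

Lemma mps_coord_sum f : f = \sum_i e i *: mps_inK (mps_coord i f).
Proof.
apply: mpsext => m; rewrite mcoef_sum {1}(flag_sum fl (mps_coef f m)).
by apply: eq_bigr => i _; rewrite mcoefZ mcoef_inK -scalerAr mulr1.
Qed.

Lemma coefs_flag_sub j f : coefs_in (flag_ideal c j) f -> flag_sub j f.
Proof.
move=> hf; exists (fun i => mps_inK (mps_coord i f)); rewrite {1}(mps_coord_sum f).
rewrite [LHS](bigID (fun i : 'I_r => (j <= i)%N)) /= [X in _ + X]big1 ?addr0 // => i.
rewrite -ltnNge => ij; suff -> : mps_coord i f = 0 by rewrite rmorph0 scaler0.
by apply: mpsext => m; apply: hf.
Qed.

Lemma coefs_max_sub f : (forall m, res (mps_coef f m) = 0) -> max_sub f.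
Proof.
move=> hf; exists [seq (e i - (res (e i))%:A, mps_inK (mps_coord i f)) | i <- enum 'I_r].
split=> [p /mapP[i _ ->]|]; first by rewrite /= rmorphB resA subrr.
rewrite big_map big_enum /=; apply/esym.
have -> : \sum_(i < r) (e i - (res (e i))%:A) *: mps_inK (mps_coord i f) =
   f - \sum_(i < r) (res (e i))%:A *: mps_inK (mps_coord i f).
  by rewrite {2}(mps_coord_sum f) -sumrB; apply: eq_bigr => i _; rewrite scalerBl.
rewrite (_ : \sum_(i < r) _ = 0) ?subr0 //; apply: mpsext => m; rewrite mcoef_sum.
transitivity ((res (mps_coef f m))%:A : A); last by rewrite hf scale0r.
rewrite {1}(flag_sum fl (mps_coef f m)) rmorph_sum scaler_suml.
apply: eq_bigr => i _; rewrite mcoefZ mcoef_inK -[c i _ *: e i]mulr_algl rmorphM resA.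
by rewrite mulr_algl scalerA; congr (_ *: _); apply: mulrC.
Qed.

(** Separation and completeness lift from the closed fibre, so series can be evaluated at any lifts
    of the variables. Bijectivity is proved one step of the flag at a time: for h with coefficients
    in I_j and psi h = 0, flatness kills the j-th coordinate of h; a remainder e_j x is matched by
    e_j times the series pi(x). *)
Lemma flat_series (B : comAlgType A) (pi : {rmorphism B -> mps n K}) (b : 'I_n -> B) :
  flat B -> surj pi -> (forall a, pi a%:A = (res a)%:A) ->
  (forall s, pi s = 0 -> max_sub s) -> (forall i, pi (b i) = mpsX K i) ->
  exists psi : {lrmorphism mps n A -> B},
    [/\ bijective psi, forall i, psi (mpsX A i) = b i
      & forall f, pi (psi f) = map_mps res f].
Proof.
move=> Bflat piS piA kpi pib.
have piZ a s : pi (a *: s) = res a *: pi s by rewrite -mulr_algl rmorphM piA mulr_algl.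
have pib0 i : mps_coef ((pi \o b) i) 0%MM = 0 by rewrite /= pib mcoefX0.
have bS : tsep b by apply: (tsep_lift Bflat piA kpi); apply: mps_tsep.
have [||psi psiX] := @mps_ev n A B b; first exact: bS.
  by apply: (tcomp_lift piS kpi); apply: mps_tcomp.
have piE f : pi (psi f) = map_mps res f.
  have -> : pi (psi f) = (pi \o psi) f by [].
  apply: mps_hom_eq => [|a|i]; rewrite /=.
  - apply: mps_tsep => i; rewrite /= psiX; exact: pib0.
  - by rewrite lrmorph_algE piA map_mpsA.
  - by rewrite psiX pib map_mpsX.
exists psi; split=> //; apply: inj_surj_bij => [f g fg|s].
  apply/eqP; rewrite -subr_eq0; apply/eqP.
  have : psi (f - g) = 0 by rewrite rmorphB /= fg subrr.
  move: (f - g) => {fg g}h h0; apply: mpsext => m; apply: (flag_ideal_top fl).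
  move: m; change (coefs_in (flag_ideal c r) h).
  apply: (flag_ind (Q := fun j => coefs_in (flag_ideal c j) h)) => [//|j hj].
  pose g := mps_inK (mps_coord j h).
  have gE : coefs_in (flag_ideal c j.+1) (h - e j *: g).
    move=> m i; rewrite mcoefB mcoefZ mcoef_inK -scalerAr mulr1 (flagB fl) (flagZ fl).
    rewrite (flagE fl) ltnS leq_eqVlt => /orP[/eqP ij|ij].
      by rewrite -(val_inj ij) eqxx mulr1 subrr.
    rewrite hj //; have /negPf -> : i != j by apply/eqP => ij'; rewrite ij' ltnn in ij.
    by rewrite mulr0 subr0.
  have gsub : flag_sub j.+1 (e j *: psi g).
    rewrite -linearZ -[e j *: g](subrK h) addrC.
    rewrite raddfD /= h0 add0r -opprB raddfN /=; apply: flag_subN.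
    have [v ->] := coefs_flag_sub gE; exists (fun i => psi (v i)).
    by rewrite raddf_sum; apply: eq_bigr => i _; rewrite /= linearZ.
  have := flat_flag resA fl Bflat (rmorphD pi) piZ gsub; rewrite piE res_inK => cj m i ij.
  have := gE m i ij; rewrite mcoefB mcoefZ mcoef_inK.
  have -> : mps_coef (mps_coord j h) m = 0 by rewrite cj.
  by rewrite scale0r mulr0 subr0.
suff [f hf] : exists f, flag_sub r (s - psi f).
  by exists f; apply/esym/eqP; rewrite -subr_eq0; apply/eqP/flag_sub_top.
apply: (flag_ind (Q := fun j => exists f, flag_sub j (s - psi f))).
  by exists 0; apply: flag_subT.
move=> j [f /flag_sub_split[x [v [hv sE]]]].
exists (f + e j *: mps_inK (pi x)).
rewrite raddfD /= linearZ /= opprD addrA sE addrAC -scalerBr; apply: flag_subD => //.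
apply: flag_sub_max; apply: kpi; rewrite rmorphB piE res_inK subrr //.
Qed.

End Coordinates.

(** When Q is flat, forming the kernel commutes with passing to the closed fibre. In the climb s - l
    = e_j b + v, flatness puts tau(b) in m Q; after subtracting from b an element of m M with the
    same image, b lies in the kernel and is approximated by an element of L. *)
Lemma flat_kernel (M Q : comAlgType A) (P : lmodType K) (tau : {lrmorphism M -> Q})
    (theta : Q -> P) (L : set M) :
  flat Q -> surj tau -> {morph theta : u v / u + v} ->
  (forall a q, theta (a *: q) = res a *: theta q) ->
  (forall q, theta q = 0 -> max_sub q) ->
  is_ideal L -> (forall s, tau s = 0 -> exists2 l, L l /\ tau l = 0 & max_sub (s - l)) ->
  forall s, tau s = 0 -> L s.
Proof.
move=> Qflat tauS thD thZ kth hL hker s ts.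
suff [l [Ll tl] hl] : exists2 l, L l /\ tau l = 0 & flag_sub r (s - l).
  by rewrite -(subrK l s) (flag_sub_top hl) add0r.
apply: (flag_ind (Q := fun j => exists2 l, L l /\ tau l = 0 & flag_sub j (s - l))).
  by exists 0; [split; [exact: (ideal0 hL)|exact: rmorph0]|apply: flag_subT].
move=> j [l [Ll tl] /flag_sub_split[b [v [[w vE] sE]]]].
have : max_sub (tau b).
  apply/kth/(flat_flag resA fl Qflat thD thZ (i := j)).
  exists (fun i => - tau (w i)).
  have : tau (s - l) = 0 by rewrite rmorphB /= ts tl subrr.
  rewrite sE rmorphD /= linearZ /= vE raddf_sum /= => /eqP; rewrite addr_eq0 => /eqP ->.
  by rewrite -sumrN; apply: eq_bigr => i _; rewrite /= linearZ /= scalerN.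
case=> q [qm qE]; have [sg sgK] := choice tauS.
pose mu : M := \sum_(p <- q) p.1 *: sg p.2.
have mum : max_sub mu.
  exists [seq (p.1, sg p.2) | p <- q]; rewrite big_map; split=> // p /mapP[p' /qm ? ->] //.
have tmu : tau mu = tau b.
  by rewrite qE raddf_sum; apply: eq_bigr => p _; rewrite /= linearZ /= sgK.
have [l' [Ll' tl'] hl'] : exists2 l', L l' /\ tau l' = 0 & max_sub (b - mu - l').
  by apply: hker; rewrite rmorphB /= tmu subrr.
exists (l + e j *: l').
  split; first by apply: (idealD hL) => //; rewrite -mulr_algl; apply: (idealM _ hL).
  by rewrite rmorphD /= linearZ /= tl tl' scaler0 addr0.
have -> : s - (l + e j *: l') = e j *: (b - mu - l' + mu) + v.
  by rewrite opprD addrA sE addrAC -scalerBr; congr (_ *: _ + _); rewrite addrAC subrK.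
by apply: flag_subD; [apply/flag_sub_max/max_subD|exists w].
Qed.

End FlagModules.

Section QuotientAlgebra.
Variables (A : comNzRingType) (B : comAlgType A) (I : set B).

(** Both proofs are arguments so that the proper ideal structure attaches to the predicate;
    [quot_algP] then offers the quotient without its construction. *)
Definition quot_pred (hI : is_ideal I) (I1 : ~ I 1) : {pred B} := fun b => `[< I b >].

Variables (hI : is_ideal I) (I1 : ~ I 1).
Local Notation qI := (quot_pred hI I1).

Fact quot_pred_ideal : idealr_closed qI.
Proof.
split; first by apply/asboolP; apply: (ideal0 hI).
  by apply/asboolP.
move=> a u v /asboolP Iu /asboolP Iv; apply/asboolP; apply: (idealD hI) => //.
exact: (idealM _ hI).
Qed.
HB.instance Definition _ := isIdealr.Build B qI quot_pred_ideal.

Definition quot_alg : Type := {ideal_quot qI}.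
HB.instance Definition _ := GRing.ComNzRing.on quot_alg.
Definition quot_pi (b : B) : quot_alg := (\pi_({ideal_quot qI}) b)%qT.

Fact quot_piD : {morph quot_pi : x y / x + y}.
Proof. by move=> x y; rewrite /quot_pi rmorphD. Qed.
Fact quot_piM : {morph quot_pi : x y / x * y}.
Proof. by move=> x y; rewrite /quot_pi rmorphM. Qed.
Fact quot_pi1 : quot_pi 1 = 1.
Proof. by rewrite /quot_pi rmorph1. Qed.

Let scale (a : A) (q : quot_alg) : quot_alg := quot_pi a%:A * q.
Fact quot_scaleA a b q : scale a (scale b q) = scale (a * b) q.
Proof.
by rewrite /scale mulrA -quot_piM -scalerAl mul1r scalerA.
Qed.
Fact quot_scale1 : left_id 1 scale.
Proof. by move=> q; rewrite /scale scale1r quot_pi1 mul1r. Qed.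
Fact quot_scaleDr : right_distributive scale +%R.
Proof. by move=> a p q; rewrite /scale mulrDr. Qed.
Fact quot_scaleDl q : {morph scale^~ q : a b / a + b}.
Proof. by move=> a b; rewrite /scale scalerDl quot_piD mulrDl. Qed.
HB.instance Definition _ := GRing.Zmodule_isLmodule.Build A quot_alg
  quot_scaleA quot_scale1 quot_scaleDr quot_scaleDl.
Fact quot_scaleAl (a : A) (p q : quot_alg) : a *: (p * q) = a *: p * q.
Proof. by rewrite /GRing.scale /= /scale mulrA. Qed.
HB.instance Definition _ := GRing.Lmodule_isLalgebra.Build A quot_alg quot_scaleAl.
HB.instance Definition _ := GRing.Lalgebra_isComAlgebra.Build A quot_alg.

Lemma quot_pi_eq0 b : quot_pi b = 0 <-> I b.
Proof.
have -> : 0 = quot_pi 0 by apply: (addrI (quot_pi 0)); rewrite -quot_piD !addr0.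
split.
  move/eqP; rewrite /quot_pi -(Quotient.idealrBE qI) subr0.
  by move/asboolP.
move=> Ib; apply/eqP; rewrite /quot_pi -(Quotient.idealrBE qI) subr0.
exact/asboolP.
Qed.

Lemma quot_algP : exists (Q : comAlgType A) (pi : {lrmorphism B -> Q}),
  surj pi /\ kerset pi = I.
Proof.
have piZ : scalable (mk_rmorph quot_piD quot_piM quot_pi1).
  by move=> a b; rewrite -[a *: b]mulr_algl rmorphM.
exists quot_alg, (mk_lrmorph piZ); split; last first.
  by apply/seteqP; split=> b; [move/quot_pi_eq0|move/quot_pi_eq0].
by move=> q; exists (repr q); rewrite /= /quot_pi reprK.
Qed.
End QuotientAlgebra.

(** * Weierstrass division *)

Section Shift.
Variables (n : nat) (A : comNzRingType).
Implicit Types (f g : mps n A) (m : 'X_{1..n}).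

Definition mps_shift (i : 'I_n) (w : nat) f : mps n A :=
  MPS (fun m => mps_coef f (m + U_(i) *+ w)%MM).

Lemma mcoef_shift i w f m : mps_coef (mps_shift i w f) m = mps_coef f (m + U_(i) *+ w)%MM.
Proof. by []. Qed.

Lemma mnm_sub_pow i w m : (w <= m i)%N -> m = (m - U_(i) *+ w + U_(i) *+ w)%MM.
Proof.
move=> wm; rewrite submK //; apply/mnm_lepP => l; rewrite mulmnE mnm1E.
by case: eqP => [<-|]; rewrite ?mul1n ?mul0n.
Qed.

Lemma mcoefXnM i w f m : mps_coef (mpsX A i ^+ w * f) (m + U_(i) *+ w)%MM = mps_coef f m.
Proof.
elim: w f m => [|w IHw] f m; first by rewrite expr0 mul1r mulm0n addm0.
by rewrite exprSr -mulrA mulmS addmA IHw mcoefXM.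
Qed.

Lemma mcoefXnM0 i w f m : (m i < w)%N -> mps_coef (mpsX A i ^+ w * f) m = 0.
Proof.
elim: w f m => // w IHw f m mw; rewrite exprS -mulrA.
case mi: (m i) => [|r]; first by rewrite mcoefXM0.
have wm : (1 <= m i)%N by rewrite mi.
rewrite (mnm_sub_pow wm) mulm1n mcoefXM IHw // mnmBE mnm1E eqxx subn1.
by rewrite mi -ltnS -mi.
Qed.

Lemma mps_shiftXn i w f : mps_shift i w (mpsX A i ^+ w * f) = f.
Proof. by apply: mpsext => m; rewrite mcoef_shift mcoefXnM. Qed.

Lemma mps_shiftP i w f : (forall m, (m i < w)%N -> mps_coef f m = 0) ->
  f = mpsX A i ^+ w * mps_shift i w f.
Proof.
move=> hf; apply: mpsext => m; case: (ltnP (m i) w) => mw; first by rewrite hf // mcoefXnM0.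
by rewrite [in RHS](mnm_sub_pow mw) mcoefXnM mcoef_shift -mnm_sub_pow.
Qed.

Lemma mps_shiftD i w f g : mps_shift i w (f + g) = mps_shift i w f + mps_shift i w g.
Proof. by apply: mpsext. Qed.

Lemma mpsX_inj i f g : mpsX A i * f = mpsX A i * g -> f = g.
Proof. by move=> fg; apply: mpsext => m; rewrite -(mcoefXM i f) fg mcoefXM. Qed.

Lemma mps_shift_comm i j w f : i != j -> mps_shift i w (mpsX A j * f) = mpsX A j * mps_shift i w f.
Proof.
move=> ij; apply: mpsext => m; rewrite mcoef_shift.
have eij : (U_(i) *+ w)%MM j = 0%N by rewrite mulmnE mnm1E (negPf ij).
case mj: (m j) => [|r]; first by rewrite !mcoefXM0 // mnmDE mj eij.
have m1 : (1 <= m j)%N by rewrite mj.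
rewrite (mnm_sub_pow m1) mulm1n mcoefXM mcoef_shift.
have -> : (m - U_(j) + U_(j) + U_(i) *+ w)%MM = (m - U_(j) + U_(i) *+ w + U_(j))%MM.
  by rewrite -!addmA (addmC U_(j)%MM).
by rewrite mcoefXM.
Qed.

Definition mps_low (i : 'I_n) (w : nat) f : mps n A :=
  MPS (fun m => if (m i < w)%N then mps_coef f m else 0).

Lemma mcoef_low i w f m : mps_coef (mps_low i w f) m = if (m i < w)%N then mps_coef f m else 0.
Proof. by []. Qed.

Lemma mps_low_shift i w f : f = mps_low i w f + mpsX A i ^+ w * mps_shift i w f.
Proof.
apply: mpsext => m; rewrite mcoefD mcoef_low; case: ltnP => mw; first by rewrite mcoefXnM0 // addr0.
by rewrite add0r [in RHS](mnm_sub_pow mw) mcoefXnM mcoef_shift -mnm_sub_pow.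
Qed.

End Shift.

Lemma mn2_eq (m m' : 'X_{1..2}) : m ord0 = m' ord0 -> m ord_max = m' ord_max -> m = m'.
Proof.
move=> h0 h1; apply/mnmP => i; case/orP: (orbN (i == ord0)) => [/eqP -> //|i0].
by have -> : i = ord_max by apply: val_inj; case: i i0 => [[|[|[]]]].
Qed.

Lemma ord_max2 : (ord0 : 'I_2) != ord_max. Proof. by []. Qed.

Lemma mps2_tailE (A : comNzRingType) (f : mps 2 A) :
  f = (mps_coef f 0%MM)%:A + (mpsX A ord0 * mps_tail ord0 f + mpsX A ord_max * mps_tail ord_max f).
Proof.
rewrite {1}(mps_tailE f) !big_ord_recl big_ord0 addr0.
by have -> : lift ord0 ord0 = ord_max :> 'I_2 by apply: val_inj.
Qed.

Section Weierstrass.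
Variables (A : comNzRingType) (g : mps 2 A) (w : nat).
Local Notation x := (mpsX A (ord0 : 'I_2)).
Local Notation y := (mpsX A (ord_max : 'I_2)).
Local Notation S := (mps_shift ord0 w).
Implicit Types (f h : mps 2 A).

(** Splitting h by degree in x gives L h = S h (x^w + y g) + (part of h of x-degree below w). Hence
    dividing f means solving L h = f, and uniqueness of division is injectivity of L. *)
Let L h := h + y * (g * S h).

Let Ysep : tsep (fun _ : 'I_1 => y). Proof. by apply: mps_tsep => i; apply: mcoefX0. Qed.

Let SD f h : S (f + h) = S f + S h. Proof. exact: mps_shiftD. Qed.
Let Sy f : S (y * f) = y * S f. Proof. exact: mps_shift_comm. Qed.

(* L is the identity plus an operator that raises the order in y. *)
Let L_surj f : exists h, L h = f.
Proof.
have [t tE] : exists t, forall f, t f = f + \sum_(i < 1) y * t (- (g * S f)).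
  by apply: (@mps_tcomp _ _ _ (fun _ => y) (mps 2 A) (fun _ f => - (g * S f))) => i; apply: mcoefX0.
have {}tE f' : t f' = f' + y * t (- (g * S f')) by rewrite tE big_ord1.
exists (t f); apply/eqP; rewrite -subr_eq0; apply/eqP.
apply: (tsepF (T := fun _ f => - (g * S f)) (D := fun f => L (t f) - f) Ysep) => {}f.
by rewrite big_ord1 /L {1 2}tE SD Sy; ring.
Qed.

Let L_inj h : L h = 0 -> h = 0.
Proof.
move=> Lh; apply: (Ysep (S := [set h | L h = 0])) Lh => {}h Lh.
have hE : h = y * (- (g * S h)) by apply/eqP; rewrite mulrN -addr_eq0; apply/eqP.
exists (fun=> - (g * S h)); rewrite big_ord1; split=> // _.
apply: (@mpsX_inj _ _ ord_max); rewrite mulr0 -[RHS]Lh /L {3 4}hE Sy; ring.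
Qed.

Lemma weierstrass_div f :
  exists q r, f = q * (x ^+ w + y * g) + mps_low ord0 w r.
Proof.
have [h <-] := L_surj f; exists (S h), h.
by rewrite /L {1}(mps_low_shift ord0 w h); ring.
Qed.

Lemma weierstrass_uniq q r :
  q * (x ^+ w + y * g) + mps_low ord0 w r = 0 -> q = 0 /\ mps_low ord0 w r = 0.
Proof.
move=> e; pose h := x ^+ w * q + mps_low ord0 w r.
have Sh : S h = q.
  apply: mpsext => m; rewrite mcoef_shift mcoefD mcoefXnM mcoef_low.
  by rewrite mnmDE mulmnE mnm1E eqxx mul1n ltnNge leq_addl addr0.
have h0 : h = 0 by apply: L_inj; rewrite /L Sh -[RHS]e /h; ring.
have q0 : q = 0 by rewrite -Sh h0; apply: mpsext.
by split=> //; move: h0; rewrite /h q0 mulr0 add0r.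
Qed.

Lemma weierstrass_nzd q : q * (x ^+ w + y * g) = 0 -> q = 0.
Proof.
move=> e; have [|//] := @weierstrass_uniq q 0.
by rewrite e add0r; apply: mpsext => m; rewrite mcoef_low if_same.
Qed.

End Weierstrass.

Section FlatSeries.
Variables (K : fieldType) (A : comAlgType K) (res : {rmorphism A -> K}).
Variables (r : nat) (e : 'I_r -> A) (c : 'I_r -> A -> K).
Hypothesis fl : flag_basis res e c.

(** Unique representatives supported on [Lam] identify Q with the module of all functions from [Lam]
    to A, which is flat by [flat_fun]. *)
Lemma flat_normal_form n (Q : lmodType A) (Lam : pred 'X_{1..n}) (pi : {linear mps n A -> Q}) :
  (forall q, exists f, (forall m, ~~ Lam m -> mps_coef f m = 0) /\ pi f = q) ->
  (forall f, (forall m, ~~ Lam m -> mps_coef f m = 0) -> pi f = 0 -> f = 0) ->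
  flat Q.
Proof.
move=> /choice[nf nfE] nfU.
have nfP f q : (forall m, ~~ Lam m -> mps_coef f m = 0) -> pi f = q -> nf q = f.
  move=> f0 fq; have [g0 gq] := nfE q; apply/eqP; rewrite -subr_eq0; apply/eqP.
  apply: nfU => [m mL|]; first by rewrite mcoefB f0 ?g0 ?subrr.
  by rewrite raddfB /= gq fq subrr.
apply: (flat_fun fl (T := {m | Lam m}) (k := fun q m => mps_coef (nf q) (sval m))).
- move=> a u v t; rewrite (nfP (a *: nf u + nf v)) => [//|m mL|].
    by rewrite mcoefD mcoefZ !(nfE _).1 // mulr0 addr0.
  by rewrite linearP /= !(nfE _).2.
- move=> u v uv; rewrite -(nfE u).2 -(nfE v).2; congr (pi _); apply: mpsext => m.
  have [mL|mL] := boolP (Lam m); first exact: (uv (exist _ m mL)).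
  by rewrite !(nfE _).1.
move=> g; pose f : mps n A := MPS (fun m => if insub m is Some t then g t else 0).
have fE (t : {m | Lam m}) : mps_coef f (sval t) = g t.
  by rewrite /f /mps_coef valK.
exists (pi f) => t; rewrite (nfP f) // => m mL.
by rewrite /f /mps_coef insubN.
Qed.

Lemma flat_mps n : flat (mps n A).
Proof.
apply: (@flat_normal_form n _ predT idfun) => [q|f _ //].
by exists q.
Qed.

Lemma flat_mps_y (Q : comAlgType A) (pi : {lrmorphism mps 2 A -> Q}) :
  surj pi -> kerset pi = ideal_gen [set mpsX A ord_max] -> flat Q.
Proof.
move=> piS kpi; apply: (@flat_normal_form 2 Q (fun m => m ord_max == 0%N) pi) => [q|f f0 pf].
  have [f <-] := piS q; exists (mps_low ord_max 1 f); split=> [m m0|].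
    by rewrite mcoef_low ltnS leqn0 (negPf m0).
  rewrite [in RHS](mps_low_shift ord_max 1 f) raddfD /= -[LHS]addr0; congr (_ + _).
  apply/esym; change (kerset pi (mpsX A ord_max ^+ 1 * mps_shift ord_max 1 f)).
  by rewrite kpi; apply/ideal_gen1P; exists (mps_shift ord_max 1 f); rewrite mulrC.
have : kerset pi f by [].
rewrite kpi => /ideal_gen1P[g fE]; apply: mpsext => m.
have [m0|m0] := eqVneq (m ord_max) 0%N; last exact: f0.
by rewrite fE mulrC mcoefXM0.
Qed.

Lemma flat_mps_weierstrass (Q : comAlgType A) (pi : {lrmorphism mps 2 A -> Q}) w g :
  surj pi -> kerset pi = ideal_gen [set mpsX A ord0 ^+ w + mpsX A ord_max * g] -> flat Q.
Proof.
move=> piS kpi; apply: (@flat_normal_form 2 Q (fun m => m ord0 < w)%N pi) => [q|f f0 pf].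
  have [f <-] := piS q; have [p [s ->]] := weierstrass_div g w f.
  exists (mps_low ord0 w s); split=> [m m0|]; first by rewrite mcoef_low (negPf m0).
  rewrite raddfD /= -[LHS]add0r; congr (_ + _).
  apply/esym; change (kerset pi (p * (mpsX A ord0 ^+ w + mpsX A ord_max * g))).
  by rewrite kpi; apply/ideal_gen1P; exists p.
have : kerset pi f by [].
rewrite kpi => /ideal_gen1P[p fE].
have fl' : mps_low ord0 w (- f) = - f.
  apply: mpsext => m; rewrite mcoef_low; case: ifPn => // mw.
  by rewrite mcoefN f0 ?oppr0.
have [|_] := @weierstrass_uniq A g w p (- f); first by rewrite -fE fl' subrr.
by rewrite fl' => /eqP; rewrite oppr_eq0 => /eqP.
Qed.

End FlatSeries.

(** * Deformations in coordinates *)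

Section DeformationStructure.
Variables (K : fieldType) (OS OD OC : comAlgType K).
Variables (delta : {lrmorphism OS -> OD}) (rho : {lrmorphism OS -> OC}).
Variables (Phi : {lrmorphism OS -> mps 2 K}) (F0 : mps 2 K).
Hypothesis PhiB : bijective Phi.
Hypothesis kdelta : kerset delta = Phi @^-1` ideal_gen [set py K].
Hypothesis rhoS : surj rho.
Hypothesis krho : kerset rho = Phi @^-1` ideal_gen [set F0].

Section OverA.
Variables (A : comAlgType K) (res : {rmorphism A -> K}).
Variables (r : nat) (e : 'I_r -> A) (c : 'I_r -> A -> K).
Hypothesis resA : forall k, res k%:A = k.
Hypothesis resP : forall a, maxid A a <-> res a = 0.
Hypothesis fl : flag_basis res e c.
Local Notation X := (mpsX A (ord0 : 'I_2)).
Local Notation Y := (mpsX A (ord_max : 'I_2)).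
Local Notation max_sub := (@max_sub K A res).
Local Notation inK := (@map_mps 2 K A (in_alg A)).

Lemma closed_fibreP (B : comAlgType A) (B0 : comAlgType K) (pi : {rmorphism B -> B0}) :
  closed_fibre pi -> (forall a, pi a%:A = (res a)%:A) /\ forall s, pi s = 0 -> max_sub s.
Proof.
case=> piK piS kpi; split=> [a|s].
  have ma : kerset pi (a - (res a)%:A)%:A.
    rewrite kpi; apply: ideal_gen_sub; exists (a - (res a)%:A) => //.
    by apply/resP; rewrite rmorphB resA subrr.
  apply/eqP; rewrite -(piK (res a)) -subr_eq0 -rmorphB -scalerBl; apply/eqP.
  exact: ma.
move=> ps; have : kerset pi s by [].
rewrite kpi => /ideal_gen_sumP[l [lS ->]].
(* [xget] recovers a scalar of the maximal ideal from its image in B; the default 0 is never reached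
   on l. *)
exists [seq (xget 0 [set a | maxid A a /\ a%:A = p.2], p.1) | p <- l].
have lE p : p \in l -> let a := xget 0 [set a | maxid A a /\ a%:A = p.2] in
    maxid A a /\ a%:A = p.2.
  move=> /lS[a ma ap]; case: xgetP => [b -> //|/(_ a)]; by case.
split=> [q /mapP[p /lE[/resP h _] ->] //|].
rewrite big_map [LHS]big_seq [RHS]big_seq; apply: eq_bigr => p /lE[_ h] /=.
by rewrite -mulr_algl h mulrC.
Qed.

Lemma max_sub_lin (M N : lmodType A) (f : {linear M -> N}) s : max_sub s -> max_sub (f s).
Proof.
move=> [l [hl ->]]; exists [seq (p.1, f p.2) | p <- l]; split=> [p /mapP[q /hl ? ->]//|].
by rewrite big_map raddf_sum; apply: eq_bigr => p _; rewrite /= linearZ.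
Qed.

(** Nakayama's lemma for the nilpotent maximal ideal, as a climb along the flag. *)
Lemma flag_surj (M N : lmodType A) (f : {linear M -> N}) :
  (forall s, exists t, max_sub (s - f t)) -> surj f.
Proof.
move=> h s; suff [t ht] : exists t, flag_sub e r (s - f t).
  by exists t; apply/esym/eqP; rewrite -subr_eq0; apply/eqP/flag_sub_top/ht.
apply: (flag_ind (Q := fun j => exists t, flag_sub e j (s - f t))).
  by exists 0; apply: (flag_subT fl).
move=> j [t /(flag_sub_split (e := e))[b [v [hv sE]]]]; have [t' ht'] := h b.
exists (t + e j *: t'); rewrite raddfD /= linearZ /= opprD addrA sE addrAC -scalerBr.
by apply: flag_subD => //; apply: (flag_sub_max resA fl).
Qed.

(* Coordinates x, y of the family with D = V(y) and P = V(x, y). *)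
Definition coord_map (x : deform OS OC A) (j : {lrmorphism mps 2 A -> dS x}) :=
  [/\ bijective j,
      Phi (fibS x (j X)) = px K /\ Phi (fibS x (j Y)) = py K
    & sec x (toD x (j X)) = 0 /\ toD x (j Y) = 0].

(* C = V(G) in suitable coordinates: by flatness (G) is the whole kernel of toC. *)
Definition presented (G : mps 2 A) (x : deform OS OC A) :=
  exists j, [/\ @coord_map x j, Phi (fibS x (j G)) = F0 & toC x (j G) = 0].

Variable x : deform OS OC A.
Hypothesis xD : is_deform delta rho x.

Lemma fibS_A a : Phi (fibS x a%:A) = (res a)%:A.
Proof. by case: xD => _ _ [/closed_fibreP[-> _] _] _ _; rewrite lrmorph_algE. Qed.

Lemma fibS_ker s : Phi (fibS x s) = 0 -> max_sub s.
Proof.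
case: xD => _ _ [/closed_fibreP[_ h] _] _ _ ps; apply: h.
by apply: (bij_inj PhiB); rewrite rmorph0.
Qed.

Lemma fibS_surj : surj (Phi \o fibS x).
Proof.
case: xD => _ _ [[_ fS _] _] _ _ s.
by have [t tE] := bij_surj PhiB s; have [u uE] := fS t; exists u; rewrite /= uE.
Qed.

Lemma coord_fib j : coord_map j -> forall f, Phi (fibS x (j f)) = map_mps res f.
Proof.
case=> _ [jX jY] _ f.
have jXi i : Phi (fibS x (j (mpsX A i))) = mpsX K i.
  have [->//|i0] := eqVneq i ord0.
  by have -> : i = ord_max by apply: val_inj; case: i i0 => [[|[|[]]]].
have -> : Phi (fibS x (j f)) = (Phi \o fibS x \o j) f by [].
apply: (@mps_hom_eq 2 A (mps 2 K)) => [|a|i] /=.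
- by apply: mps_tsep => i; rewrite /= jXi mcoefX0.
- by rewrite lrmorph_algE fibS_A map_mpsA.
- by rewrite jXi map_mpsX.
Qed.

Lemma coord_exists s t : Phi (fibS x s) = px K -> Phi (fibS x t) = py K ->
  sec x (toD x s) = 0 -> toD x t = 0 ->
  exists j, [/\ @coord_map x j, j X = s & j Y = t].
Proof.
move=> ps pt ss tt; pose b (i : 'I_2) := if i == ord0 then s else t.
have xflat : flat (dS x) by case: xD => -[].
have pib i : (Phi \o fibS x) (b i) = mpsX K i.
  rewrite /b /=; have [->//|i0] := eqVneq i ord0.
  by have -> : i = ord_max by apply: val_inj; case: i i0 => [[|[|[]]]].
have [psi [psiB psiX _]] := flat_series resA fl xflat fibS_surj fibS_A fibS_ker pib.
have jX : psi X = s by rewrite psiX.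
have jY : psi Y = t by rewrite psiX.
by exists psi; split=> //; split=> //; rewrite jX jY.
Qed.

Lemma fibS_idD s : toD x s = 0 -> exists g, Phi (fibS x s) = g * py K.
Proof.
move=> ts; apply/ideal_gen1P.
have : kerset delta (fibS x s) by case: xD => _ _ _ [<- _] _; exists s.
by rewrite kdelta.
Qed.

Lemma lift_idD t : delta t = 0 -> exists2 s, toD x s = 0 & fibS x s = t.
Proof.
move=> dt; have : kerset delta t by [].
by case: xD => _ _ _ [<- _] _ [s ? <-]; exists s.
Qed.

Lemma coord_D j : coord_map j -> forall f, toD x (j f) = 0 <-> exists g, f = g * Y.
Proof.
move=> hj f; have [jB [jX jY] [sX tY]] := hj.
split=> [tf|[g ->]]; last by rewrite !rmorphM /= tY mulr0.
have [_ DS _ [fD _] _] := xD; have Dflat : flat (dD x) by case: xD => -[].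
have [sD sDK] := choice DS.
(* The data of a deformation contain no map from O_D of the family to its closed fibre; it is
   recovered from [fibS] by choosing preimages in O_S. *)
pose theta q := delta (fibS x (sD q)).
have thE s : theta (toD x s) = delta (fibS x s).
  apply/eqP; rewrite -subr_eq0 -!rmorphB; apply/eqP.
  change (kerset delta (fibS x (sD (toD x s) - s))); rewrite -fD.
  by exists (sD (toD x s) - s) => //; rewrite /idD /kerset /= rmorphB /= sDK subrr.
have thD : {morph theta : u v / u + v}.
  by move=> u v; rewrite -(sDK u) -(sDK v) -rmorphD !thE !rmorphD.
have thZ a q : theta (a *: q) = res a *: theta q.
  rewrite -(sDK q) -linearZ /= !thE -[a *: _]mulr_algl rmorphM.
  have -> : fibS x a%:A = (res a)%:A.
    by apply: (bij_inj PhiB); rewrite fibS_A lrmorph_algE.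
  by rewrite mulr_algl linearZ.
have kth q : theta q = 0 -> max_sub q.
  rewrite -{2}(sDK q) => /lift_idD[s ts fs].
  rewrite -[toD x _]subr0 -ts -rmorphB; apply: max_sub_lin; apply: fibS_ker.
  by rewrite !rmorphB /= fs subrr.
have hL : is_ideal (j @` ideal_gen [set Y]).
  by apply: image_ideal; [apply: bij_surj|apply: ideal_genP].
have : (j @` ideal_gen [set Y]) (j f).
  apply: (flat_kernel resA fl Dflat DS thD thZ kth hL _ tf) => s /fibS_idD[g gE].
  exists (j (inK g * Y)).
    split; last by rewrite !rmorphM /= tY mulr0.
    by exists (inK g * Y) => //; apply/ideal_gen1P; exists (inK g).
  apply: fibS_ker; rewrite !rmorphB /= gE coord_fib // rmorphM /= res_inK //.
  by rewrite map_mpsX subrr.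
by case=> g /ideal_gen1P[h ->] /(bij_inj jB) <-; exists h.
Qed.

Lemma coord_P j : coord_map j -> forall f, sec x (toD x (j f)) = mps_coef f 0%MM.
Proof.
move=> [_ _ [sX tY]] f; rewrite {1}(mps2_tailE f) !rmorphD !rmorphM /= sX tY rmorph0.
by rewrite !mul0r !addr0 !lrmorph_algE linearZ /= rmorph1 mulr1.
Qed.

Lemma toC_surj : surj (toC x).
Proof.
apply: flag_surj => s; have [_ _ [_ cf] _ cr] := xD.
have [t tE] := rhoS (fibC x s); have [_ fS _] : closed_fibre (fibS x) by case: xD => _ _ [].
have [u uE] := fS t; exists u; have [_ h] := closed_fibreP cf.
by apply: h; rewrite rmorphB /= cr uE tE subrr.
Qed.

(** An arbitrary lift of F0 has its image in m O_C; subtracting an element of m O_S with the same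
    image leaves the closed fibre unchanged. *)
Lemma toC_lift : exists2 s, Phi (fibS x s) = F0 & toC x s = 0.
Proof.
have [s0 s0E] := fibS_surj F0; have [_ _ [_ cf] _ cr] := xD.
have [_ h] := closed_fibreP cf.
have [l [hl lE]] : max_sub (toC x s0).
  apply: h; rewrite cr; change (kerset rho (fibS x s0)); rewrite krho.
  rewrite /preimage /mkset; have -> : Phi (fibS x s0) = F0 by [].
  by apply: ideal_gen_sub.
have [sg sgK] := choice toC_surj.
pose u := \sum_(p <- l) p.1 *: sg p.2.
exists (s0 - u).
  rewrite !rmorphB /=; have -> : Phi (fibS x s0) = F0 by [].
  rewrite /u !rmorph_sum big_seq big1 ?subr0 // => p /hl rp.
  by rewrite -mulr_algl !rmorphM /= fibS_A rp scale0r mul0r.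
rewrite rmorphB /= lE /u rmorph_sum -sumrB big1 // => p _.
by rewrite /= linearZ /= sgK subrr.
Qed.

Lemma coord_C j G : coord_map j -> Phi (fibS x (j G)) = F0 -> toC x (j G) = 0 ->
  forall f, toC x (j f) = 0 <-> exists g, f = g * G.
Proof.
move=> hj jG tG f; have [jB _ _] := hj.
split=> [tf|[g ->]]; last by rewrite !rmorphM /= tG mulr0.
have [_ _ [_ cf] _ cr] := xD; have Cflat : flat (dC x) by case: xD => -[].
have [cA ck] := closed_fibreP cf.
have cZ a q : fibC x (a *: q) = res a *: fibC x q by rewrite -mulr_algl rmorphM cA mulr_algl.
have hL : is_ideal (j @` ideal_gen [set G]).
  by apply: image_ideal; [apply: bij_surj|apply: ideal_genP].
have : (j @` ideal_gen [set G]) (j f).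
  apply: (flat_kernel resA fl Cflat toC_surj (rmorphD (fibC x)) cZ ck hL _ tf) => s ts.
  have [h hE] : exists h, Phi (fibS x s) = h * F0.
    apply/ideal_gen1P; have : kerset rho (fibS x s) by rewrite /kerset /= -cr ts rmorph0.
    by rewrite krho.
  exists (j (inK h * G)).
    split; last by rewrite !rmorphM /= tG mulr0.
    by exists (inK h * G) => //; apply/ideal_gen1P; exists (inK h).
  apply: fibS_ker; rewrite !rmorphB /= hE !rmorphM /= jG coord_fib // res_inK //.
  by rewrite subrr.
by case=> g /ideal_gen1P[h ->] /(bij_inj jB) <-; exists h.
Qed.

Lemma lift_coords : exists s t, [/\ Phi (fibS x s) = px K, Phi (fibS x t) = py K,
  sec x (toD x s) = 0 & toD x t = 0].
Proof.
have [_ _ _ [fD fP] _] := xD.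
have [u uE] := bij_surj PhiB (px K); have [v vE] := bij_surj PhiB (py K).
have : maxid OS u.
  move=> [b ub]; have : maxid _ (px K) by apply/mps_maxid_field/mcoefX0.
  by apply; exists (Phi b); rewrite -uE -rmorphM ub rmorph1.
rewrite -fP => -[s ss su]; have [t tt tv] : exists2 t, toD x t = 0 & fibS x t = v.
  apply: lift_idD; change (kerset delta v); rewrite kdelta /preimage /mkset vE.
  by apply: ideal_gen_sub.
by exists s, t; split=> //; rewrite ?su ?tv.
Qed.

Lemma presented_exists : exists G, presented G x.
Proof.
have [s [t [ps pt ss tt]]] := lift_coords.
have [j [hj _ _]] := coord_exists ps pt ss tt.
have [u uF uC] := toC_lift; have [jB _ _] := hj; have [G GE] := bij_surj jB u.
by exists G, j; rewrite GE.
Qed.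

End OverA.
End DeformationStructure.

(** * Base change of power series rings *)

Section Pushout.
Variables (K : fieldType) (A' : comAlgType K) (res : {rmorphism A' -> K}).
Variables (r : nat) (e : 'I_r -> A') (c : 'I_r -> A' -> K).
Hypothesis fl : flag_basis res e c.
Variables (n : nat) (A : comNzRingType) (kappa : {rmorphism K -> A}) (phi : {rmorphism A -> A'}).
Hypothesis phik : forall k, phi (kappa k) = k%:A.
Hypothesis span : forall f : mps n A, exists l : seq (A * mps n K),
  f = \sum_(p <- l) p.1%:A * map_mps kappa p.2.
Local Notation inK := (@map_mps n K A' (in_alg A')).
Local Notation coord := (mps_coord c).

Lemma map_mps_kappa (p : mps n K) : map_mps phi (map_mps kappa p) = inK p.
Proof. by apply: mpsext => m; rewrite !mcoef_map phik. Qed.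

Lemma mps_coordD i : {morph @coord n i : f g / f + g}.
Proof. by move=> f g; apply: mpsext => m; rewrite mcoefD [LHS](flagD fl). Qed.

Lemma mps_coord_inK i a (p : mps n K) : coord i (a *: inK p) = c i a *: p.
Proof.
apply: mpsext => m; rewrite mcoefZ [LHS]/mps_coef /= mcoefZ mcoef_map.
by rewrite -scalerAr mulr1 (flagZ fl) mulrC.
Qed.

(** A' has a finite K-basis e_i, so a series over A' is a sum of e_i f_i with f_i over K, and the
    map is forced to be sum h(e_i) g(f_i). The map [kappa] covers two cases at once: base change
    from an artinian A, and A = K for the constant inclusion. *)
Lemma mps_pushout (T : comNzRingType) (g : {rmorphism mps n A -> T}) (h : {rmorphism A' -> T}) :
  (forall a, g a%:A = h (phi a)) ->
  exists u : {rmorphism mps n A' -> T},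
    [/\ forall f, u (map_mps phi f) = g f, forall a, u a%:A = h a
      & forall u' : {rmorphism mps n A' -> T},
          (forall f, u' (map_mps phi f) = g f) -> (forall a, u' a%:A = h a) -> u' =1 u].
Proof.
move=> gh; pose u (f : mps n A') := \sum_i h (e i) * g (map_mps kappa (coord i f)).
have uD : {morph u : f f' / f + f'}.
  move=> f f'; rewrite /u -big_split; apply: eq_bigr => i _ /=.
  by rewrite mps_coordD !rmorphD mulrDr.
have u0 : u 0 = 0 by apply: (addrI (u 0)); rewrite -uD !addr0.
have us (I : Type) (s : seq I) (F : I -> mps n A') : u (\sum_(i <- s) F i) = \sum_(i <- s) u (F i).
  exact: (big_morph u uD u0).
have uE a p : u (a *: inK p) = h a * g (map_mps kappa p).
  rewrite /u [in RHS](flag_sum fl a) rmorph_sum mulr_suml; apply: eq_bigr => i _.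
  rewrite mps_coord_inK map_mpsZ -[_ *: map_mps _ _]mulr_algl rmorphM gh phik.
  by rewrite mulrA -rmorphM -scalerAr mulr1.
have u1 : u 1 = 1 by rewrite -[1]scale1r -(rmorph1 inK) uE !rmorph1 mulr1.
have uM : {morph u : f f' / f * f'}.
  move=> f f'; rewrite {1}(mps_coord_sum fl f) {1}(mps_coord_sum fl f') mulr_suml us.
  rewrite [in RHS]/u mulr_suml; apply: eq_bigr => i _.
  rewrite mulr_sumr [X in u X]mulr_sumr us; apply: eq_bigr => j _.
  rewrite -scalerAl -scalerAr scalerA -rmorphM uE !rmorphM /=; ring.
exists (mk_rmorph uD uM u1); split=> [f|a|u' u'phi u'A f] /=.
- have [l ->] := span f; rewrite !rmorph_sum us; apply: eq_bigr => p _.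
  rewrite !rmorphM /= map_mpsA map_mps_kappa mulr_algl uE gh //.
- by rewrite -[1](rmorph1 inK) uE !rmorph1 mulr1.
rewrite {1}(mps_coord_sum fl f) rmorph_sum; apply: eq_bigr => i _.
by rewrite -mulr_algl rmorphM u'A -u'phi map_mps_kappa.
Qed.
End Pushout.

Lemma AC_nilpotent (K : fieldType) (A : comAlgType K) a : in_AC A -> maxid A a ->
  exists N, a ^+ N = 0.
Proof.
case=> hm art _ ma; have [N hN] := artin_nilpotent hm art; exists N.
have : ideal_pow (maxid A) N (a ^+ N).
  elim: N {hN} => // N IHN; apply: ideal_gen_sub.
  by exists a => //; exists (a ^+ N); rewrite ?exprS.
by rewrite hN.
Qed.

(** The element a - res a is nilpotent, so its image in the field K is 0. *)
Lemma AC_local (K : fieldType) (A A' : comAlgType K) (phi : {lrmorphism A -> A'})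
    (res : {rmorphism A -> K}) (res' : {rmorphism A' -> K}) a :
  in_AC A -> (forall k, res k%:A = k) -> (forall a, maxid A a <-> res a = 0) ->
  (forall k, res' k%:A = k) -> res' (phi a) = res a.
Proof.
move=> AC resA resP resA'; have /resP /(AC_nilpotent AC)[N aN] : res (a - (res a)%:A) = 0.
  by rewrite rmorphB resA subrr.
have : res' (phi (a - (res a)%:A)) ^+ N = 0 by rewrite -!rmorphXn aN !rmorph0.
move/eqP; rewrite expf_eq0 => /andP[_]; rewrite !rmorphB /= lrmorph_algE resA'.
by rewrite subr_eq0 => /eqP.
Qed.

Section DeformationMaps.
Variables (K : fieldType) (OS OD OC : comAlgType K).
Variables (delta : {lrmorphism OS -> OD}) (rho : {lrmorphism OS -> OC}).
Variables (Phi : {lrmorphism OS -> mps 2 K}) (F0 : mps 2 K).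
Hypothesis PhiB : bijective Phi.
Hypothesis kdelta : kerset delta = Phi @^-1` ideal_gen [set py K].
Hypothesis rhoS : surj rho.
Hypothesis krho : kerset rho = Phi @^-1` ideal_gen [set F0].
Local Notation presented := (presented Phi F0).
Local Notation coord_map := (@coord_map K OS OC Phi).
Local Notation is_deform := (is_deform delta rho).

Section OverA.
Variables (A : comAlgType K).
Hypothesis AC : in_AC A.
Implicit Types (x y : deform OS OC A).
Local Notation X := (mpsX A (ord0 : 'I_2)).
Local Notation Y := (mpsX A (ord_max : 'I_2)).

Lemma AC_coord_D x : is_deform x -> forall j, coord_map j ->
  forall f, toD x (j f) = 0 <-> exists g, f = g * Y.
Proof.
by have [res [r [e [c [resA resP fl]]]]] := AC_flag AC; move=> xD; apply: (coord_D PhiB kdelta resA resP fl xD).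
Qed.

Lemma AC_coord_P x : forall j, @coord_map A x j ->
  forall f, sec x (toD x (j f)) = mps_coef f 0%MM.
Proof. exact: coord_P. Qed.

Lemma AC_toC_surj x : is_deform x -> surj (toC x).
Proof.
by have [res [r [e [c [resA resP fl]]]]] := AC_flag AC; move=> xD; apply: (toC_surj rhoS resA resP fl xD).
Qed.

Lemma AC_coord_C x : is_deform x -> forall j G, coord_map j ->
  Phi (fibS x (j G)) = F0 -> toC x (j G) = 0 ->
  forall f, toC x (j f) = 0 <-> exists g, f = g * G.
Proof.
by have [res [r [e [c [resA resP fl]]]]] := AC_flag AC; move=> xD;
  apply: (coord_C PhiB rhoS krho resA resP fl xD).
Qed.

Lemma AC_presented_exists x : is_deform x -> exists G, presented G x.
Proof.
by have [res [r [e [c [resA resP fl]]]]] := AC_flag AC; move=> xD;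
  apply: (presented_exists PhiB kdelta rhoS krho resA resP fl xD).
Qed.

Lemma AC_coord_exists x : is_deform x -> forall s t,
  Phi (fibS x s) = px K -> Phi (fibS x t) = py K ->
  sec x (toD x s) = 0 -> toD x t = 0 ->
  exists j, [/\ @coord_map A x j, j X = s & j Y = t].
Proof.
by have [res [r [e [c [resA resP fl]]]]] := AC_flag AC; move=> xD; apply: (coord_exists PhiB resA resP fl xD).
Qed.

Lemma presented_iso x y G : is_deform x -> is_deform y ->
  presented G x -> presented G y -> deform_iso x y.
Proof.
move=> xD yD [j [hj jG tG]] [j' [hj' jG' tG']].
have [jB [jX jY] [sX tY]] := hj; have [jB' [jX' jY'] [sX' tY']] := hj'.
have [k [jk kj]] := inv_lrmorph jB; have [k' [jk' kj']] := inv_lrmorph jB'.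
have xS := AC_toC_surj xD; have yS := AC_toC_surj yD.
have Cx := AC_coord_C xD hj jG tG; have Cy := AC_coord_C yD hj' jG' tG'.
pose alpha : {lrmorphism dS x -> dS y} := j' \o k.
have aj f : alpha (j f) = j' f by rewrite /= jk.
have [|beta betaE] := rmorph_factor (p := toC x) (g := toC y \o alpha) xS.
  by move=> s; rewrite -(kj s) /= jk => /Cx/Cy.
have betaA a : beta a%:A = a%:A by rewrite -(lrmorph_algE (toC x)) betaE /= !lrmorph_algE.
have alphaB : bijective alpha.
  by exists (j \o k') => s /=; rewrite ?jk ?jk' ?kj ?kj'.
exists alpha, (mk_lrmorph (lrmorph_of_alg betaA)); split.
- split=> //; apply: inj_surj_bij => /=.
    move=> u v uv; apply/eqP; rewrite -subr_eq0; apply/eqP.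
    have [s sE] := xS (u - v); have : beta (u - v) = 0 by rewrite rmorphB uv subrr.
    by rewrite -sE betaE -(kj s) /= jk => /Cy/Cx.
  by move=> u; have [s <-] := yS u; exists (toC x (j (k' s))); rewrite betaE /= jk kj'.
- have fibE s : fibS y (alpha s) = fibS x s.
    apply: (bij_inj PhiB); rewrite -(kj s) aj.
    have [res [r [e [c [resA resP fl]]]]] := AC_flag AC.
    by rewrite (coord_fib resA resP xD hj) (coord_fib resA resP yD hj').
  split=> // u /=; have [s <-] := xS u; rewrite betaE /=.
  by have [_ _ _ _ ->] := xD; have [_ _ _ _ ->] := yD; rewrite fibE.
- by move=> s; rewrite /= betaE.
have Dx := AC_coord_D xD hj; have Dy := AC_coord_D yD hj'.
split; apply/seteqP; split=> s.
- by case=> u + <-; rewrite -(kj u) aj => /Dx/Dy.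
- by move=> ts; exists (j (k' s)); rewrite ?aj ?kj' //; apply/Dx/Dy; rewrite kj'.
- case=> u + <-; rewrite -(kj u) aj.
  change (sec x (toD x (j (k u))) = 0 -> sec y (toD y (j' (k u))) = 0).
  by rewrite (AC_coord_P hj) (AC_coord_P hj').
- move=> ts; exists (j (k' s)); rewrite ?aj ?kj' //; move: ts; rewrite -{1}(kj' s).
  change (sec y (toD y (j' (k' s))) = 0 -> sec x (toD x (j (k' s))) = 0).
  by rewrite (AC_coord_P hj) (AC_coord_P hj').
Qed.

Lemma iso_presented x y G : presented G x -> deform_iso x y -> presented G y.
Proof.
move=> [j [[jB [jX jY] [sX tY]] jG tG]] [alpha [beta [[aB bB] [fS fC] ab [aD aP]]]].
exists (alpha \o j); split=> /=; rewrite ?fS //; last by rewrite -ab tG rmorph0.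
split; [exact: bij_comp|by rewrite /= !fS|split=> /=].
  have : [set alpha z | z in Defs.idP (x := x)] (alpha (j X)) by exists (j X).
  by rewrite aP.
have : [set alpha z | z in idD (x := x)] (alpha (j Y)) by exists (j Y).
by rewrite aD.
Qed.

(** An isomorphism class is thereby described by any one of its equations, so equality of classes
    can be proved by exhibiting a common equation. *)
Lemma iso_class_presented x G : is_deform x -> presented G x ->
  iso_class delta rho x = fun y => is_deform y /\ presented G y.
Proof.
move=> xD xG; apply/funext => y; apply/propext; split=> -[yD h]; split=> //.
  exact: iso_presented h.
exact: presented_iso xG h.
Qed.

Lemma mps_span n (f : mps n A) : exists l : seq (A * mps n K),
  f = \sum_(p <- l) p.1%:A * map_mps (in_alg A) p.2.
Proof.
have [res [r [e [c [resA resP fl]]]]] := AC_flag AC.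
exists [seq (e i, mps_coord c i f) | i <- enum 'I_r]; rewrite big_map big_enum /=.
by rewrite {1}(mps_coord_sum fl f); apply: eq_bigr => i _; rewrite mulr_algl.
Qed.

(** On D = V(Y) the ideal of P is generated by X: a series without constant term is X times its
    first tail plus Y times the second, and Y vanishes on D. So the w-th power consists of the
    restrictions of multiples of X^w. *)
Lemma contains_coord x j G w : coord_map j -> contains_mP w x -> toC x (j G) = 0 ->
  is_deform x -> exists a b, G = a * X ^+ w + b * Y.
Proof.
move=> hj cw tG xD; have [jB [jX jY] [sX tY]] := hj.
have hpow k : ideal_pow (kerset (sec x)) k `<=` [set q | exists a, q = toD x (j (a * X ^+ k))].
  have [_ DS _ _ _] := xD.
  elim: k => [|k IHk] q.
    by move=> _; have [s <-] := DS q; have [a <-] := bij_surj jB s; exists a; rewrite mulr1.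
  apply: (ideal_gen_min (I := [set q | exists a, q = toD x (j (a * X ^+ k.+1))])).
    split=> [|_ _ [a ->] [b ->]|s _ [b ->]].
    - by exists 0; rewrite mul0r !rmorph0.
    - by exists (a + b); rewrite mulrDl !rmorphD.
    - have [u <-] := DS s; have [a <-] := bij_surj jB u.
      by exists (a * b); rewrite -!rmorphM mulrA.
  move=> _ [s ss [_ /IHk[b ->] <-]].
  have [u uE] := DS s; have [a aE] := bij_surj jB u.
  move: ss; rewrite /kerset /mkset -uE -aE (AC_coord_P hj) => a0.
  exists (mps_tail ord0 a * b).
  rewrite {1}(mps2_tailE a) a0 scale0r add0r -!rmorphM mulrDl !rmorphD !rmorphM /= tY.
  by rewrite exprS !rmorphM /=; ring.
have [a aE] : exists a, toD x (j G) = toD x (j (a * X ^+ w)).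
  by apply: hpow; apply: cw; exists (j G).
have : toD x (j (G - a * X ^+ w)) = 0 by rewrite !rmorphB /= aE subrr.
by move=> /(AC_coord_D xD hj)[b bE]; exists a, b; rewrite -bE addrC subrK.
Qed.

Lemma coord_contains x j G w a b : coord_map j -> Phi (fibS x (j G)) = F0 -> toC x (j G) = 0 ->
  is_deform x -> G = a * X ^+ w + b * Y -> contains_mP w x.
Proof.
move=> hj jG tG xD GE _ [s ts <-]; have [jB [jX jY] [sX tY]] := hj.
have [f fE] := bij_surj jB s.
have [g gE] : exists g, f = g * G by apply/(AC_coord_C xD hj jG tG); rewrite fE.
have hpow k q : ideal_pow (kerset (sec x)) k (q * toD x (j X) ^+ k).
  elim: k q => // k IHk q; apply: ideal_gen_sub.
  exists (toD x (j X)); first by [].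
  exists (q * toD x (j X) ^+ k); first exact: IHk.
  by rewrite exprS mulrCA.
rewrite -fE gE GE.
have -> : toD x (j (g * (a * X ^+ w + b * Y))) = toD x (j (g * a)) * toD x (j X) ^+ w.
  by do !rewrite (rmorphM, rmorphD, rmorphXn) /=; rewrite tY; ring.
exact: hpow.
Qed.

End OverA.

Section BaseChange.
Variables (A A' : comAlgType K) (phi : {lrmorphism A -> A'}).
Hypotheses (AC : in_AC A) (AC' : in_AC A').
Variables (x : deform OS OC A) (x' : deform OS OC A').
Hypotheses (xD : is_deform x) (xD' : is_deform x').
Variable G : mps 2 A.
Local Notation X := (mpsX A (ord0 : 'I_2)).
Local Notation Y := (mpsX A (ord_max : 'I_2)).
Local Notation X' := (mpsX A' (ord0 : 'I_2)).
Local Notation Y' := (mpsX A' (ord_max : 'I_2)).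

Lemma ord2_ind (P : 'I_2 -> Prop) : P ord0 -> P ord_max -> forall i, P i.
Proof.
move=> P0 P1 i; have [->//|i0] := eqVneq i ord0.
by have -> : i = ord_max by apply: val_inj; case: i i0 => [[|[|[]]]].
Qed.

Lemma base_change_presented : presented G x -> base_change phi x x' ->
  presented (map_mps phi G) x'.
Proof.
move=> [j [[jB [jX jY] [sX tY]] jG tG]] [bS [bC [[[bSA _] _] [fS fC] bSC bD bP]]].
have tY' : toD x' (bS (j Y)) = 0.
  have : idD (x := x') (bS (j Y)) by rewrite bD; apply: ideal_gen_sub; exists (j Y).
  exact.
have [|||j' [hj' jX' jY']] := AC_coord_exists AC' xD' (s := bS (j X)) (t := bS (j Y)) _ _ _ tY'.
- by rewrite fS.
- by rewrite fS.
- by rewrite bP sX rmorph0.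
have [jB' _ _] := hj'; have [k' [jk' kj']] := inv_lrmorph jB'.
have jE f : j' (map_mps phi f) = bS (j f).
  rewrite -[RHS]kj'; congr (j' _).
  have -> : k' (bS (j f)) = (k' \o bS \o j) f by [].
  apply: (@mps_hom_eq 2 A (mps 2 A') (map_mps phi)) => [|a|] /=.
  - by apply: mps_tsep => i; rewrite map_mpsX mcoefX0.
  - by rewrite map_mpsA lrmorph_algE bSA lrmorph_algE.
  - apply: ord2_ind; rewrite map_mpsX ?jX -?jX' -?jY' jk' //.
exists j'; split=> //; rewrite jE; first by rewrite fS.
by rewrite -bSC tG rmorph0.
Qed.

Lemma presented_base_change : presented G x -> presented (map_mps phi G) x' ->
  base_change phi x x'.
Proof.
move=> [j [hj jG tG]] [j' [hj' jG' tG']].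
have [jB [jX jY] [sX tY]] := hj; have [jB' [jX' jY'] [sX' tY']] := hj'.
have [k [jk kj]] := inv_lrmorph jB; have [k' [jk' kj']] := inv_lrmorph jB'.
have xS := AC_toC_surj AC xD; have xS' := AC_toC_surj AC' xD'.
have Cx := AC_coord_C AC xD hj jG tG; have Cx' := AC_coord_C AC' xD' hj' jG' tG'.
have [res [r [e [c [resA resP fl]]]]] := AC_flag AC.
have [res' [r' [e' [c' [resA' resP' fl']]]]] := AC_flag AC'.
pose bS : {rmorphism dS x -> dS x'} := j' \o map_mps phi \o k.
have bSj f : bS (j f) = j' (map_mps phi f) by rewrite /= jk.
have bSA a : bS a%:A = (phi a)%:A by rewrite /= lrmorph_algE map_mpsA lrmorph_algE.
have [|bC bCE] := rmorph_factor (p := toC x) (g := toC x' \o bS) xS.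
  move=> s; rewrite -(kj s) => /Cx[g ->] /=; rewrite jk rmorphM; apply/Cx'.
  by exists (map_mps phi g).
have fibE s : fibS x' (bS s) = fibS x s.
  apply: (bij_inj PhiB); rewrite -(kj s) bSj.
  rewrite (coord_fib resA resP xD hj) (coord_fib resA' resP' xD' hj').
  by apply: mpsext => m; rewrite !mcoef_map (AC_local phi _ AC resA resP resA').
have cocS : cocartesian phi bS.
  split=> // T g h gh.
  have [|||u0 [u0phi u0A u0U]] := mps_pushout fl' (kappa := in_alg A) (phi := phi) _ _
    (g := g \o j) (h := h).
  - by move=> a; apply: lrmorph_algE.
  - exact: mps_span.
  - by move=> a; rewrite /= lrmorph_algE.
  exists (u0 \o k'); split=> [s|a|u' u'b u'A s] /=.
  - by rewrite jk' u0phi /= kj.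
  - by rewrite lrmorph_algE u0A.
  have -> : u' s = (u' \o j') (k' s) by rewrite /= kj'.
  apply: u0U => [f|a] /=; last by rewrite lrmorph_algE.
  by rewrite -bSj u'b.
have bCA a : bC a%:A = (phi a)%:A.
  rewrite -(lrmorph_algE (toC x)); apply: (etrans (bCE _)).
  by apply: (etrans (congr1 (toC x') (bSA a))); apply: lrmorph_algE.
(* C is cut out by G over A and by its image over A', so a map out of the pushout of O_S that kills
   G descends to O_C. *)
have cocC : cocartesian phi bC.
  split=> // T g h gh; have [_ cS] := cocS.
  have [|u0 [u0b u0A u0U]] := cS T (g \o toC x) h.
    by move=> a; rewrite /= lrmorph_algE.
  have [|u uE] := rmorph_factor (p := toC x') (g := u0) xS'.
    move=> s; rewrite -(kj' s) => /Cx'[f ->]; rewrite !rmorphM /= -bSj u0b /= tG rmorph0.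
    by rewrite mulr0.
  exists u; split=> [q|a|u' u'b u'A q].
  - by have [s <-] := xS q; rewrite bCE /= uE; exact: u0b.
  - by rewrite -(lrmorph_algE (toC x')) uE u0A.
  have [s <-] := xS' q; rewrite uE; apply: (u0U (u' \o toC x')) => [t|a] /=.
    by rewrite -u'b bCE.
  by rewrite lrmorph_algE.
have Dx := AC_coord_D AC xD hj; have Dx' := AC_coord_D AC' xD' hj'.
exists bS, bC; split=> //.
- split=> // q; have [s <-] := xS q; rewrite bCE /=.
  by have [_ _ _ _ ->] := xD; have [_ _ _ _ ->] := xD'; rewrite fibE.
- apply/seteqP; split=> s.
    rewrite -(kj' s) => /Dx'[g ->]; rewrite rmorphM; apply: (idealM _ (ideal_genP _)).
    apply: ideal_gen_sub; exists (j Y); first exact: tY.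
    by rewrite bSj map_mpsX.
  apply: ideal_gen_min; first exact: ker_ideal.
  move=> _ [t + <-]; rewrite -(kj t) => /Dx[g ->]; rewrite bSj; apply/Dx'.
  by exists (map_mps phi g); rewrite rmorphM /= map_mpsX.
- move=> s; rewrite -(kj s) bSj (AC_coord_P hj) (AC_coord_P hj').
  by rewrite mcoef_map.
Qed.

End BaseChange.
End DeformationMaps.

(** * Deformations with a prescribed equation *)

Section DeformationExists.
Variables (K : fieldType) (OS OD OC : comAlgType K).
Variables (delta : {lrmorphism OS -> OD}) (rho : {lrmorphism OS -> OC}).
Variables (Phi : {lrmorphism OS -> mps 2 K}) (F0 : mps 2 K).
Hypothesis PhiB : bijective Phi.
Hypothesis kdelta : kerset delta = Phi @^-1` ideal_gen [set py K].
Hypothesis rhoS : surj rho.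
Hypothesis krho : kerset rho = Phi @^-1` ideal_gen [set F0].
Hypothesis F00 : mps_coef F0 0%MM = 0.
Local Notation presented := (presented Phi F0).
Local Notation coord_map := (@coord_map K OS OC Phi).
Local Notation is_deform := (is_deform delta rho).

Section OverA.
Variables (A : comAlgType K) (res : {rmorphism A -> K}).
Variables (r : nat) (e : 'I_r -> A) (c : 'I_r -> A -> K).
Hypothesis AC : in_AC A.
Hypothesis resA : forall k, res k%:A = k.
Hypothesis resP : forall a, maxid A a <-> res a = 0.
Hypothesis fl : flag_basis res e c.
Local Notation X := (mpsX A (ord0 : 'I_2)).
Local Notation Y := (mpsX A (ord_max : 'I_2)).
Local Notation inK := (@map_mps 2 K A (in_alg A)).

Lemma closed_fibre_intro (B : comAlgType A) (B0 : comAlgType K) (pi : {rmorphism B -> B0}) :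
  (forall a, pi a%:A = (res a)%:A) -> surj pi -> (forall s, pi s = 0 -> max_sub res s) ->
  closed_fibre pi.
Proof.
move=> piA piS kpi; split=> // [k|]; first by rewrite piA resA.
apply/seteqP; split=> s.
  move=> /kpi[l [hl ->]]; rewrite big_seq.
  apply: (ideal_sum _ (ideal_genP _)) => p /hl/resP rp.
  rewrite -mulr_algl; apply: (idealMr _ (ideal_genP _)).
  by apply: ideal_gen_sub; exists p.1.
apply: ideal_gen_min; first exact: ker_ideal.
by move=> _ [a /resP ra <-]; rewrite /kerset /= piA ra scale0r.
Qed.

Lemma closed_fibre_quot (B Q : comAlgType A) (B0 Q0 : comAlgType K)
    (p : {lrmorphism B -> Q}) (pi : {rmorphism B -> B0}) (p0 : {rmorphism B0 -> Q0})
    (pi' : {rmorphism Q -> Q0}) :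
  surj p -> surj pi -> surj p0 -> (forall a, pi a%:A = (res a)%:A) ->
  (forall k, p0 k%:A = k%:A) ->
  (forall s, pi s = 0 -> max_sub res s) -> (forall b, pi' (p b) = p0 (pi b)) ->
  (forall b0, p0 b0 = 0 -> exists2 b, p b = 0 & pi b = b0) -> closed_fibre pi'.
Proof.
move=> pS piS p0S piA p0K kpi pi'E lft; apply: closed_fibre_intro => [a|q0|q].
- by rewrite -(lrmorph_algE p) pi'E piA p0K.
- have [b0 <-] := p0S q0; have [b <-] := piS b0; by exists (p b).
have [b <-] := pS q; rewrite pi'E => /lft[b' pb' pib'].
rewrite -[p b]subr0 -pb' -rmorphB; apply: max_sub_lin; apply: kpi.
by rewrite rmorphB pib' subrr.
Qed.

Definition mps_const_fun n (f : mps n A) : A := mps_coef f 0%MM.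
Fact mps_const_D n : {morph @mps_const_fun n : f g / f + g}. Proof. by []. Qed.
Fact mps_const_M n : {morph @mps_const_fun n : f g / f * g}.
Proof. by move=> f g; apply: mcoefM0. Qed.
Fact mps_const_1 n : @mps_const_fun n 1 = 1. Proof. by rewrite /mps_const_fun mcoef1 eqxx. Qed.
Definition mps_const n := mk_rmorph (@mps_const_D n) (@mps_const_M n) (@mps_const_1 n).

(** S is A[[x, y]] itself and D, C are quotients of it. C is flat because Weierstrass division by
    the equation gives unique remainders of degree below w in x. *)
Lemma deform_exists w g : map_mps res (Y * g + X ^+ w) = F0 ->
  exists x : deform OS OC A, [/\ is_deform x, presented (Y * g + X ^+ w) x & contains_mP w x].
Proof.
set G := _ + _ => resG.
have [Psi [PhiK PsiK]] := inv_lrmorph PhiB.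
have G00 : res (mps_coef G 0%MM) = 0 by rewrite -mcoef_map resG F00.
have notin1 (H : mps 2 A) : res (mps_coef H 0%MM) = 0 -> ~ ideal_gen [set H] 1.
  move=> H0 /ideal_gen1P[u /(congr1 (fun h => res (mps_coef h 0%MM)))].
  by rewrite mcoefM0 mcoef1 eqxx rmorph1 rmorphM H0 mulr0 => /eqP; rewrite oner_eq0.
have Y1 : ~ ideal_gen [set Y] 1 by apply: notin1; rewrite mcoefX0 rmorph0.
have [Q [p [pS kp]]] := quot_algP (ideal_genP _) Y1.
have [C [q [qS kq]]] := quot_algP (ideal_genP _) (notin1 _ G00).
have [|sc scE] := rmorph_factor (p := p) (g := mps_const 2) pS.
  move=> f pf; have : kerset p f by []; rewrite kp => /ideal_gen1P[h ->].
  by rewrite /= /mps_const_fun mcoefM0 mcoefX0 mulr0.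
have scZ : scalable_for *%R sc.
  move=> a u; rewrite -mulr_algl rmorphM -(lrmorph_algE p) scE /= /mps_const_fun.
  by rewrite mcoefA eqxx mulr1n.
pose fS : {rmorphism mps 2 A -> OS} := Psi \o map_mps res.
have fSA a : fS a%:A = (res a)%:A by rewrite /= map_mpsA lrmorph_algE.
have fSS : surj fS.
  by move=> s; exists (inK (Phi s)); rewrite /= res_inK // PhiK.
have kfS f : fS f = 0 -> max_sub res f.
  move=> fSf; apply: (coefs_max_sub resA fl) => m.
  have : map_mps res f = 0 by rewrite -[LHS]PsiK -/fS; move: fSf => /= ->; rewrite rmorph0.
  by move/(congr1 (fun h => mps_coef h m)); rewrite mcoef_map.
have PhifS f : Phi (fS f) = map_mps res f by rewrite /= PsiK.
have [|fC fCE] := rmorph_factor (p := q) (g := rho \o fS) qS.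
  move=> f qf; have : kerset q f by []; rewrite kq => /ideal_gen1P[h ->].
  rewrite rmorphM [X in _ * X](_ : _ = 0) ?mulr0 //.
  have : kerset rho (fS G); last by [].
  by rewrite krho /preimage /mkset PhifS resG; apply: ideal_gen_sub.
have pY : p Y = 0 by have : kerset p Y by rewrite kp; apply: ideal_gen_sub.
have qG : q G = 0 by have : kerset q G by rewrite kq; apply: ideal_gen_sub.
pose x : deform OS OC A := @Deform K OS OC A (mps 2 A) Q C p q (mk_lrmorph_reg scZ) fS fC.
have xD : is_deform x.
  split=> //=.
  - split; first exact: (flat_mps fl).
      exact: (flat_mps_y fl pS kp).
    by apply: (flat_mps_weierstrass fl (w := w) (g := g) qS); rewrite kq addrC.
  - split; first by apply: closed_fibre_intro.
    apply: (closed_fibre_quot (p := q) (pi := fS) (p0 := rho)) => //.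
      by move=> k; apply: lrmorph_algE.
    move=> s rs; have : kerset rho s by [].
    rewrite krho => /ideal_gen1P[h hE]; exists (inK h * G).
      by rewrite rmorphM /= qG mulr0.
    by apply: (bij_inj PhiB); rewrite PhifS rmorphM /= res_inK // resG hE.
  - split; apply/seteqP; split=> s.
    + case=> f pf <-; rewrite kdelta /preimage /mkset PhifS; apply/ideal_gen1P.
      have : kerset p f by [].
      rewrite kp => /ideal_gen1P[h ->]; exists (map_mps res h).
      by rewrite rmorphM /= map_mpsX.
    + rewrite kdelta => /ideal_gen1P[h hE]; exists (inK h * Y).
        by rewrite /idD /kerset /= rmorphM /= pY mulr0.
      by apply: (bij_inj PhiB); rewrite PhifS rmorphM /= res_inK // map_mpsX hE.
    + case=> f; rewrite /Defs.idP /mkset /= scE /= /mps_const_fun => f0 <- [u fu].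
      have : mps_coef (Phi (fS f * u)) 0%MM = 0.
        by rewrite rmorphM mcoefM0 (congr1 (fun h => mps_coef h 0%MM) (PhifS f)) mcoef_map f0 rmorph0 mul0r.
      by rewrite fu rmorph1 mcoef1 eqxx => /eqP; rewrite oner_eq0.
    + move=> ms; exists (inK (Phi s)); last by apply: (bij_inj PhiB); rewrite PhifS res_inK.
      rewrite /Defs.idP /mkset /= scE /= /mps_const_fun mcoef_map.
      suff -> : mps_coef (Phi s) 0%MM = 0 by rewrite rmorph0.
      apply/mps_maxid_field => -[u su]; apply: ms; exists (Psi u).
      by apply: (bij_inj PhiB); rewrite rmorphM /= PsiK su rmorph1.
have hj : coord_map (x := x) idfun.
  split; [by exists idfun|split|split] => /=; rewrite ?PhifS ?map_mpsX //.
  by rewrite scE /= /mps_const_fun mcoefX0.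
exists x; split=> //.
  by exists idfun; split=> //=; rewrite PhifS.
have jG : Phi (fibS x (idfun G)) = F0 by rewrite /= PhifS.
apply: (coord_contains PhiB rhoS krho AC hj jG qG xD (a := 1) (b := g)).
by rewrite /G mul1r addrC mulrC.
Qed.

End OverA.

(** The prescribed equation is a function of the constant inclusion j; the hypothesis evaluates it
    at the inclusion built from coordinates, which sends s to its series with constant
    coefficients. *)
Lemma presented_embedded (A : comAlgType K) (x : deform OS OC A)
    (Ft : {rmorphism OS -> dS x} -> dS x) G :
  in_AC A -> is_deform x -> presented G x ->
  (forall (j0 : {lrmorphism mps 2 A -> dS x}) (j : {rmorphism OS -> dS x}),
     (forall s, j s = j0 (map_mps (in_alg A) (Phi s))) -> Ft j = j0 G) ->
  embedded_by delta x Ft.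
Proof.
move=> AC xD [j0 [hj jG tG]] FtE; have [jB [jX jY] [sX tY]] := hj.
have [res [r [e [c [resA resP fl]]]]] := AC_flag AC.
have [k [jk kj]] := inv_lrmorph jB; have [Psi [PhiK PsiK]] := inv_lrmorph PhiB.
have fj := coord_fib resA resP xD hj.
pose j : {rmorphism OS -> dS x} := j0 \o map_mps (in_alg A) \o Phi.
have jE s : j s = j0 (map_mps (in_alg A) (Phi s)) by [].
have fjE s : fibS x (j s) = s.
  by apply: (bij_inj PhiB); rewrite jE fj res_inK.
have Cx := AC_coord_C PhiB rhoS krho AC xD hj jG tG.
have Dx := AC_coord_D PhiB kdelta AC xD hj.
exists j; split=> //.
- split=> [a|T g h gh].
    by rewrite /= lrmorph_algE map_mpsA lrmorph_algE.
  have [|||u [uphi uA uU]] := mps_pushout fl (n := 2) (A := K) (kappa := idfun) (phi := in_alg A)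
    _ _ (g := g \o Psi) (h := h).
  + by [].
  + move=> f; exists [:: (1, f)]; rewrite big_seq1 scale1r mul1r.
    by apply: mpsext.
  + by move=> a; rewrite /= lrmorph_algE gh.
  exists (u \o k); split=> [s|a|u' u'j u'A s] /=.
  + by rewrite jk uphi /= PhiK.
  + by rewrite lrmorph_algE uA.
  have -> : u' s = (u' \o j0) (k s) by rewrite /= kj.
  apply: uU => [f|a] /=; last by rewrite lrmorph_algE.
  by rewrite -u'j jE PsiK.
- apply/seteqP; split=> s.
    rewrite -(kj s) => /Dx[f ->]; rewrite rmorphM; apply: (idealM _ (ideal_genP _)).
    apply: ideal_gen_sub; exists (Psi (py K)); last by rewrite jE PsiK map_mpsX.
    by rewrite kdelta /preimage /mkset PsiK; apply: ideal_gen_sub.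
  apply: ideal_gen_min; first exact: ker_ideal.
  move=> _ [t + <-]; rewrite kdelta => /ideal_gen1P[f fE].
  by rewrite jE; apply/Dx; exists (map_mps (in_alg A) f); rewrite fE rmorphM /= map_mpsX.
- have maxX (i : 'I_2) : maxid OS (Psi (mpsX K i)).
    move=> [b pb]; have : maxid _ (mpsX K i) by apply/mps_maxid_field/mcoefX0.
    by apply; exists (Phi b); rewrite -(PsiK (mpsX K i)) -rmorphM pb rmorph1.
  have gX (i : 'I_2) f : ideal_gen [set j s | s in maxid OS] (j0 (mpsX A i * f)).
    rewrite rmorphM; apply: (idealMr _ (ideal_genP _)); apply: ideal_gen_sub.
    by exists (Psi (mpsX K i)) => //; rewrite jE PsiK map_mpsX.
  apply/seteqP; split=> s.
    rewrite -(kj s) /Defs.idP /mkset (AC_coord_P hj) => s0.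
    rewrite (mps2_tailE (k s)) s0 scale0r add0r rmorphD.
    by apply: (idealD (ideal_genP _)); apply: gX.
  apply: ideal_gen_min.
    have -> : Defs.idP (x := x) = kerset (sec x \o toD x) by [].
    exact: ker_ideal.
  move=> _ [t mt <-]; rewrite /Defs.idP /mkset jE (AC_coord_P hj) mcoef_map.
  suff -> : mps_coef (Phi t) 0%MM = 0 by rewrite rmorph0.
  apply/mps_maxid_field => -[u tu]; apply: mt; exists (Psi u).
  by apply: (bij_inj PhiB); rewrite rmorphM /= PsiK tu rmorph1.
- split; first exact: (AC_toC_surj rhoS AC xD).
  rewrite (FtE j0 j jE); apply/seteqP; split=> s.
    by rewrite -(kj s) => /Cx[f ->]; apply/ideal_gen1P; exists (j0 f); rewrite rmorphM.
  by move/ideal_gen1P => [f ->]; rewrite /kerset /mkset rmorphM /= tG mulr0.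
Qed.

End DeformationExists.

(** * Normal forms of equations *)

Section Taylor.
Variables (n : nat) (A : comNzRingType).

Lemma coefs_in_ideal (L : set A) : is_ideal L -> is_ideal (@coefs_in n A L).
Proof.
move=> hL; split=> [m|f g Lf Lg m|f g Lg m].
- exact: (ideal0 hL).
- by rewrite mcoefD; apply: (idealD hL).
- apply: mcoefM_ind => [|a b|k1 k2 _]; [exact: (ideal0 hL)|exact: (idealD hL)|].
  exact: (idealM _ hL).
Qed.

Lemma coefs_inZ (L : set A) a (f : mps n A) : is_ideal L -> L a -> coefs_in L (a *: f).
Proof. by move=> hL La m; rewrite mcoefZ; apply: (idealMr _ hL). Qed.

Lemma coefs_inM (E L : set A) (f g : mps n A) : is_ideal L ->
  (forall a b, E a -> E b -> L (a * b)) -> coefs_in E f -> coefs_in E g -> coefs_in L (f * g).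
Proof.
move=> hL EL Ef Eg m; apply: mcoefM_ind => [|a b|k1 k2 _]; [exact: (ideal0 hL)|exact: (idealD hL)|].
exact: EL.
Qed.

Variables (E L : set A) (phi : {lrmorphism mps n A -> mps n A}) (xi : 'I_n -> mps n A).
Hypotheses (hE : is_ideal E) (hL : is_ideal L) (EL : forall a b, E a -> E b -> L (a * b)).
Hypothesis phiX : forall i, phi (mpsX A i) = mpsX A i + xi i.
Hypothesis xiE : forall i, coefs_in E (xi i).

Let phi_tail f : phi f = (mps_coef f 0%MM)%:A + \sum_i (mpsX A i + xi i) * phi (mps_tail i f).
Proof.
rewrite {1}(mps_tailE f) rmorphD /= lrmorph_algE rmorph_sum; congr (_ + _).
by apply: eq_bigr => i _; rewrite /= rmorphM /= phiX.
Qed.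

Lemma subst_close f : coefs_in E (phi f - f).
Proof.
apply: (@mps_sep_mod n A n (mpsX A) E [set g | exists f, g = phi f - f]) => //; last by exists f.
  by move=> i; apply: mcoefX0.
move=> {f} _ [f ->]; exists (fun i => phi (mps_tail i f) - mps_tail i f); split.
  by move=> i; exists (mps_tail i f).
move=> m.
have -> : phi f - f - \sum_i mpsX A i * (phi (mps_tail i f) - mps_tail i f) =
    \sum_i xi i * phi (mps_tail i f).
  rewrite phi_tail [X in _ - X - _](mps_tailE f) opprD addrACA subrr add0r -sumrB -sumrB.
  by apply: eq_bigr => i _; ring.
by move: m; apply: (ideal_sum _ (coefs_in_ideal hE)) => i _; apply: (idealMr _ (coefs_in_ideal hE)).
Qed.

(** Second order terms have coefficients in products of two elements of E. The defect satisfies D f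
    = sum X_i D(tail_i f) + sum xi_i (phi(tail_i f) - tail_i f), where by [subst_close] the last sum
    has coefficients in L; [mps_sep_mod] concludes. *)
Lemma subst_taylor f : coefs_in L (phi f - (f + \sum_i xi i * mps_deriv i f)).
Proof.
pose D f := phi f - (f + \sum_i xi i * mps_deriv i f).
apply: (@mps_sep_mod n A n (mpsX A) L [set g | exists f, g = D f]) => //; last by exists f.
  by move=> i; apply: mcoefX0.
move=> {f} _ [f ->]; exists (fun i => D (mps_tail i f)); split.
  by move=> i; exists (mps_tail i f).
move=> m.
have dE i : mps_deriv i f = mps_tail i f + \sum_j mpsX A j * mps_deriv i (mps_tail j f).
  rewrite {1}(mps_tailE f) mps_derivD mps_derivA add0r.
  rewrite (big_morph _ (mps_derivD i) (mps_deriv0 _ i)).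
  rewrite (bigD1 i) //= mps_derivX eqxx mulr1n -addrA [in RHS](bigD1 i) //=; congr (_ + (_ + _)).
  by apply: eq_bigr => j /negPf ji; rewrite mps_derivX eq_sym ji mulr0n add0r.
have -> : D f - \sum_i mpsX A i * D (mps_tail i f) =
    \sum_i xi i * (phi (mps_tail i f) - mps_tail i f).
  pose V := \sum_i mpsX A i * mps_tail i f; pose P := \sum_i mpsX A i * phi (mps_tail i f).
  pose Q := \sum_i xi i * phi (mps_tail i f); pose R := \sum_i xi i * mps_tail i f.
  pose W := \sum_i mpsX A i * \sum_j xi j * mps_deriv j (mps_tail i f).
  have e1 : \sum_i (mpsX A i + xi i) * phi (mps_tail i f) = P + Q.
    by rewrite -big_split; apply: eq_bigr => i _; rewrite mulrDl.
  have e2 : \sum_i xi i * mps_deriv i f = R + W.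
    have -> : W = \sum_i xi i * \sum_j mpsX A j * mps_deriv i (mps_tail j f).
      rewrite /W; under eq_bigr do rewrite mulr_sumr.
      rewrite exchange_big; apply: eq_bigr => i _; rewrite mulr_sumr.
      by apply: eq_bigr => j _; rewrite mulrCA.
    by rewrite -big_split; apply: eq_bigr => i _; rewrite dE mulrDr.
  have e3 : \sum_i mpsX A i * D (mps_tail i f) = P - (V + W).
    by rewrite -big_split -sumrB; apply: eq_bigr => i _; rewrite /D mulrBr mulrDr.
  have -> : \sum_i xi i * (phi (mps_tail i f) - mps_tail i f) = Q - R.
    by rewrite -sumrB; apply: eq_bigr => i _; rewrite mulrBr.
  rewrite e3 /D phi_tail e1 e2 [X in _ - (X + (R + W))](mps_tailE f) -/V; ring.
move: m; apply: (ideal_sum _ (coefs_in_ideal hL)) => i _.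
by apply: (coefs_inM hL EL) (xiE i) (subst_close _).
Qed.

End Taylor.

Section NormalForm.
Variables (K : fieldType) (OS OD OC : comAlgType K).
Variables (delta : {lrmorphism OS -> OD}) (rho : {lrmorphism OS -> OC}).
Variables (Phi : {lrmorphism OS -> mps 2 K}) (f : mps 2 K) (w k : nat) (fs : 'I_k -> mps 2 K).
Let F0 : mps 2 K := py K * f + px K ^+ w.
Hypothesis PhiB : bijective Phi.
Hypothesis kdelta : kerset delta = Phi @^-1` ideal_gen [set py K].
Hypothesis rhoS : surj rho.
Hypothesis krho : kerset rho = Phi @^-1` ideal_gen [set F0].
Hypothesis fs_span : forall h, exists c : 'I_k -> K, Iea F0 (py K * (h - \sum_i c i *: fs i)).
Local Notation presented := (presented Phi F0).
Local Notation coord_map := (@coord_map K OS OC Phi).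
Local Notation is_deform := (is_deform delta rho).

Definition eqn (A : comAlgType K) (v : 'I_k -> A) : mps 2 A :=
  mpsX A ord_max * (map_mps (in_alg A) f + \sum_i v i *: map_mps (in_alg A) (fs i)) +
  mpsX A ord0 ^+ w.

Lemma Iea_decomp (F h : mps 2 K) : Iea F h -> exists xi eta d,
  mps_coef xi 0%MM = 0 /\
  h = xi * mps_deriv ord0 F + py K * eta * mps_deriv ord_max F + d * F.
Proof.
apply: (@ideal_gen_min _ _ [set h | exists xi eta d, mps_coef xi 0%MM = 0 /\
  h = xi * mps_deriv ord0 F + py K * eta * mps_deriv ord_max F + d * F]).
  split=> [|_ _ [x1 [y1 [d1 [x10 ->]]]] [x2 [y2 [d2 [x20 ->]]]]|a _ [x1 [y1 [d1 [x10 ->]]]]].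
  - by exists 0, 0, 0; split=> //; ring.
  - exists (x1 + x2), (y1 + y2), (d1 + d2); rewrite mcoefD x10 x20 addr0; split=> //; ring.
  - exists (a * x1), (a * y1), (a * d1); rewrite mcoefM0 x10 mulr0; split=> //; ring.
move=> g [->|->|->|->].
- by exists (px K), 0, 0; split; [exact: mcoefX0|ring].
- by exists (py K), 0, 0; split; [exact: mcoefX0|ring].
- by exists 0, 1, 0; split=> //; ring.
- by exists 0, 0, 1; split=> //; ring.
Qed.

Lemma series_in_xw_y (A : comNzRingType) (h : mps 2 A) :
  (forall m : 'X_{1..2}, m ord_max = 0%N -> (m ord0 < w)%N -> mps_coef h m = 0) ->
  exists a b, h = a * mpsX A ord0 ^+ w + b * mpsX A ord_max.
Proof.
move=> h0; exists (mps_shift ord0 w (mps_low ord_max 1 h)), (mps_shift ord_max 1 h).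
rewrite mulrC [X in _ = _ + X]mulrC -mps_shiftP; first exact: mps_low_shift.
by move=> m mw; rewrite mcoef_low; case: ifP => //; rewrite ltnS leqn0 => /eqP /h0 ->.
Qed.

Lemma xw_y_vanish (A : comNzRingType) (a b : mps 2 A) (m : 'X_{1..2}) :
  m ord_max = 0%N -> (m ord0 < w)%N ->
  mps_coef (a * mpsX A ord0 ^+ w + b * mpsX A ord_max) m = 0.
Proof.
by move=> m0 mw; rewrite mcoefD mulrC mcoefXnM0 // mulrC mcoefXM0 // addr0.
Qed.

Section OverA.
Variables (A : comAlgType K) (res : {rmorphism A -> K}).
Variables (r : nat) (e : 'I_r -> A) (c : 'I_r -> A -> K).
Hypothesis AC : in_AC A.
Hypothesis resA : forall k, res k%:A = k.
Hypothesis resP : forall a, maxid A a <-> res a = 0.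
Hypothesis fl : flag_basis res e c.
Local Notation X := (mpsX A (ord0 : 'I_2)).
Local Notation Y := (mpsX A (ord_max : 'I_2)).
Local Notation inK := (@map_mps 2 K A (in_alg A)).

Lemma inKZ a (g : mps 2 K) : inK (a *: g) = a%:A *: inK g. Proof. exact: map_mpsZ. Qed.

Lemma res_eqn (v : 'I_k -> A) : (forall i, res (v i) = 0) -> map_mps res (eqn v) = F0.
Proof.
move=> rv; rewrite /eqn rmorphD rmorphXn rmorphM rmorphD rmorph_sum /= !map_mpsX res_inK //.
by rewrite big1 ?addr0 // => i _; rewrite map_mpsZ rv scale0r.
Qed.

Lemma eqn_vanish (v : 'I_k -> A) (m : 'X_{1..2}) :
  m ord_max = 0%N -> (m ord0 < w)%N -> mps_coef (eqn v) m = 0.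
Proof.
by move=> m0 mw; rewrite /eqn addrC -[X ^+ w]mul1r [Y * _]mulrC; apply: xw_y_vanish.
Qed.

Variable x : deform OS OC A.
Hypothesis xD : is_deform x.

(** The new coordinates are j o phi^-1, so an equation G becomes phi G. The conditions on phi X and
    phi Y say that phi fixes P, D and the closed fibre. *)
Lemma coord_change j (phi : {lrmorphism mps 2 A -> mps 2 A}) d : coord_map (x := x) j ->
  bijective phi -> mps_coef (phi X) 0%MM = 0 -> map_mps res (phi X) = px K ->
  phi Y = Y * d -> map_mps res d = 1 ->
  exists j', coord_map (x := x) j' /\ forall g, j' (phi g) = j g.
Proof.
move=> hj phiB phiX0 rphiX phiY rd; have [jB [jX jY] [sX tY]] := hj.
have [psi [phiK psiK]] := inv_lrmorph phiB.
have [d' dd'] : exists d', d * d' = 1.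
  have rd0 : res (1 - mps_coef d 0%MM) = 0.
    by rewrite rmorphB rmorph1 -mcoef_map rd mcoef1 eqxx subrr.
  have [[b ub]|nu] := pselect (exists b, mps_coef d 0%MM * b = 1); first exact: mps_inv ub.
  have /resP : maxid A (mps_coef d 0%MM) by [].
  by move=> rd1; move: rd0; rewrite rmorphB rmorph1 rd1 subr0 => /eqP; rewrite oner_eq0.
have rphi g : map_mps res (phi g) = map_mps res g.
  have -> : map_mps res (phi g) = (map_mps res \o phi) g by [].
  apply: (@mps_hom_eq 2 A (mps 2 K)) => [|a|] /=.
  - apply: mps_tsep; apply: ord2_ind; rewrite /= ?rphiX ?phiY ?rmorphM /= ?rd ?mulr1 ?map_mpsX;
      exact: mcoefX0.
  - by rewrite lrmorph_algE.
  - by apply: ord2_ind; rewrite ?rphiX ?phiY ?rmorphM /= ?rd ?mulr1 ?map_mpsX.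
have phi0 g : mps_coef (phi g) 0%MM = mps_coef g 0%MM.
  rewrite {1}(mps2_tailE g) !rmorphD !rmorphM /= lrmorph_algE !mcoefD !mcoefM0 phiX0.
  by rewrite phiY mcoefM0 mcoefX0 !mul0r !addr0 mcoefA eqxx mulr1n.
have psiY : psi Y = psi d' * Y.
  by rewrite -{2}(phiK Y) phiY -rmorphM mulrCA [d' * d]mulrC dd' mulr1.
exists (j \o psi); split=> [|g] /=; last by rewrite phiK.
have jfib := coord_fib resA resP xD hj.
split; first by apply: bij_comp => //; exists phi.
  rewrite /= !jfib -!(rphi (psi _)) !psiK !map_mpsX //.
rewrite /= (AC_coord_P hj) -phi0 psiK mcoefX0 psiY !rmorphM /= tY mulr0 //.
Qed.

Variable J : set A.
Hypothesis hJ : is_ideal J.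
Hypothesis Jm : forall a, J a -> res a = 0.
Hypothesis xw : contains_mP w x.

Lemma flag_capP j : is_ideal (flag_ideal c j `&` J).
Proof.
have hI := flag_idealP resA fl j.
by split=> [|a b [? ?] [? ?]|a b [? ?]]; split;
  [exact: (ideal0 hI)|exact: (ideal0 hJ)|exact: (idealD hI)|exact: (idealD hJ)
  |exact: (idealM _ hI)|exact: (idealM _ hJ)].
Qed.

(** The ideal J makes the computation relative: G and [eqn v] agree modulo J, and v changes within
    J. J is the maximal ideal for the existence of normal forms, and ker(B -> A) for smoothness. *)
Lemma normal_step (j : 'I_r) G v : presented G x -> (forall i, res (v i) = 0) ->
  coefs_in (flag_ideal c j `&` J) (G - eqn v) ->
  exists v' G', [/\ forall i, J (v' i - v i), presented G' x
    & coefs_in (flag_ideal c j.+1 `&` J) (G' - eqn v')].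
Proof.
move=> xG rv GE.
pose E := flag_ideal c j `&` J; pose L := flag_ideal c j.+1 `&` J.
have hE : is_ideal E by apply: flag_capP.
have hL : is_ideal L by apply: flag_capP.
have mEL a b : res a = 0 -> E b -> L (a * b).
  by move=> ra [Ib Jb]; split; [exact: (flag_ideal_max resA fl)|exact: (idealM _ hJ)].
have [cE|] := pselect (forall a, E a -> c j a = 0).
  exists v, G; split=> // [i|m]; first by rewrite subrr; apply: (ideal0 hJ).
  have [Ia Ja] := GE m; split=> // i; rewrite ltnS leq_eqVlt => /orP[/eqP ij|/Ia //].
  by rewrite (val_inj ij); apply: cE.
move/existsNP => [a0 /not_implyP[Ea0 /eqP ca0]].
(* [eps] takes the place of e_j, which need not lie in J. If no element of E has a nonzero j-th
   coordinate, E is already L and nothing changes. *)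
pose eps := (c j a0)^-1 *: a0.
have Eeps : E eps by rewrite /eps -mulr_algl; apply: (idealM _ hE).
have ceps : c j eps = 1 by rewrite (flagZ fl) mulVf.
have epsL (g : mps 2 A) : map_mps res g = 0 -> coefs_in L (eps *: g).
  move=> rg m; rewrite mcoefZ mulrC; apply: mEL => //.
  by rewrite -mcoef_map rg.
have [j0 [hj0 jG tG]] := xG.
pose s := G - eqn v; pose h := mps_coord c j s.
have hLs : coefs_in L (s - eps *: inK h).
  move=> m; rewrite mcoefB mcoefZ mcoef_inK -scalerAr mulr1.
  have [Is Js] := GE m; have [Ie Je] := Eeps; split.
    move=> i; rewrite (flagB fl) (flagZ fl) ltnS leq_eqVlt => /orP[/eqP ij|ij].
      by rewrite (val_inj ij) ceps mulr1 subrr.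
    by rewrite Is // Ie // mulr0 subrr.
  by apply: (idealB hJ Js); rewrite -mulr_algl; apply: (idealM _ hJ).
have [a1 [b1 GxwE]] := contains_coord PhiB kdelta AC hj0 xw tG xD.
have [a [b hE1]] : exists a b, h = a * px K ^+ w + b * py K.
  apply: series_in_xw_y => m m0 mw; have -> : mps_coef h m = c j (mps_coef s m) by [].
  by rewrite mcoefB eqn_vanish // GxwE xw_y_vanish // subr0 (flag0 fl).
(* From h = a x^w + b y = a F0 + y (b - a f), the part to be expanded in the f_i is b - a f. *)
have [cc /Iea_decomp[xi [eta [d [xi0 dE]]]]] := fs_span (b - a * f).
have hE2 : h = \sum_i cc i *: (py K * fs i) + (xi * mps_deriv ord0 F0 +
    py K * eta * mps_deriv ord_max F0 + (d + a) * F0).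
  have -> : \sum_i cc i *: (py K * fs i) = py K * \sum_i cc i *: fs i.
    by rewrite mulr_sumr; apply: eq_bigr => i _; rewrite scalerAr.
  have -> : xi * mps_deriv ord0 F0 + py K * eta * mps_deriv ord_max F0 =
      py K * (b - a * f - \sum_i cc i *: fs i) - d * F0 by rewrite dE addrK.
  by rewrite hE1 /F0; ring.
pose v' i := v i + cc i *: eps.
have eqnE : eqn v' = eqn v + eps *: inK (\sum_i cc i *: (py K * fs i)).
  rewrite /eqn [RHS]addrAC; congr (_ + _).
  have -> : eps *: inK (\sum_i cc i *: (py K * fs i)) = Y * \sum_i (cc i *: eps) *: inK (fs i).
    rewrite rmorph_sum scaler_sumr mulr_sumr; apply: eq_bigr => i _ /=.
    rewrite inKZ rmorphM /= map_mpsX scalerA -[RHS]scalerAr; congr (_ *: _).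
    by rewrite -scalerAr mulr1.
  rewrite -mulrDr -addrA; congr (_ * (_ + _)); rewrite -big_split.
  by apply: eq_bigr => i _; rewrite scalerDl.
have reps : res eps = 0 by case: Eeps => _ /Jm.
pose zeta (i : 'I_2) := - eps *: inK (if i == ord0 then xi else py K * eta).
have zetaE i : coefs_in E (zeta i).
  by apply: coefs_inZ => //; apply: (idealN hE).
have pires : forall i, map_mps res (mpsX A i + zeta i) = mpsX K i.
  by move=> i; rewrite rmorphD /= map_mpsX map_mpsZ rmorphN reps oppr0 scale0r addr0.
have kres (g : mps 2 A) : map_mps res g = 0 -> max_sub res g.
  move=> rg; apply: (coefs_max_sub resA fl) => m.
  by rewrite -mcoef_map rg.
have resS : surj (map_mps res : mps 2 A -> mps 2 K).
  by move=> g; exists (inK g); apply: res_inK.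
have [phi [phiB phiX rphi]] := flat_series resA fl (flat_mps fl (n := 2)) resS
  (@map_mpsA _ _ _ res) kres pires.
have EL a' b' : E a' -> E b' -> L (a' * b') by case=> _ /Jm ra; apply: mEL.
have hM := coefs_in_ideal 2 hL.
have rG : map_mps res G = F0 by rewrite -(coord_fib resA resP xD hj0).
have re (g : mps 2 A) : map_mps res (eps *: g) = 0 by rewrite map_mpsZ reps scale0r.
have [ep sE] : exists ep : mps 2 A, forall g, eps *: g = ep * g.
  by exists eps%:A => g; rewrite mulr_algl.
(* Derivatives of G may be replaced by those of F0: the difference has coefficients in the maximal
   ideal, and [eps] times these lies in L. *)
have taylor : coefs_in L (phi G - (G - eps *: inK (xi * mps_deriv ord0 F0 +
    py K * eta * mps_deriv ord_max F0))).
  have := subst_taylor hE hL EL phiX zetaE G; rewrite !big_ord_recl big_ord0 addr0.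
  have -> : lift ord0 ord0 = ord_max :> 'I_2 by apply: val_inj.
  rewrite /zeta /= => hT.
  have hd i (g : mps 2 K) : coefs_in L (eps *: (inK g * (mps_deriv i G - inK (mps_deriv i F0)))).
    apply: epsL; rewrite rmorphM rmorphB /= [map_mps res (mps_deriv i G)]map_mps_deriv rG !res_inK // subrr mulr0 //.
  set P1 := inK xi in hT *; have -> : phi G - (G - eps *: inK (xi * mps_deriv ord0 F0 +
    py K * eta * mps_deriv ord_max F0)) =
     phi G - (G + (- eps *: inK xi * mps_deriv ord0 G +
       - eps *: inK (py K * eta) * mps_deriv ord_max G)) -
     (eps *: (inK xi * (mps_deriv ord0 G - inK (mps_deriv ord0 F0))) +
      eps *: (inK (py K * eta) * (mps_deriv ord_max G - inK (mps_deriv ord_max F0)))).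
    rewrite rmorphD /= !(rmorphM inK (_ * _)) /= [inK (xi * _)]rmorphM /=.
    by rewrite !scaleNr !sE; ring.
  by apply: (idealB hM hT); apply: (idealD hM); apply: hd.
(* This unit removes the multiple (d + a) F0 that remains in [hE2]. *)
pose e1 := 1 - eps *: inK (d + a).
have e1close : coefs_in L (e1 * phi G - eqn v').
  have -> : e1 * phi G - eqn v' =
     (phi G - (G - eps *: inK (xi * mps_deriv ord0 F0 + py K * eta * mps_deriv ord_max F0)))
     - eps *: (inK (d + a) * (phi G - inK F0)) + (s - eps *: inK h).
    rewrite eqnE hE2 /s [inK (_ + (_ + _ + _))]rmorphD /= [inK (_ + _ + (d + a) * F0)]rmorphD /=.
    rewrite [inK ((d + a) * F0)]rmorphM /= /e1 !sE; ring.
  apply: (idealD hM) => //; apply: (idealB hM) => //.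
  by apply: epsL; rewrite rmorphM rmorphB /= !res_inK // rphi rG subrr mulr0.
exists v', (e1 * phi G); split=> //.
  move=> i; rewrite /v' addrC addKr -mulr_algl; apply: (idealM _ hJ).
  by case: Eeps.
have [||||j1 [hj1 j1E]] := @coord_change j0 phi (1 - eps *: inK eta) hj0 phiB.
- by rewrite phiX mcoefD mcoefX0 mcoefZ mcoef_inK xi0 scale0r mulr0 addr0.
- by rewrite phiX pires.
- by rewrite phiX /zeta /= rmorphM /= map_mpsX mulrBr mulr1 scaleNr scalerAr.
- by rewrite rmorphB rmorph1 /= re subr0.
exists j1; split=> //.
  rewrite (coord_fib resA resP xD hj1) rmorphM /= rphi rG.
  by rewrite rmorphB rmorph1 /= re subr0 mul1r.
by rewrite !rmorphM /= j1E tG mulr0.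
Qed.

Lemma normal_form G v : presented G x -> (forall i, res (v i) = 0) ->
  coefs_in J (G - eqn v) ->
  exists v', (forall i, J (v' i - v i)) /\ presented (eqn v') x.
Proof.
move=> xG rv GE.
have [v' [vv' [G' xG' G'E]]] : exists v', (forall i, J (v' i - v i)) /\
    exists2 G', presented G' x & coefs_in (flag_ideal c r `&` J) (G' - eqn v').
  apply: (flag_ind (Q := fun j => exists v', (forall i, J (v' i - v i)) /\
    exists2 G', presented G' x & coefs_in (flag_ideal c j `&` J) (G' - eqn v'))).
    exists v; split=> [i|]; first by rewrite subrr; apply: (ideal0 hJ).
    by exists G => // m; split.
  move=> j [v1 [vv1 [G1 xG1 G1E]]].
  have rv1 i : res (v1 i) = 0 by rewrite -(subrK (v i) (v1 i)) rmorphD rv Jm ?addr0.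
  have [v2 [G2 [vv2 xG2 G2E]]] := normal_step xG1 rv1 G1E.
  exists v2; split=> [i|]; last by exists G2.
  by rewrite -(subrK (v1 i) (v2 i)) -addrA; apply: (idealD hJ).
exists v'; split=> //; suff <- : G' = eqn v' by [].
apply/eqP; rewrite -subr_eq0; apply/eqP/mpsext => m.
by have [/(flag_ideal_top fl)] := G'E m.
Qed.

End OverA.
End NormalForm.

(** * The universal family *)

Section ArtinEvaluation.
Variables (K : fieldType) (A : comAlgType K).
Hypothesis AC : in_AC A.
Variable res : {rmorphism A -> K}.
Hypothesis resA : forall k, res k%:A = k.
Hypothesis resP : forall a, maxid A a <-> res a = 0.

Lemma residue_unique (res' : {rmorphism A -> K}) : (forall k, res' k%:A = k) -> res' =1 res.
Proof. by move=> resA' a; apply: (AC_local idfun a AC resA resP resA'). Qed.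

Lemma AC_tsep n (b : 'I_n -> A) : (forall i, res (b i) = 0) -> tsep b.
Proof.
have [res' [r [e [c [resA' resP' fl]]]]] := AC_flag AC.
move=> rb S hS; suff h : forall s, S s -> flag_ideal c r s by move=> s /h/(flag_ideal_top fl).
apply: (flag_ind (Q := fun j => forall s, S s -> flag_ideal c j s)) => // j IHj s Ss.
have [s' [Ss' ->]] := hS s Ss.
apply: (ideal_sum _ (flag_idealP resA' fl _)) => i _.
apply: (flag_ideal_max resA' fl); last exact: IHj.
by apply/resP'/resP.
Qed.

(** A is viewed as an algebra over itself with closed fibre K, where the system is solved by its
    inhomogeneous term because the b_i reduce to 0. *)
Lemma AC_tcomp n (b : 'I_n -> A) (I : Type) (T : 'I_n -> I -> I) :
  (forall i, res (b i) = 0) -> tcomp b T.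
Proof.
have [res' [r [e [c [resA' resP' fl]]]]] := AC_flag AC.
move=> rb; have resE := residue_unique resA'.
pose pi : {rmorphism A^o -> K} := res'.
have piS : surj pi by move=> k; exists k%:A; apply: resA'.
have kpi (s : A^o) : pi s = 0 -> max_sub res' s.
  move=> s0; exists [:: (s : A, 1 : A^o)]; rewrite big_seq1; split=> [p|].
    by rewrite inE => /eqP ->.
  by rewrite /GRing.scale /= mulr1.
apply: (tcomp_lift resA' fl piS kpi) => v; exists v => s.
by rewrite big1 ?addr0 // => i _; rewrite /= resE rb mul0r.
Qed.

Lemma AC_ev n (b : 'I_n -> A) : (forall i, res (b i) = 0) ->
  exists u : {lrmorphism mps n K -> A}, forall i, u (mpsX K i) = b i.
Proof. by move=> rb; apply: mps_ev; [apply: AC_tsep|apply: AC_tcomp]. Qed.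

(** If u f had residue c different from 0, the unit f - c would have an image of residue 0.
    Homomorphisms from power series rings are thus automatically local. *)
Lemma AC_hom_res n (u : {lrmorphism mps n K -> A}) f : mps_coef f 0%MM = 0 -> res (u f) = 0.
Proof.
move=> f0; apply: contrapT => /eqP c0; set c := res (u f) in c0.
have [|g fg] := @mps_domain_inv n K (f - c%:A).
  by rewrite mcoefB f0 mcoefA eqxx mulr1n sub0r => /eqP; rewrite oppr_eq0 (negPf c0).
have : res (u ((f - c%:A) * g)) = 0.
  by rewrite !rmorphM !rmorphB /= lrmorph_algE resA -/c subrr mul0r.
by rewrite fg !rmorph1 => /eqP; rewrite oner_eq0.
Qed.

Lemma AC_hom_eq n (u v : {lrmorphism mps n K -> A}) :
  (forall i, u (mpsX K i) = v (mpsX K i)) -> u =1 v.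
Proof.
move=> uv; apply: mps_hom_eq => // [|a] /=; last by rewrite !lrmorph_algE.
by apply: AC_tsep => i; apply: AC_hom_res; apply: mcoefX0.
Qed.

Lemma AC_hom_local n (u : {lrmorphism mps n K -> A}) : local_hom u.
Proof. by move=> f /mps_maxid_field f0; apply/resP/AC_hom_res. Qed.

(** [induced] asks for a factorisation through a surjection onto an object of A_K. The image of u
    serves: it embeds in the finite-dimensional A, and its elements are scalars plus nilpotents. *)
Lemma AC_image (R : comAlgType K) (u : {lrmorphism R -> A}) :
  exists (A0 : comAlgType K) (q : {lrmorphism R -> A0}) (i : {lrmorphism A0 -> A}),
    [/\ in_AC A0, surj q & forall x, i (q x) = u x].
Proof.
have u1 : ~ kerset u 1 by rewrite /kerset /= rmorph1 => /eqP; rewrite oner_eq0.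
have [A0 [q [qS kq]]] := quot_algP (ker_ideal u) u1.
have [|i0 iE] := rmorph_factor (p := q) (g := u) qS.
  by move=> a qa; have : kerset q a by []; rewrite kq.
have iA k : i0 k%:A = k%:A by rewrite -(lrmorph_algE q) iE /= lrmorph_algE.
pose i := mk_lrmorph (lrmorph_of_alg iA).
have iI : injective i.
  move=> a b ab; apply/eqP; rewrite -subr_eq0; apply/eqP.
  have [x xE] := qS (a - b); rewrite -xE.
  have ux : u x = i (q x) by rewrite /= iE.
  have : kerset u x by rewrite /kerset /mkset ux xE; apply: (etrans (rmorphB i a b)); apply/eqP; rewrite subr_eq0 -[X in _ == X]ab.
  by rewrite -kq.
exists A0, q, i; split=> //.
have [s sT] := AC_span AC.
apply: (@AC_intro _ _ A i s iI) => [a|a]; first by rewrite sT.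
have /resP /(AC_nilpotent AC)[N aN] : res (i a - (res (i a))%:A) = 0.
  by rewrite rmorphB resA subrr.
exists (res (i a)), N; apply: iI; rewrite rmorphXn rmorphB /= iA rmorph0.
exact: aN.
Qed.

End ArtinEvaluation.

Section Functor.
Variables (K : fieldType) (OS OD OC : comAlgType K).
Variables (delta : {lrmorphism OS -> OD}) (rho : {lrmorphism OS -> OC}).
Variables (Phi : {lrmorphism OS -> mps 2 K}) (f : mps 2 K) (w k : nat) (fs : 'I_k -> mps 2 K).
Let F0 : mps 2 K := py K * f + px K ^+ w.
Hypothesis w0 : (0 < w)%N.
Hypothesis PhiB : bijective Phi.
Hypothesis kdelta : kerset delta = Phi @^-1` ideal_gen [set py K].
Hypothesis rhoS : surj rho.
Hypothesis krho : kerset rho = Phi @^-1` ideal_gen [set F0].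
Hypothesis fs_span : forall h, exists c : 'I_k -> K, Iea F0 (py K * (h - \sum_i c i *: fs i)).
Hypothesis fs_free : forall c : 'I_k -> K, Iea F0 (py K * \sum_i c i *: fs i) -> forall i, c i = 0.
Local Notation presented := (presented Phi F0).
Local Notation coord_map := (@coord_map K OS OC Phi).
Local Notation is_deform := (is_deform delta rho).
Local Notation eqn := (eqn f w fs).
Local Notation R := (mps k K).

Definition pclass (A : comAlgType K) (G : mps 2 A) : deform OS OC A -> Prop :=
  fun x => is_deform x /\ presented G x.

(** The value is given by the equation with t_i replaced by q(X_i), without a chosen representative;
    by [pclassE] it is the isomorphism class of any deformation having that equation. *)
Definition universal_family : formal_family (Defm delta rho w) R :=
  fun A q => pclass (eqn (fun i => q (mpsX K i))).

Lemma F00 : mps_coef F0 0%MM = 0.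
Proof.
rewrite /F0 mcoefD mcoefM0 mcoefX0 mul0r add0r -(prednK w0) exprS mcoefM0 mcoefX0.
by rewrite mul0r.
Qed.

Lemma F0_nzd q : q * F0 = 0 -> q = 0.
Proof. by rewrite /F0 addrC; apply: weierstrass_nzd. Qed.

Lemma eqn_map (A B : comAlgType K) (p : {lrmorphism A -> B}) (v : 'I_k -> A) :
  map_mps p (eqn v) = eqn (p \o v).
Proof.
have pin (g : mps 2 K) : map_mps p (map_mps (in_alg A) g) = map_mps (in_alg B) g.
  by apply: mpsext => m; rewrite !mcoef_map /= lrmorph_algE.
rewrite /eqn rmorphD rmorphXn rmorphM rmorphD rmorph_sum /= !map_mpsX pin.
by congr (_ * (_ + _) + _); apply: eq_bigr => i _; rewrite map_mpsZ pin.
Qed.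

Lemma eqn_deform (A : comAlgType K) (v : 'I_k -> A) : in_AC A -> (forall i, maxid A (v i)) ->
  exists x : deform OS OC A, [/\ is_deform x, presented (eqn v) x & contains_mP w x].
Proof.
move=> AC mv; have [res [r [e [c [resA resP fl]]]]] := AC_flag AC.
apply: (deform_exists PhiB kdelta rhoS krho F00 AC resA resP fl).
by apply: (res_eqn f w fs resA) => i; apply/resP.
Qed.

Lemma pclassE (A : comAlgType K) (x : deform OS OC A) G :
  in_AC A -> is_deform x -> presented G x -> iso_class delta rho x = pclass G.
Proof. by move=> hA; apply: (iso_class_presented PhiB kdelta rhoS krho hA). Qed.

Lemma universal_Gelt (A : comAlgType K) (v : 'I_k -> A) : in_AC A -> (forall i, maxid A (v i)) ->
  Gelt (a := Defm delta rho w) (pclass (eqn v)).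
Proof.
move=> AC mv; have [x [xD xG xw]] := eqn_deform AC mv.
by exists x => //; rewrite -(pclassE AC xD xG).
Qed.

Lemma pull_back_pclass (A B : comAlgType K) (p : {lrmorphism A -> B}) (v : 'I_k -> A) :
  in_AC A -> in_AC B -> (forall i, maxid A (v i)) ->
  pull_back delta rho p (pclass (eqn v)) = pclass (eqn (p \o v)).
Proof.
move=> AC BC mv; apply/funext => y; apply/propext; split=> -[yD].
  case=> x [xD xG] xy; split=> //; rewrite -eqn_map.
  exact: (base_change_presented PhiB BC yD xG xy).
move=> yG; split=> //; have [x [xD xG _]] := eqn_deform AC mv.
exists x; first by split.
by apply: (presented_base_change PhiB kdelta rhoS krho AC BC xD yD xG); rewrite eqn_map.
Qed.

Lemma hom_maxid (A : comAlgType K) (u : {lrmorphism R -> A}) i : in_AC A -> maxid A (u (mpsX K i)).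
Proof.
move=> AC; have [res [r [e [c [resA resP fl]]]]] := AC_flag AC.
by apply/resP/(AC_hom_res resA)/mcoefX0.
Qed.

Lemma inducedE (A : comAlgType K) (u : {lrmorphism R -> A}) c : in_AC A ->
  induced universal_family u c <-> c = pclass (eqn (fun i => u (mpsX K i))).
Proof.
move=> AC; split.
  case=> A0 [q [i [AC0 qS iq ->]]]; rewrite /= pull_back_pclass // => [|l]; last exact: hom_maxid.
  by congr (pclass (eqn _)); apply/funext => l /=; rewrite iq.
move=> ->; have [res [r [e [c' [resA resP fl]]]]] := AC_flag AC.
have [A0 [q [i [AC0 qS iq]]]] := AC_image AC resA resP u.
exists A0, q, i; split=> //; rewrite /= pull_back_pclass // => [|l]; last exact: hom_maxid.
by congr (pclass (eqn _)); apply/funext => l /=; rewrite iq.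
Qed.

Lemma universal_in_limit : in_limit universal_family.
Proof.
split=> [A q AC qS|A B q q' p AC BC qS qS' pq].
  by apply: universal_Gelt => // i; apply: hom_maxid.
rewrite /universal_family /= pull_back_pclass // => [|l]; last exact: hom_maxid.
by congr (pclass (eqn _)); apply/funext => l /=; rewrite pq.
Qed.

Lemma deform_normal_form (A : comAlgType K) (x : deform OS OC A) : in_AC A -> is_deform x ->
  contains_mP w x -> exists v : 'I_k -> A, (forall i, maxid A (v i)) /\ presented (eqn v) x.
Proof.
move=> AC xD xw; have [res [r [e [c [resA resP fl]]]]] := AC_flag AC.
have [G xG] := AC_presented_exists PhiB kdelta rhoS krho AC xD.
have [hm _ _] := AC.
have Jm a : maxid A a -> res a = 0 by move/resP.
have [||v' [v'm xv']] := normal_form PhiB kdelta fs_span AC resA resP fl xD hm Jm xw (v := fun=> 0) xG.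
- by move=> i; rewrite rmorph0.
- move=> m; apply/resP; rewrite -mcoef_map rmorphB /= (res_eqn _ _ _ resA) => [|i]; last by rewrite rmorph0.
  have [j [hj jG _]] := xG.
  by rewrite -(coord_fib resA resP xD hj) jG subrr.
by exists v'; split=> // i; have := v'm i; rewrite subr0.
Qed.

(** An equation of x over B is altered, by lifting to B a change of coordinates and a unit over A,
    until it reduces to the equation given by u. The relative normal form with J = ker p then yields
    parameters v with p(v) = u. *)
Lemma universal_smooth : smooth_map universal_family.
Proof.
move=> B A p BC AC pl pS u cB ul [x [xD xw] ->] /(inducedE _ _ AC) pcE.
have [resB [rB [fB [cB' [resBA resBP flB]]]]] := AC_flag BC.
have [res [r [e [c [resA resP fl]]]]] := AC_flag AC.
have resp a : res (p a) = resB a by apply: (AC_local p a BC resBA resBP resA).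
have mp g : map_mps res (map_mps p g) = map_mps resB g.
  by apply: mpsext => m; rewrite !mcoef_map resp.
have mu i : maxid A (u (mpsX K i)) by apply: hom_maxid.
have [y [yD yF _]] := eqn_deform AC mu.
have [G0 xG0] := AC_presented_exists PhiB kdelta rhoS krho BC xD.
(* y has the equation given by u; being also a pull-back of a deformation isomorphic to x, it has
   the image of G0 as a second one. *)
have yG0 : presented (map_mps p G0) y.
  have : pclass (eqn (fun i => u (mpsX K i))) y by split.
  rewrite -pcE => -[_ [x1 [x1D xx1] x1y]].
  exact: (base_change_presented PhiB AC yD (iso_presented xG0 xx1) x1y).
have [j0 [hj0 jG0 tG0]] := xG0.
have [j1 [hj1 jG1 tG1]] := yG0; have [j2 [hj2 jG2 tG2]] := yF.
have [jB1 _ _] := hj1; have [k1 [jk1 kj1]] := inv_lrmorph jB1.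
have [_ [jX2 jY2] [sX2 tY2]] := hj2.
(* The coordinates belonging to the equation of u, written in those belonging to the image of G0;
   these two series are lifted to B. *)
pose xiA := k1 (j2 (mpsX A ord0)).
have [etaA etaE] : exists g, k1 (j2 (mpsX A ord_max)) = g * mpsX A ord_max.
  by apply/(AC_coord_D PhiB kdelta AC yD hj1); rewrite kj1.
have xiA0 : mps_coef xiA 0%MM = 0 by rewrite -(AC_coord_P hj1) kj1.
have pSS := map_mps_surj (n := 2) pS.
have [xi0 xi0E] := pSS xiA; have [eta etaBE] := pSS etaA.
(* A lift may acquire a constant term in ker p; removing it keeps the section P at the origin. *)
pose xi := xi0 - (mps_coef xi0 0%MM)%:A.
have pxi : map_mps p xi = xiA.
  by rewrite rmorphB /= map_mpsA -mcoef_map xi0E xiA0 scale0r subr0.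
have xi00 : mps_coef xi 0%MM = 0 by rewrite mcoefB mcoefA eqxx mulr1n subrr.
have [jB0 _ [_ tY0]] := hj0; have [k0 [jk0 kj0]] := inv_lrmorph jB0.
have fib0 := coord_fib resBA resBP xD hj0; have fib1 := coord_fib resA resP yD hj1.
have [||||j' [hj' jX' jY']] := AC_coord_exists PhiB BC xD (s := j0 xi) (t := j0 (eta * mpsX B ord_max)).
- by rewrite fib0 -mp pxi -fib1 kj1.
- by rewrite fib0 -mp rmorphM /= map_mpsX etaBE -etaE -fib1 kj1.
- by rewrite (AC_coord_P hj0).
- by rewrite !rmorphM /= tY0 mulr0.
have [jB' _ _] := hj'; have [k' [jk' kj']] := inv_lrmorph jB'.
pose G1 := k' (j0 G0).
have fib' := coord_fib resBA resBP xD hj'.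
have G1E : j' G1 = j0 G0 by rewrite kj'.
have phiE g : map_mps p (k0 (j' g)) = k1 (j2 (map_mps p g)).
  have -> : map_mps p (k0 (j' g)) = (map_mps p \o k0 \o j') g by [].
  apply: (@mps_hom_eq 2 B (mps 2 A) _ (k1 \o j2 \o map_mps p)) => [|a|] /=.
  - apply: mps_tsep; apply: ord2_ind; rewrite /= ?jX' ?jY' jk0 ?pxi //.
    by rewrite rmorphM /= map_mpsX mcoefM0 mcoefX0 mulr0.
  - by rewrite !lrmorph_algE !map_mpsA !lrmorph_algE.
  - apply: ord2_ind; rewrite ?jX' ?jY' jk0 map_mpsX //.
    by rewrite rmorphM /= map_mpsX etaBE etaE.
have [e0 e0E] : exists e0, map_mps p G1 = e0 * eqn (fun i => u (mpsX K i)).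
  apply/(AC_coord_C PhiB rhoS krho AC yD hj2 jG2 tG2).
  by rewrite -(kj1 (j2 _)) -phiE G1E jk0.
have rv : map_mps res (eqn (fun i => u (mpsX K i))) = F0.
  by apply: (res_eqn _ _ _ resA) => i; apply/resP.
(* Both equations reduce to F0, which is not a zero divisor, so the factor reduces to 1 and its lift
   to B is a unit. *)
have re0 : map_mps res e0 = 1.
  apply/eqP; rewrite -subr_eq0; apply/eqP/F0_nzd; rewrite mulrBl mul1r -{1}rv -rmorphM /= -e0E.
  by rewrite mp -fib' G1E jG0 subrr.
have [eB eBE] := pSS e0.
have [eB' eeB] : exists eB', eB * eB' = 1.
  have [[b eb]|nu] := pselect (exists b, mps_coef eB 0%MM * b = 1); first exact: mps_inv eb.
  have /resBP : maxid B (mps_coef eB 0%MM) by [].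
  rewrite -mcoef_map -mp eBE re0 mcoef1 eqxx => /eqP; by rewrite oner_eq0.
pose G2 := eB' * G1.
have reB' : map_mps resB eB' = 1.
  by rewrite -[LHS]mul1r -{1}re0 -eBE mp -rmorphM /= eeB rmorph1.
have xG2 : presented G2 x.
  exists j'; split=> //; first by rewrite fib' rmorphM /= reB' mul1r -fib' G1E.
  by rewrite !rmorphM /= G1E tG0 mulr0.
have pG2 : map_mps p G2 = eqn (fun i => u (mpsX K i)).
  by rewrite rmorphM /= e0E mulrA -eBE -rmorphM /= [eB' * _]mulrC eeB rmorph1 mul1r.
have [v0 v0E] := choice (fun i => pS (u (mpsX K i))).
have [|||v [vv0 xv]] := normal_form PhiB kdelta fs_span BC resBA resBP flB xD (ker_ideal p) _ xw
    (v := v0) xG2.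
- by move=> a pa; rewrite -resp pa rmorph0.
- by move=> i; rewrite -resp v0E; apply/resP.
- move=> m; rewrite /kerset /= -mcoef_map rmorphB /= pG2 eqn_map.
  rewrite (_ : p \o v0 = fun i => u (mpsX K i)) ?subrr //.
  by apply/funext => i /=.
have pv i : p (v i) = u (mpsX K i).
  by apply/eqP; rewrite -v0E -subr_eq0 -rmorphB; apply/eqP/vv0.
have [i|vh vhE] := AC_ev BC resBA resBP (b := v).
  by rewrite -resp pv; apply/resP.
exists vh; split; first exact: (AC_hom_local resBA resBP).
  move=> g; have -> : p (vh g) = (p \o vh) g by [].
  by apply: (AC_hom_eq AC resA resP) => i /=; rewrite vhE.
apply/(inducedE _ _ BC); rewrite (pclassE BC xD xv); congr (pclass (eqn _)).
by apply/funext => i; rewrite vhE.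
Qed.

End Functor.

(** * Uniqueness of the normal form to first order *)

Section Tangent.
Variables (K : fieldType) (OS OD OC : comAlgType K).
Variables (delta : {lrmorphism OS -> OD}) (rho : {lrmorphism OS -> OC}).
Variables (Phi : {lrmorphism OS -> mps 2 K}) (f : mps 2 K) (w k : nat) (fs : 'I_k -> mps 2 K).
Let F0 : mps 2 K := py K * f + px K ^+ w.
Hypothesis PhiB : bijective Phi.
Hypothesis kdelta : kerset delta = Phi @^-1` ideal_gen [set py K].
Hypothesis rhoS : surj rho.
Hypothesis krho : kerset rho = Phi @^-1` ideal_gen [set F0].
Hypothesis fs_free : forall c : 'I_k -> K, Iea F0 (py K * \sum_i c i *: fs i) -> forall i, c i = 0.
Local Notation presented := (presented Phi F0).
Local Notation eqn := (eqn f w fs).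

Lemma Iea_comb (F xi eta d : mps 2 K) : mps_coef xi 0%MM = 0 ->
  Iea F (xi * mps_deriv ord0 F + py K * eta * mps_deriv ord_max F + d * F).
Proof.
move=> xi0; have hI : is_ideal (Iea F) := ideal_genP _.
have gen g : [\/ g = px K * mps_deriv ord0 F, g = py K * mps_deriv ord0 F,
    g = py K * mps_deriv ord_max F | g = F] -> Iea F g by apply: ideal_gen_sub.
rewrite (mps2_tailE xi) xi0 scale0r add0r mulrDl.
apply: (idealD hI); last by apply: (idealM _ hI); apply: gen; apply: Or44.
apply: (idealD hI); last by rewrite mulrAC mulrC; apply: (idealM _ hI); apply: gen; apply: Or43.
apply: (idealD hI); rewrite mulrAC mulrC; apply: (idealM _ hI); apply: gen.
  exact: Or41.
exact: Or42.
Qed.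

Section OverA.
Variables (A : comAlgType K) (res : {rmorphism A -> K}).
Variables (r : nat) (e : 'I_r -> A) (c : 'I_r -> A -> K).
Hypothesis AC : in_AC A.
Hypothesis resA : forall k, res k%:A = k.
Hypothesis resP : forall a, maxid A a <-> res a = 0.
Hypothesis fl : flag_basis res e c.
Hypothesis m2 : forall a b, res a = 0 -> res b = 0 -> a * b = 0.
Local Notation X := (mpsX A (ord0 : 'I_2)).
Local Notation Y := (mpsX A (ord_max : 'I_2)).
Local Notation inK := (@map_mps 2 K A (in_alg A)).

Lemma mps_coordM i (g : mps 2 A) (p : mps 2 K) : mps_coord c i (g * inK p) = mps_coord c i g * p.
Proof.
apply: mpsext => m; rewrite mcoefM [LHS]/mps_coef /= mcoefM (flag_fsum fl).
apply: eq_bigr => l _; rewrite mcoef_map /= -scalerAr mulr1 (flagZ fl) mulrC //.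
Qed.

Lemma mps_coord_nat i : {morph (@mps_coord K A r c 2) i : g h / g - h}.
Proof. by move=> g h; apply: mpsext => m; rewrite mcoefB [LHS](flagB fl). Qed.

(** Two equations of x differ by a coordinate change and a unit, both trivial modulo the maximal
    ideal. As products of two elements of this ideal vanish, Taylor's formula is exact and the
    coefficients may be replaced by those of F0. Each coordinate c_i of the identity [key] puts y
    times the sum of the (c_i(v'_l) - c_i(v_l)) f_l in I^ea. *)
Lemma eqn_unique (x : deform OS OC A) v v' : is_deform delta rho x ->
  presented (eqn v) x -> presented (eqn v') x ->
  (forall i, res (v i) = 0) -> (forall i, res (v' i) = 0) -> forall i, v i = v' i.
Proof.
move=> xD [j [hj jG tG]] [j' [hj' jG' tG']] rv rv'.
have [jB [jX jY] [sX tY]] := hj; have [jB' [jX' jY'] [sX' tY']] := hj'.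
have [j1 [jj1 j1j]] := inv_lrmorph jB.
pose phi : {lrmorphism mps 2 A -> mps 2 A} := j1 \o j'.
have phiE g : j (phi g) = j' g by rewrite /= j1j.
have fib := coord_fib resA resP xD hj; have fib' := coord_fib resA resP xD hj'.
have rphi g : map_mps res (phi g) = map_mps res g by rewrite -fib phiE fib'.
pose zeta i := phi (mpsX A i) - mpsX A i.
pose E : set A := [set a | res a = 0].
have hE : is_ideal E by apply: (ker_ideal res).
have zE i : coefs_in E (zeta i).
  by move=> m; rewrite /E /mkset -mcoef_map rmorphB /= rphi subrr.
have phiX i : phi (mpsX A i) = mpsX A i + zeta i by rewrite addrC subrK.
have EL a b : E a -> E b -> [set 0] (a * b) by move=> ra rb; apply: m2.
have taylor := subst_taylor hE (@is_ideal0 A) EL phiX zE.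
have [e0 e0E] : exists e0, phi (eqn v') = e0 * eqn v.
  by apply/(AC_coord_C PhiB rhoS krho AC xD hj jG tG); rewrite phiE.
have xi0 : mps_coef (zeta ord0) 0%MM = 0.
  by rewrite mcoefB mcoefX0 subr0 -(AC_coord_P hj) phiE.
have [d dE] : exists d, zeta ord_max = Y * d.
  have [g gE] : exists g, phi Y = g * Y.
    by apply/(AC_coord_D PhiB kdelta AC xD hj); rewrite phiE.
  by exists (g - 1); rewrite /zeta gE; ring.
have EE0 (g h : mps 2 A) : map_mps res g = 0 -> map_mps res h = 0 -> g * h = 0.
  move=> rg rh; apply: mpsext => m.
  apply: (coefs_inM (@is_ideal0 A) EL); move=> l; rewrite /E /mkset -mcoef_map.
    by rewrite rg.
  by rewrite rh.
have reqn u : (forall i, res (u i) = 0) -> map_mps res (eqn u) = F0 := @res_eqn _ f w _ fs _ _ resA u.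
have re0 : map_mps res e0 = 1.
  apply/eqP; rewrite -subr_eq0; apply/eqP/(@weierstrass_nzd K f w); rewrite [px K ^+ w + _]addrC -/F0.
  by rewrite mulrBl mul1r -{1}(reqn v rv) -rmorphM /= -e0E rphi reqn // subrr.
pose e1 := e0 - 1.
have re1 : map_mps res e1 = 0 by rewrite rmorphB rmorph1 /= re0 subrr.
pose dl (u : 'I_k -> A) := \sum_i u i *: inK (fs i).
have rdl u : (forall i, res (u i) = 0) -> map_mps res (dl u) = 0.
  by move=> ru; rewrite rmorph_sum big1 // => i _; rewrite /= map_mpsZ ru scale0r.
have eqnE u : eqn u = inK F0 + Y * dl u.
  rewrite /eqn /F0 -/(dl u) rmorphD rmorphXn rmorphM /= !map_mpsX; ring.
have rz i : map_mps res (zeta i) = 0 by rewrite rmorphB /= rphi subrr.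
have derivE i : zeta i * mps_deriv i (eqn v') = zeta i * inK (mps_deriv i F0).
  rewrite eqnE mps_derivD mulrDr map_mps_deriv [X in _ + X]EE0 ?addr0 //.
  by rewrite map_mps_deriv rmorphM /= rdl // mulr0 mps_deriv0.
have key : Y * (dl v' - dl v) = e1 * inK F0 - zeta ord0 * inK (mps_deriv ord0 F0)
    - Y * d * inK (mps_deriv ord_max F0).
  have t0 : phi (eqn v') = eqn v' + (zeta ord0 * mps_deriv ord0 (eqn v') +
      zeta ord_max * mps_deriv ord_max (eqn v')).
    apply/eqP; rewrite -subr_eq0; apply/eqP/mpsext => m; have := taylor (eqn v') m.
    rewrite !big_ord_recl big_ord0 addr0.
    by have -> : lift ord0 ord0 = ord_max :> 'I_2 by apply: val_inj.
  have e10 : e1 * (Y * dl v) = 0 by rewrite mulrCA (EE0 _ _ re1 (rdl v rv)) mulr0.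
  move: t0; rewrite e0E !derivE dE !eqnE.
  have -> : e0 * (inK F0 + Y * dl v) = inK F0 + Y * dl v + e1 * inK F0 + e1 * (Y * dl v).
    by rewrite /e1; ring.
  rewrite e10 addr0 => t0.
  apply: (addrI (inK F0 + Y * dl v)); rewrite !addrA t0; ring.
have cE i : py K * \sum_l (c i (v' l) - c i (v l)) *: fs l =
    - mps_coord c i (zeta ord0) * mps_deriv ord0 F0 +
    py K * (- mps_coord c i d) * mps_deriv ord_max F0 + mps_coord c i e1 * F0.
  have cD (g h : mps 2 A) : mps_coord c i (g - h) = mps_coord c i g - mps_coord c i h.
    exact: mps_coord_nat.
  have cY g : mps_coord c i (Y * g) = py K * mps_coord c i g.
    by rewrite mulrC -(map_mpsX (in_alg A)) mps_coordM mulrC.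
  have cdl u : mps_coord c i (dl u) = \sum_l c i (u l) *: fs l.
    rewrite (big_morph _ (mps_coordD fl i) (id1 := 0)); last first.
      by apply: mpsext => m; apply: (flag0 fl).
    by apply: eq_bigr => l _; rewrite (mps_coord_inK fl).
  have h := congr1 (mps_coord c i) key.
  rewrite cY cD !cdl !cD -mulrA cY !mps_coordM -sumrB in h.
  have -> : \sum_l (c i (v' l) - c i (v l)) *: fs l =
      \sum_l (c i (v' l) *: fs l - c i (v l) *: fs l).
    by apply: eq_bigr => l _; rewrite scalerBl.
  by rewrite h; ring.
move=> l; rewrite (flag_sum fl (v l)) (flag_sum fl (v' l)); apply: eq_bigr => i _.
congr (_ *: _); apply/esym/eqP; rewrite -subr_eq0; apply/eqP.
apply: (fs_free (c := fun l => c i (v' l) - c i (v l))); rewrite cE; apply: Iea_comb.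
by rewrite mcoefN [X in - X](_ : _ = 0) ?oppr0 //; change (c i (mps_coef (zeta ord0) 0%MM) = 0); rewrite xi0 (flag0 fl).
Qed.
End OverA.
End Tangent.

Section DualNumbers.
Variable K : fieldType.
Local Notation D := (dual_numbers K).

Lemma dual_decomp : exists eps : D, eps * eps = 0 /\ forall p : D, exists a b, p = a%:A + b *: eps.
Proof.
pose h : {poly K} := 'X^2.
(* The quotient type divides by [mk_monic h], which for a power of X is that power. *)
have mh : mk_monic h = 'X^2 by apply: mk_monic_Xn.
exists (in_qpoly h 'X); split.
  rewrite -in_qpolyM; apply/val_inj => /=; rewrite mh -expr2.
  by rewrite Pdiv.RingMonic.rmodpp // monicXn.
have s3 : size (mk_monic h) = 3%N by rewrite mh size_polyXn.
move=> p; exists (val p)`_0, (val p)`_1.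
have {1}-> : p = in_qpoly h (val p).
  by apply/val_inj; rewrite /= Pdiv.Ring.rmodp_small // size_mk_monic.
have sp : (size (val p) <= 2)%N by apply: leq_trans (size_mk_monic p) (eq_leq s3).
have {1}-> : val p = (val p)`_0 *: 1 + (val p)`_1 *: 'X.
  apply/polyP => i; rewrite coefD !coefZ coef1 coefX.
  case: i => [|[|i]] /=; rewrite ?mulr1 ?mulr0 ?addr0 ?add0r //.
  by rewrite nth_default // (leq_trans sp).
by rewrite in_qpolyD !in_qpolyZ in_qpoly1.
Qed.

Lemma dual_AC : in_AC D.
Proof.
have [eps [eps2 epsP]] := dual_decomp.
apply: (@AC_intro K D D idfun [:: 1; eps]) => [//|p|p] /=.
  have [a [b ->]] := epsP p; exists a, b.
  by rewrite -addrA -opprD subrr.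
have [a [b ->]] := epsP p; exists a, 2%N.
have e2 : eps ^+ 2 = 0 := eps2.
by rewrite addrAC subrr add0r exprZn e2 scaler0.
Qed.

Lemma dual_square0 (res : {rmorphism D -> K}) : (forall k, res k%:A = k) ->
  forall a b, res a = 0 -> res b = 0 -> a * b = 0.
Proof.
move=> resA; have [eps [eps2 epsP]] := dual_decomp.
have re : res eps = 0.
  by have := congr1 res eps2; rewrite rmorphM rmorph0 => /eqP; rewrite mulf_eq0 orbb => /eqP.
have h p : res p = 0 -> exists b, p = b *: eps.
  have [a [b ->]] := epsP p; rewrite rmorphD /= resA (_ : res (b *: eps) = 0) ?addr0 => [->|].
    by exists b; rewrite scale0r add0r.
  by rewrite -[b *: eps]mulr_algl rmorphM /= re mulr0.
move=> _ _ /h[a ->] /h[b ->]; by rewrite -scalerAl -scalerAr eps2 !scaler0.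
Qed.
End DualNumbers.

Section Universal.
Variables (K : fieldType) (OS OD OC : comAlgType K).
Variables (delta : {lrmorphism OS -> OD}) (rho : {lrmorphism OS -> OC}).
Variables (Phi : {lrmorphism OS -> mps 2 K}) (f : mps 2 K) (w k : nat) (fs : 'I_k -> mps 2 K).
Let F0 : mps 2 K := py K * f + px K ^+ w.
Hypothesis w0 : (0 < w)%N.
Hypothesis PhiB : bijective Phi.
Hypothesis kdelta : kerset delta = Phi @^-1` ideal_gen [set py K].
Hypothesis rhoS : surj rho.
Hypothesis krho : kerset rho = Phi @^-1` ideal_gen [set F0].
Hypothesis fs_span : forall h, exists c : 'I_k -> K, Iea F0 (py K * (h - \sum_i c i *: fs i)).
Hypothesis fs_free : forall c : 'I_k -> K, Iea F0 (py K * \sum_i c i *: fs i) -> forall i, c i = 0.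

Lemma universal_dual : bijective_on_dual_numbers (universal_family delta rho Phi f w fs).
Proof.
move=> c [x [xD xw] ->]; have AC := dual_AC K.
have [res [r [e [c' [resA resP fl]]]]] := AC_flag AC.
have [v [mv xv]] := deform_normal_form PhiB kdelta rhoS krho fs_span AC xD xw.
have [i|u uE] := AC_ev AC resA resP (b := v); first by apply/resP.
have cE := pclassE PhiB kdelta rhoS krho AC xD xv.
have indE u1 c1 := @inducedE _ _ _ _ delta rho Phi f w k fs w0 PhiB kdelta rhoS krho _ u1 c1 AC.
exists u; split; first exact: (AC_hom_local resA resP).
  by apply/indE; rewrite cE; congr (pclass _ _ _ _ _ (eqn _ _ _ _)); apply/funext => i; rewrite uE.
move=> u' ul /indE cE'; apply: (AC_hom_eq AC resA resP) => i; rewrite uE.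
have [_ xu'] : pclass delta rho Phi f w (eqn f w fs (fun i => u' (mpsX K i))) x.
  by rewrite -cE' cE; split.
apply: (eqn_unique PhiB kdelta rhoS krho fs_free AC resA resP fl (dual_square0 resA) xD xu' xv) => l.
  by apply/resP; apply: hom_maxid AC.
exact/resP.
Qed.
End Universal.

(** * Power series rings are noetherian *)

Section Dickson.
Variable n : nat.
Implicit Types (m : 'X_{1..n}) (S : set 'X_{1..n}).

(** Induction on the number k of variables that are compared. If s works for k of them and N is the
    largest next exponent on s, an m with next exponent at least N lies above an element of s; each
    of the finitely many smaller exponents has a finite set of its own. *)
Lemma dickson S : exists s : seq 'X_{1..n}, uniq s /\ (forall m, m \in s -> S m) /\
  forall m, S m -> exists2 m0, m0 \in s & (m0 <= m)%MM.
Proof.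
suff H k : (k <= n)%N -> forall S, exists s : seq 'X_{1..n}, (forall m, m \in s -> S m) /\
    forall m, S m -> exists2 m0, m0 \in s & forall i : 'I_n, (i < k)%N -> (m0 i <= m i)%N.
  have [s [sS sP]] := H n (leqnn n) S; exists (undup s).
  split; first exact: undup_uniq.
  split=> [m|m /sP[m0 ms h]]; first by rewrite mem_undup; apply: sS.
  by exists m0; rewrite ?mem_undup //; apply/mnm_lepP => i; apply: h.
elim: k => {S} [_ S|k IHk kn S].
  have [[m Sm]|S0] := pselect (exists m, S m).
    by exists [:: m]; split=> [m'|m' _]; [rewrite inE => /eqP ->|exists m; rewrite ?inE].
  by exists [::]; split=> // m Sm; case: S0; exists m.
have [s [sS sP]] := IHk (ltnW kn) S; pose l := Ordinal kn.
have [t tP] := choice (fun j => IHk (ltnW kn) [set m | S m /\ m l = j]).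
pose N := \max_(m <- s) m l.
exists (s ++ flatten [seq t j | j <- iota 0 N]); split=> [m|m Sm].
  rewrite mem_cat => /orP[/sS //|/flattenP[_ /mapP[j _ ->] mj] ].
  by have [/(_ m mj)[] ] := tP j.
have [ml|ml] := ltnP (m l) N.
  have [_ h] := tP (m l); have [//|m0 m0t le0] := h m.
  exists m0; first by rewrite mem_cat; apply/orP; right; apply/flattenP;
    exists (t (m l)) => //; apply: map_f; rewrite mem_iota.
  move=> i; rewrite ltnS leq_eqVlt => /orP[/eqP il|/le0 //].
  have -> : i = l by apply: val_inj.
  by have [/(_ m0 m0t)[_ ->] ] := tP (m l).
have [m0 m0s le0] := sP m Sm; exists m0; first by rewrite mem_cat m0s.
move=> i; rewrite ltnS leq_eqVlt => /orP[/eqP il|/le0 //].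
have -> : i = l by apply: val_inj.
by apply: leq_trans ml; rewrite /N (big_rem m0) //= leq_maxl.
Qed.

End Dickson.

Section Noetherian.
Variables (n : nat) (K : fieldType).
Implicit Types (f : mps n K) (m : 'X_{1..n}).
Local Notation R := (mps n K).

Definition mps_mon m : R := MPS (fun m' => (m' == m)%:R).

Lemma mcoef_mon m m' : mps_coef (mps_mon m) m' = (m' == m)%:R. Proof. by []. Qed.

Lemma mcoef_monM m f m' : mps_coef (mps_mon m * f) (m + m')%MM = mps_coef f m'.
Proof.
have d1 := ltnSn (mdeg (m + m')).
rewrite mulrC [LHS](mps_mulE f (mps_mon m) d1 d1).
have -> : mps_trunc (mdeg (m + m')).+1 (mps_mon m) = 'X_[m].
  apply/mpolyP => l; rewrite mcoeffX; have [ld|ld] := ltnP (mdeg l) (mdeg (m + m')).+1.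
    by rewrite mcoeff_trunc // mcoef_mon eq_sym.
  have /negPf -> : m != l by apply: contraTneq ld => <-; rewrite -ltnNge ltnS mdegD leq_addr.
  rewrite raddf_sum big1 //= => k _; rewrite mcoeffZ mcoeffX.
  by have /negPf -> : bmnm k != l; rewrite ?mulr0 //; apply: contraTneq ld => <-; rewrite -ltnNge bmdeg.
by rewrite mcoeffMX mcoeff_trunc // ltnS mdegD leq_addl.
Qed.

Lemma mps_ge_mon m d : (d <= mdeg m)%N -> mps_ge d (mps_mon m).
Proof.
move=> dm m' md; rewrite mcoef_mon; case: eqVneq => // e.
by move: md; rewrite e ltnNge dm.
Qed.

Definition vanish_lt m f := forall m', (m' < m)%O -> mps_coef f m' = 0.

Lemma vanish_lt_monM m f m' : vanish_lt m f -> vanish_lt (m' + m)%MM (mps_mon m' * f).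
Proof.
move=> mf l lm; apply: (mcoefM_ind (L := [set 0])) => //.
  by move=> a b -> ->; rewrite addr0.
move=> k1 k2 e; rewrite mcoef_mon /=; case: eqVneq => [k1m|_]; last by rewrite mul0r.
by rewrite mf ?mulr0 //; rewrite -(ltmc_add2r m') -k1m -e k1m.
Qed.

Lemma initial_exists f : f <> 0 -> exists m, mps_coef f m <> 0 /\ vanish_lt m f.
Proof.
move=> f0; have [m0 m0P] : exists m, mps_coef f m <> 0.
  by apply: contrapT => h; apply/f0/mpsext => m; apply: contrapT => fm; apply: h; exists m.
elim/(well_founded_ind (@ltom_wf n)): m0 m0P => m IHm fm.
have [[m' [m'm fm']]|h] := pselect (exists m', (m' < m)%O /\ mps_coef f m' <> 0).
  exact: IHm fm'.
by exists m; split=> // m' m'm; apply: contrapT => fm'; apply: h; exists m'.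
Qed.

Lemma vanish_lt_ge m f d : vanish_lt m f -> (d <= mdeg m)%N -> mps_ge d f.
Proof. by move=> mf dm m' m'd; apply/mf/lt_mdeg_ltmc/(leq_trans m'd). Qed.

Section Division.
Variables (I : set R) (s : seq 'X_{1..n}) (F : 'X_{1..n} -> R).
Hypothesis hI : is_ideal I.
Hypothesis us : uniq s.
Hypothesis FI : forall m, m \in s -> [/\ I (F m), mps_coef (F m) m = 1 & vanish_lt m (F m)].
Hypothesis sI : forall f m, I f -> mps_coef f m <> 0 -> vanish_lt m f ->
  exists2 m0, m0 \in s & (m0 <= m)%MM.
Local Notation comb q := (\sum_(m <- s) q m * F m).

(** Standard basis division for an order in which low degree comes first: while f has terms of
    degree d, its smallest monomial is cancelled by a multiple of some F m0. The bound on the order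
    of q m makes the successive quotients summable. *)
Lemma degree_step d f : I f -> mps_ge d f -> exists q : 'X_{1..n} -> R,
  (forall m, mps_ge (d - mdeg m) (q m)) /\ mps_ge d.+1 (f - comb q).
Proof.
(* [U f] holds the monomials of degree at most d that are not smaller than the initial monomial of
   f; cancelling the initial term makes it strictly smaller. *)
pose U f : {set 'X_{1..n < d.+1}} := [set m | ~~ `[< forall m', (m' <= bmnm m)%O -> mps_coef f m' = 0 >] ]%SET.
have [N] := ubnP #|U f|; elim: N f => // N IHN f UN If fd.
have [g1|g1] := pselect (mps_ge d.+1 f).
  exists (fun=> 0); split=> [m|]; first exact: mps_ge_0.
  by rewrite big1 ?subr0 // => m _; rewrite mul0r.
have f0 : f <> 0 by move=> f0; apply: g1; rewrite f0; apply: mps_ge_0.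
have [m [fm mf]] := initial_exists f0.
have md : (mdeg m < d.+1)%N by rewrite ltnNge; apply/negP => dm; apply/g1/(vanish_lt_ge mf dm).
have dm : (d <= mdeg m)%N by rewrite leqNgt; apply/negP => /fd.
have [m0 m0s m0m] := sI If fm mf; have [IF F1 Fm0] := FI m0s.
set c := mps_coef f m in fm.
have [m1 mE] : exists m1, m = (m1 + m0)%MM by exists (m - m0)%MM; rewrite submK.
pose f1 := f - c%:A * (mps_mon m1 * F m0).
have If1 : I f1 by apply: (idealB hI) => //; do 2 apply: (idealM _ hI).
have vF : vanish_lt m (mps_mon m1 * F m0) by rewrite mE; apply: vanish_lt_monM.
have f1m m' : (m' <= m)%O -> mps_coef f1 m' = 0.
  rewrite mcoefB mulr_algl mcoefZ Order.POrderTheory.le_eqVlt => /orP[/eqP ->|m'm].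
    by rewrite {2}mE mcoef_monM F1 mulr1 subrr.
  by rewrite mf // vF // mulr0 subr0.
have [|||q [qd qE]] := IHN f1.
- rewrite -ltnS; apply: leq_ltn_trans UN; apply: proper_card; apply/properP; split.
    apply/fintype.subsetP => l; rewrite !inE; apply: contra => /asboolP h; apply/asboolP => m' m'l.
    have [/f1m //|mm'] := Order.TotalTheory.leP m' m.
    case: fm; apply: h; apply: Order.POrderTheory.ltW; exact: Order.POrderTheory.lt_le_trans m'l.
  exists (BMultinom md); rewrite !inE /=.
    by apply/asboolP => h; apply: fm; apply: h.
  by rewrite negbK; apply/asboolP.
- exact: If1.
- by apply: mps_geB => //; apply/mps_geMl/(vanish_lt_ge vF).
exists (fun l => q l + if l == m0 then c%:A * mps_mon m1 else 0); split.
  move=> l; apply: mps_geD => //; case: eqVneq => [->|_]; last exact: mps_ge_0.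
  by apply/mps_geMl/mps_ge_mon; rewrite leq_subLR addnC -mdegD -mE.
have -> : comb (fun l => q l + if l == m0 then c%:A * mps_mon m1 else 0) =
    comb q + c%:A * mps_mon m1 * F m0.
  rewrite (bigD1_seq m0) // [comb q](bigD1_seq m0) //= eqxx mulrDl -!addrA; congr (_ + _).
  rewrite addrC; congr (_ + _); apply: eq_bigr => l /negPf ->; by rewrite addr0.
by rewrite opprD addrA addrAC -mulrA.
Qed.

Lemma division f : I f -> exists q : 'X_{1..n} -> R, f = comb q.
Proof.
move=> If; pose D := \max_(m <- s) mdeg m.
have sD m : m \in s -> (mdeg m <= D)%N by move=> ms; rewrite /D (big_rem m) //= leq_maxl.
have stepP (dg : nat * R) : exists q : 'X_{1..n} -> R, I dg.2 -> mps_ge dg.1 dg.2 ->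
    (forall m, mps_ge (dg.1 - mdeg m) (q m)) /\ mps_ge dg.1.+1 (dg.2 - comb q).
  have [h|h] := pselect (I dg.2 /\ mps_ge dg.1 dg.2).
    by have [q qP] := degree_step h.1 h.2; exists q.
  by exists (fun=> 0) => h1 h2; case: h.
have [qs qsP] := choice stepP.
pose g := fix g d := if d is d'.+1 then g d' - comb (qs (d', g d')) else f.
have gP d : I (g d) /\ mps_ge d (g d).
  elim: d => [|d [Id gd] ]; first by split=> //; apply: mps_ge0.
  have [_ ?] := qsP (d, g d) Id gd; split=> //=; apply: (idealB hI) => //.
  rewrite big_seq; apply: (ideal_sum _ hI) => m /FI[Fm _ _]; exact: (idealM _ hI).
pose Q d m := \sum_(e < d) qs (e : nat, g e) m.
have gE d : f = g d + comb (Q d).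
  elim: d => [|d ->] /=.
    by rewrite big1 ?addr0 // => m _; rewrite /Q big_ord0 mul0r.
  have -> : comb (Q d.+1) = comb (qs (d, g d)) + comb (Q d).
    by rewrite -big_split; apply: eq_bigr => m _; rewrite /Q big_ord_recr /= mulrDl addrC.
  by rewrite addrA subrK.
(* D bounds the degrees in s; starting the sequence at index D turns the estimate d - deg m into
   order at least k for the k-th difference. *)
have limP m : exists l, m \in s -> forall k, mps_ge k (l - Q (k + D)%N m).
  have [ms|ms] := boolP (m \in s); last by exists 0.
  have [k|l lP] := @mps_lim n K (fun k => Q (k + D)%N m); last by exists l.
  rewrite addSn /Q big_ord_recr /= addrAC subrr add0r.
  have [Id gd] := gP (k + D)%N; have [h _] := qsP (_, _) Id gd.
  by apply: mps_ge_le (h m); rewrite /= -addnBA ?leq_addr // sD.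
have [l lP] := choice limP; exists l; apply/eqP; rewrite -subr_eq0; apply/eqP.
apply: mps_ge_ext => k; rewrite {1}(gE (k + D)%N) -addrA; apply: mps_geD.
  by apply: mps_ge_le (gP _).2; apply: leq_addr.
rewrite -sumrB big_seq; apply: mps_ge_sum => m ms.
by rewrite -mulrBl mulrC -opprB mulrN; apply/mps_geN/mps_geMl/lP.
Qed.

End Division.

(** Dickson's lemma gives finitely many initial exponents below all those of I, and series of I with
    these initial terms generate I by division. *)
Lemma mps_noetherian : noetherian R.
Proof.
move=> I hI; pose S := [set m | exists f, [/\ I f, mps_coef f m = 1 & vanish_lt m f] ].
have [s [us [sS sP] ] ] := dickson S.
have FP m : exists f, S m -> [/\ I f, mps_coef f m = 1 & vanish_lt m f].
  by have [[f fP]|h] := pselect (S m); [exists f|exists 0 => /h].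
have [F FE] := choice FP; exists [seq F m | m <- s]; apply/seteqP; split; last first.
  by apply: ideal_gen_min => // f /= /mapP[m ms ->]; have [] := FE m (sS m ms).
move=> f If; have [| |q ->] := @division I s F hI us _ _ f If.
- by move=> m /sS/FE.
- move=> g m Ig gm mg; apply: sP; exists ((mps_coef g m)^-1 *: g); split.
  + by rewrite -mulr_algl; apply: (idealM _ hI).
  + by rewrite mcoefZ mulVf //; apply/eqP.
  + by move=> m' /mg; rewrite mcoefZ => ->; rewrite mulr0.
rewrite big_seq; apply: (ideal_sum _ (@ideal_genP _ _)).
move=> m ms; apply: (idealM _ (@ideal_genP _ _)).
by apply: ideal_gen_sub; apply: map_f.
Qed.

Lemma maxid_pow d : ideal_pow (maxid R) d = @mps_ge n K d.
Proof.
have gI e : is_ideal (@mps_ge n K e).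
  split; [exact: mps_ge_0|move=> *; exact: mps_geD|move=> *; exact: mps_geMl].
elim: d => [|d IHd]; first by apply/seteqP; split.
rewrite /ideal_pow iterS -/(ideal_pow _ d) IHd; apply/seteqP; split.
  apply: ideal_gen_min => // _ [a /mps_maxid_field/mps_ge1 a1 [b bd <-] ].
  by rewrite -add1n; apply: mps_geM.
move=> f fd; rewrite (mps_tailE f) fd ?mdeg0 // scale0r add0r.
apply: (ideal_sum _ (@ideal_genP _ _)).
move=> i _; apply: ideal_gen_sub; exists (mpsX K i); first by apply/mps_maxid_field/mcoefX0.
by exists (mps_tail i f) => //; apply: mps_ge_tail.
Qed.

Lemma mps_complete_local_noetherian : complete_local_noetherian R.
Proof.
split; last 1 first.
- move=> f; exists (mps_coef f 0%MM); apply/mps_maxid_field.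
  by rewrite mcoefB mcoefA eqxx subrr.
- rewrite /is_local; have -> : maxid R = @mps_ge n K 1.
    apply/seteqP; split=> f; first by move/mps_maxid_field/mps_ge1.
    by move=> f1; apply/mps_maxid_field/f1; rewrite mdeg0.
  split; [exact: mps_ge_0|move=> *; exact: mps_geD|move=> *; exact: mps_geMl].
- exact: mps_noetherian.
split.
  apply/seteqP; split=> [f hf|_ -> d _]; last by rewrite maxid_pow; apply: mps_ge_0.
  by apply: mps_ge_ext => d; have := hf d I; rewrite maxid_pow.
move=> t ht; have [|l lP] := @mps_lim n K t; first by move=> d; rewrite -maxid_pow.
by exists l => d; rewrite maxid_pow.
Qed.

End Noetherian.

(** * Changes of coordinates *)

Section FormalInverse.
Variable K : fieldType.

Lemma mcoef_hom0 n m (u : {lrmorphism mps n K -> mps m K}) f :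
  mps_coef (u f) 0%MM = mps_coef f 0%MM.
Proof.
suff h g : mps_coef g 0%MM = 0 -> mps_coef (u g) 0%MM = 0.
  have := h (f - (mps_coef f 0%MM)%:A).
  rewrite rmorphB /= lrmorph_algE !mcoefB !mcoefA !eqxx !mulr1n subrr => /(_ erefl) /eqP.
  by rewrite subr_eq0 => /eqP.
move=> g0; apply: contrapT => /eqP c0; set c := mps_coef (u g) _ in c0.
have [|h gh] := @mps_domain_inv n K (g - c%:A).
  by rewrite mcoefB g0 mcoefA eqxx mulr1n sub0r => /eqP; rewrite oppr_eq0 (negPf c0).
have : mps_coef (u ((g - c%:A) * h)) 0%MM = 0.
  by rewrite rmorphM mcoefM0 rmorphB /= lrmorph_algE mcoefB mcoefA eqxx mulr1n subrr mul0r.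
by rewrite gh rmorph1 mcoef1 eqxx => /eqP; rewrite oner_eq0.
Qed.

(** Every f expands as f(0) + sum u(X_j) T_j f, so a preimage is the solution t of t f = f(0) + sum
    X_j t(T_j f). *)
Lemma hom_surj n m (u : {lrmorphism mps n K -> mps m K}) (a : 'I_m -> 'I_n -> mps m K) :
  (forall i, mpsX K i = \sum_j a i j * u (mpsX K j)) -> surj u.
Proof.
move=> aE; pose T j f := \sum_i a i j * mps_tail i f.
have TE f : f = (mps_coef f 0%MM)%:A + \sum_j u (mpsX K j) * T j f.
  rewrite {1}(mps_tailE f); congr (_ + _).
  under eq_bigr => i _ do rewrite aE mulr_suml.
  rewrite exchange_big; apply: eq_bigr => j _; rewrite mulr_sumr.
  by apply: eq_bigr => i _; rewrite mulrCA mulrA.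
have [|t tE] := @mps_tcomp n K n (fun j => mpsX K j) _ T _ (fun f => (mps_coef f 0%MM)%:A).
  exact: mcoefX0.
move=> f; exists (t f); apply/eqP; rewrite -subr_eq0; apply/eqP.
apply: (tsepF (T := T) (D := fun f => u (t f) - f)
  (mps_tsep (b := fun j => u (mpsX K j)) _)) => [j|{}f]; first by rewrite mcoef_hom0 mcoefX0.
rewrite /= tE [X in _ - X](TE f) rmorphD rmorph_sum /= lrmorph_algE opprD addrACA subrr add0r -sumrB.
by apply: eq_bigr => j _; rewrite rmorphM mulrBr.
Qed.

(* The kernels of the iterates of u form an ascending chain. *)
Lemma noetherian_surj_bij (R : comNzRingType) (u : {rmorphism R -> R}) :
  noetherian R -> surj u -> bijective u.
Proof.
move=> NR uS; apply: inj_surj_bij => // a b ab.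
pose I := [set x | exists N, iter N u x = 0].
have it0 N : iter N u 0 = 0 by elim: N => //= N ->; rewrite rmorph0.
have itD N x y : iter N u (x + y) = iter N u x + iter N u y.
  by elim: N => //= N ->; rewrite rmorphD.
have itM N x y : iter N u (x * y) = iter N u x * iter N u y.
  by elim: N => //= N ->; rewrite rmorphM.
have it_le M N x : (M <= N)%N -> iter M u x = 0 -> iter N u x = 0.
  by move=> /subnK <-; rewrite iterD => ->.
have hI : is_ideal I.
  split; first by exists 0%N.
    move=> x y [M xM] [N yN]; exists (maxn M N).
    by rewrite itD (it_le M) ?leq_maxl // (it_le N) ?leq_maxr // addr0.
  by move=> x y [N yN]; exists N; rewrite itM yN mulr0.
have [s IE] := NR I hI.
have [N sN] : exists N, forall x, x \in s -> iter N u x = 0.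
  have : forall x, x \in s -> I x by move=> x xs; rewrite IE; apply: ideal_gen_sub.
  elim: s {IE} => [|y s IHs] sI; first by exists 0%N.
  have [x xs|N sN] := IHs; first by apply: sI; rewrite inE xs orbT.
  have [M yM] := sI y (mem_head _ _); exists (maxn M N) => x; rewrite inE => /orP[/eqP ->|/sN].
    by apply: it_le yM; rewrite leq_maxl.
  by apply: it_le; rewrite leq_maxr.
have IN x : I x -> iter N u x = 0.
  rewrite IE; apply: (@ideal_gen_min _ _ [set x | iter N u x = 0]) => //.
  by split=> [|y z /= yN zN|y z /= zN]; rewrite /= ?it0 // ?itD ?itM ?yN zN ?addr0 ?mulr0.
have itS M x : exists y, iter M u y = x.
  elim: M x => [x|M IHM x]; first by exists x.
  by have [y <-] := uS x; have [z <-] := IHM y; exists z.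
apply/eqP; rewrite -subr_eq0; apply/eqP; have [c cE] := itS N (a - b).
by rewrite -cE; apply: IN; exists N.+1; rewrite /= cE rmorphB ab subrr.
Qed.

(** Plays the part of the formal inverse function theorem: injectivity is deduced from surjectivity
    by noetherianity. *)
Lemma hom_bij n (u : {lrmorphism mps n K -> mps n K}) (a : 'I_n -> 'I_n -> mps n K) :
  (forall i, mpsX K i = \sum_j a i j * u (mpsX K j)) -> bijective u.
Proof. by move/hom_surj => uS; apply: noetherian_surj_bij uS; apply: mps_noetherian. Qed.

End FormalInverse.

Section Plane.
Variable K : fieldType.

Lemma ord2P (i j l : 'I_2) : i != j -> l = i \/ l = j.
Proof.
by case: i => [ [|[|] ] ] //= ?; case: j => [ [|[|] ] ] //= ?; case: l => [ [|[|] ] ] //= ? _;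
  (by left; apply: val_inj) || (by right; apply: val_inj).
Qed.

Lemma big_ord2 (V : nmodType) (i j : 'I_2) (F : 'I_2 -> V) : i != j ->
  \sum_l F l = F i + F j.
Proof.
move=> ij; rewrite (bigD1 i) //= (bigD1 j) 1?eq_sym //= big1 ?addr0 // => l /andP[/negPf li /negPf lj].
by case: (ord2P l ij) => e; move: li lj; rewrite e eqxx.
Qed.

Lemma low_order (i j : 'I_2) (c : mps 2 K) : i != j -> mps_low i 1 c <> 0 ->
  exists N u, mps_low i 1 c = mpsX K j ^+ N * u /\ mps_coef u 0%MM <> 0.
Proof.
move=> ij c0; pose P N := `[< mps_coef c (U_(j) *+ N)%MM <> 0 >].
have mE (m : 'X_{1..2}) : m i = 0%N -> m = (U_(j) *+ m j)%MM.
  move=> mi; apply/mnmP => l; rewrite mulmnE mnm1E.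
  by case: (ord2P l ij) => ->; rewrite ?eqxx ?mul1n // mi eq_sym (negPf ij).
have [N PN] : exists N, P N.
  apply: contrapT => h; apply/c0/mpsext => m; rewrite mcoef_low; case: ltnP => //.
  rewrite ltnS leqn0 => /eqP/mE ->; apply: contrapT => cm; apply: h; exists (m j).
  by apply/asboolP.
case: (ex_minnP (ex_intro _ N PN)) => {PN}N /asboolP PN Nmin.
exists N, (mps_shift j N (mps_low i 1 c)); split.
  apply: mps_shiftP => m mN; rewrite mcoef_low; case: ltnP => //; rewrite ltnS leqn0 => /eqP mi.
  apply: contrapT; rewrite (mE _ mi) => cm; have /Nmin : P (m j) by apply/asboolP.
  by rewrite leqNgt mN.
by rewrite mcoef_shift mcoef_low add0m mulmnE mnm1E eq_sym (negPf ij).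
Qed.

(** Some variable X_i maps to t times a unit, so K[[X_i]] maps isomorphically onto K[[t]], and the
    other variable X_j has the same image as a series s in X_i. The new coordinates are X_i and X_j
    - s. *)
Lemma plane_coordinates (pr : {lrmorphism mps 2 K -> mps 1 K}) : surj pr ->
  exists phi : {lrmorphism mps 2 K -> mps 2 K},
    bijective phi /\ forall f, pr (phi f) = 0 <-> ideal_gen [set py K] f.
Proof.
pose t := mpsX K (ord0 : 'I_1) => prS.
have tE (f : mps 1 K) : f = (mps_coef f 0%MM)%:A + t * mps_tail ord0 f.
  by rewrite {1}(mps_tailE f) big_ord1.
have prX l : exists p, pr (mpsX K l) = t * p.
  by exists (mps_tail ord0 (pr (mpsX K l))); rewrite {1}(tE (pr _)) mcoef_hom0 mcoefX0 scale0r add0r.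
have [p pE] := choice prX; have [g gE] := prS t.
(* Otherwise every series without constant term would map into (t^2), but t = pr g is the image of
   one. *)
have [i pn0] : exists i, mps_coef (p i) 0%MM <> 0.
  apply: contrapT => h; have : 1 = \sum_l p l * pr (mps_tail l g).
    apply: (@mpsX_inj _ _ ord0); rewrite mulr1 -/t -{1}gE {1}(mps_tailE g) rmorphD /=.
    rewrite -(mcoef_hom0 pr) gE mcoefX0 scale0r rmorph0 add0r rmorph_sum mulr_sumr.
    by apply: eq_bigr => l _; rewrite rmorphM /= pE mulrA.
  move=> /(congr1 (fun f => mps_coef f 0%MM)); rewrite mcoef1 eqxx mcoef_sum big1 => [/eqP|l _].
    by rewrite oner_eq0.
  rewrite mcoefM0; have [->|pl] := pselect (mps_coef (p l) 0%MM = 0); first by rewrite mul0r.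
  by case: h; exists l.
have [j ij] : exists j : 'I_2, i != j.
  by case: i {pn0} => [ [|[|] ] ] // ?; [exists ord_max|exists ord0].
have [v pv] := mps_domain_inv pn0.
have [sg sgX] : exists sg : {lrmorphism mps 1 K -> mps 2 K}, forall l, sg (mpsX K l) = mpsX K i.
  by apply: mps_subst => _; apply: mcoefX0.
have sgX0 : pr (sg t) = t * p i by rewrite sgX pE.
have /bij_surj th : bijective (pr \o sg).
  by apply: (@hom_bij _ _ _ (fun _ _ => v)) => l; rewrite big_ord1 (ord1 l) /= sgX0 mulrC -mulrA pv mulr1.
have [r rE] := th (t * p j).
have r0 : mps_coef r 0%MM = 0.
  by rewrite -(mcoef_hom0 sg) -(mcoef_hom0 pr) [pr _]rE mcoefM0 mcoefX0 mul0r.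
pose s := sg r; have sE : s = mpsX K i * sg (mps_tail ord0 r).
  by rewrite /s {1}(tE r) r0 scale0r add0r rmorphM /= sgX.
have [|phi phiX] := @mps_subst 2 K 2 (fun l => if l == ord0 then mpsX K i else mpsX K j - s).
  by move=> l; case: eqP => _; rewrite ?mcoefB ?sE ?mcoefM0 ?mcoefX0 ?mul0r ?subr0.
have phi0 : phi (px K) = mpsX K i by rewrite phiX.
have phi1 : phi (py K) = mpsX K j - s by rewrite phiX.
exists phi; split.
  apply: (@hom_bij _ _ _ (fun l l' => if l == i then (l' == ord0)%:R
                           else if l' == ord0 then sg (mps_tail ord0 r) else 1)) => l.
  rewrite (big_ord2 _ (ord_max2)) /= -/(px K) -/(py K) phi0 phi1.
  case: (ord2P l ij) => ->; first by rewrite eqxx mul1r mul0r addr0.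
  by rewrite eq_sym (negPf ij) sE; ring.
have piphi1 : pr (phi (py K)) = 0 by rewrite phi1 rmorphB /= pE /s [pr (sg r)]rE subrr.
move=> f; split=> [f0|/ideal_gen1P[g' ->]]; last by rewrite !rmorphM /= piphi1 mulr0.
(* Modulo y, f is a series in x; if that were x^N times a unit, its image would be t^N times a unit
   and not 0. *)
have fE := mps_low_shift ord_max 1 f; rewrite expr1 -/(py K) in fE.
have [l0|/low_order h] := pselect (mps_low ord_max 1 f = 0).
  by apply/ideal_gen1P; exists (mps_shift ord_max 1 f); rewrite {1}fE l0 add0r mulrC.
have [//|N [u [uE u0]]] := h ord0.
have := f0; rewrite fE uE rmorphD !rmorphM rmorphXn /= -/(px K) phi0.
rewrite rmorphD !rmorphM rmorphXn /= piphi1 mul0r addr0 pE exprMn -mulrA => e.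
have /(congr1 (fun f => mps_coef f 0%MM)) : p i ^+ N * pr (phi u) = 0.
  by rewrite -(mps_shiftXn ord0 N (_ * _)) e; apply: mpsext.
rewrite mcoefM0 !mcoef_hom0; have -> : mps_coef (p i ^+ N) 0%MM = mps_coef (p i) 0%MM ^+ N.
  by elim: N {uE e} => [|N IHN]; rewrite ?expr0 ?mcoef1 ?eqxx // !exprS mcoefM0 IHN.
by move/eqP; rewrite mulf_eq0 expf_eq0 => /orP[/andP[_]|] /eqP.
Qed.

Lemma coordinates_exist (OS OD : comAlgType K) (delta : {lrmorphism OS -> OD}) :
  surface_pair delta -> exists Phi : {lrmorphism OS -> mps 2 K}, coordinates delta Phi.
Proof.
case=> -[al alB] dS [be beB]; have [al1 [al1K alK]] := inv_lrmorph alB.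
pose pr : {lrmorphism mps 2 K -> mps 1 K} := be \o delta \o al1.
have [|phi [phiB phiE]] := @plane_coordinates pr.
  move=> f; have [d dE] := bij_surj beB f; have [s sE] := dS d.
  by exists (al s); rewrite /= al1K sE.
have [phi1 [phi1K phiK]] := inv_lrmorph phiB.
exists (phi1 \o al); split.
  by apply: bij_comp => //; exists phi.
apply/seteqP; split=> s.
  move=> s0; apply/phiE; rewrite /= phiK al1K.
  by have -> : delta s = 0 by []; rewrite rmorph0.
move/phiE; rewrite /= phiK al1K => e; apply: (bij_inj beB); by rewrite e rmorph0.
Qed.

End Plane.

(** * Finiteness of the colength *)

Section Codimension.
Variables (K : fieldType) (V : lmodType K).
Implicit Type J : set V.

(** A relation modulo J with c_i nonzero allows f_i to be dropped from the spanning family. *)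
Lemma codim_exists J n (f : 'I_n -> V) :
  (forall v, exists c : 'I_n -> K, J (v - \sum_i c i *: f i)) -> subspace J -> exists k, codim J k.
Proof.
move=> sp [J0 JD JZ]; elim: n f sp => [|n IHn] f sp.
  by exists 0%N, f; split=> // c _ [].
have [h|/existsNP[c /not_implyP[cJ /existsNP[i /eqP ci] ] ] ] :=
    pselect (forall c : 'I_n.+1 -> K, J (\sum_i c i *: f i) -> forall i, c i = 0).
  by exists n.+1, f.
apply: (IHn (f \o lift i)) => v; have [d dJ] := sp v.
exists (fun l => d (lift i l) - d i / c i * c (lift i l)).
have -> : v - \sum_l (d (lift i l) - d i / c i * c (lift i l)) *: (f \o lift i) l =
    (v - \sum_l d l *: f l) + (d i / c i) *: \sum_l c l *: f l.
  rewrite !(bigD1_ord i) //= scalerDr scalerA mulfVK // -addrA; congr (_ + _).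
  rewrite opprD addrACA addNr add0r scaler_sumr -sumrN -sumrN -big_split /=.
  by apply: eq_bigr => l _; rewrite scalerBl opprB scalerA addrC.
by apply: JD => //; apply: JZ.
Qed.

Lemma codim_le J k k' : subspace J -> codim J k -> codim J k' -> (k <= k')%N.
Proof.
move=> [J0 JD JZ] [f [ff _] ] [f' [_ sp] ].
have [c cE] := choice (fun i => sp (f i)).
have JB u v : J u -> J v -> J (u - v) by move=> Ju Jv; rewrite -scaleN1r; apply: JD => //; apply: JZ.
have JS (T : finType) (F : T -> V) : (forall i, J (F i)) -> J (\sum_i F i).
  by move=> h; apply: (big_ind J) => // *; apply: JD.
pose M := \matrix_(i, j) c i j : 'M[K]_(k, k').
suff /eqP <- : row_free M by apply: rank_leq_col.
apply: inj_row_free => v vM; apply/rowP => i; rewrite mxE; apply: (ff (fun i => v 0 i)) => {i}.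
have -> : \sum_i v 0 i *: f i = \sum_i v 0 i *: (f i - \sum_j c i j *: f' j).
  have e : \sum_i v 0 i *: \sum_j c i j *: f' j = 0.
    under eq_bigr => i _ do rewrite scaler_sumr.
    rewrite exchange_big big1 // => j _ /=.
    have : (v *m M) 0 j = 0 by rewrite vM mxE.
    rewrite mxE => e; rewrite -[RHS](scale0r (f' j)) -e scaler_suml.
    by apply: eq_bigr => i _; rewrite scalerA !mxE.
  rewrite -[LHS]subr0 -[X in _ - X]e -sumrB; by apply: eq_bigr => i _; rewrite scalerBr.
by apply: JS => i; apply: JZ.
Qed.

Lemma codim_unique J k k' : subspace J -> codim J k -> codim J k' -> k = k'.
Proof. by move=> JS h h'; apply/eqP; rewrite eqn_leq !(codim_le JS). Qed.

End Codimension.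

Section Restriction.
Variable K : fieldType.

Lemma mps_lowD n i w (f g : mps n K) : mps_low i w (f + g) = mps_low i w f + mps_low i w g.
Proof. by apply: mpsext => m; rewrite mcoefD !mcoef_low mcoefD; case: ifP; rewrite ?addr0. Qed.

Lemma mps_lowX n i (f : mps n K) : mps_low i 1 (mpsX K i * f) = 0.
Proof. by apply: mpsext => m; rewrite mcoef_low; case: ltnP => //; rewrite ltnS leqn0 => /eqP/mcoefXM0. Qed.

Lemma mps_low_comm n i j (f : mps n K) : i != j ->
  mps_low i 1 (mpsX K j * f) = mpsX K j * mps_low i 1 f.
Proof.
move=> ij; apply: (addIr (mpsX K i ^+ 1 * mps_shift i 1 (mpsX K j * f))).
by rewrite -mps_low_shift {1}(mps_low_shift i 1 f) mulrDr mps_shift_comm // mulrCA.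
Qed.

Lemma mps_low_low n i (f : mps n K) : mps_low i 1 (mps_low i 1 f) = mps_low i 1 f.
Proof. by apply: mpsext => m; rewrite !mcoef_low; case: ltnP. Qed.

(* mps_low i 1 sets X_i = 0, hence is multiplicative. *)
Lemma restriction (i j : 'I_2) : i != j ->
  exists r : {lrmorphism mps 2 K -> mps 2 K}, forall f, r f = mps_low i 1 f.
Proof.
move=> ij; have [l|r rX] := @mps_subst 2 K 2 (fun l => if l == i then 0 else mpsX K l).
  by case: eqP => _; rewrite ?mcoefX0.
exists r => f; apply/eqP; rewrite -subr_eq0; apply/eqP.
apply: (tsepF (n := 1) (T := fun _ => mps_tail j) (D := fun f => r f - mps_low i 1 f)
  (mps_tsep (b := fun=> mpsX K j) _)) => [_|{}f]; first exact: mcoefX0.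
rewrite big_ord1 {1 2}(mps_tailE f) (big_ord2 _ ij) !mps_lowD mps_lowX mps_low_comm //.
rewrite !rmorphD !rmorphM /= lrmorph_algE !rX eqxx eq_sym (negPf ij) mul0r !add0r.
have -> : mps_low i 1 (mps_coef f 0%MM)%:A = (mps_coef f 0%MM)%:A :> mps 2 K.
  by apply: mpsext => m; rewrite mcoef_low mcoefA; case: eqVneq => [->|]; rewrite ?mnm0E // if_same.
by rewrite opprD addrACA subrr add0r mulrBr.
Qed.

(** By the product rule the generators for a multiple of H lie in the ideal of H; for a unit
    multiple the argument runs both ways. *)
Lemma Iea_unit (u v G : mps 2 K) : u * v = 1 -> Iea (u * G) = Iea G.
Proof.
have sub (a H : mps 2 K) : Iea (a * H) `<=` Iea H.
  have hI : is_ideal (Iea H) := @ideal_genP _ _.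
  have gen h : _ -> Iea H h := @ideal_gen_sub _ _ h.
  apply: ideal_gen_min => // h [] ->; last by apply: (idealM _ hI); apply: gen; apply: Or44.
  - rewrite mps_derivM mulrDr; apply: (idealD hI).
      by rewrite mulrCA; apply: (idealM _ hI); apply: gen; apply: Or41.
    by rewrite mulrCA; apply: (idealMr _ hI); apply: gen; apply: Or44.
  - rewrite mps_derivM mulrDr; apply: (idealD hI).
      by rewrite mulrCA; apply: (idealM _ hI); apply: gen; apply: Or42.
    by rewrite mulrCA; apply: (idealMr _ hI); apply: gen; apply: Or44.
  - rewrite mps_derivM mulrDr; apply: (idealD hI).
      by rewrite mulrCA; apply: (idealM _ hI); apply: gen; apply: Or43.
    by rewrite mulrCA; apply: (idealMr _ hI); apply: gen; apply: Or44.
move=> uv; apply/seteqP; split; first exact: sub.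
by rewrite -{1}[G]mul1r -uv [u * v]mulrC -mulrA; apply: sub.
Qed.

Lemma codim_xw_y w : codim [set g : mps 2 K | exists a b, g = a * px K ^+ w + b * py K] w.
Proof.
have xi_coef i (m : 'X_{1..2}) : mps_coef (px K ^+ i) m = (m == U_(ord0) *+ i)%MM%:R.
  rewrite -[px K ^+ i]mulr1; have [im|im] := leqP i (m ord0).
    rewrite [in LHS](mnm_sub_pow im) mcoefXnM mcoef1 -(inj_eq (@addIm _ (U_(ord0) *+ i)%MM)).
    by rewrite -mnm_sub_pow // add0m.
  rewrite mcoefXnM0 //; case: eqVneq => // me.
  by rewrite me mulmnE mnm1E eqxx mul1n ltnn in im.
exists (fun i => px K ^+ i); split=> [c [a [b e] ] i|v].
  have : mps_coef (a * px K ^+ w + b * py K) (U_(ord0) *+ i)%MM = 0.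
    by apply: xw_y_vanish; rewrite mulmnE mnm1E ?mul0n // eqxx mul1n.
  rewrite -e mcoef_sum (bigD1 i) //= mcoefZ xi_coef eqxx mulr1.
  rewrite big1 ?addr0 // => j ji; rewrite mcoefZ xi_coef; case: eqVneq => [|_]; last exact: mulr0.
  move=> /mnmP/(_ ord0); rewrite !mulmnE !mnm1E !mul1n => /val_inj ij.
  by rewrite ij eqxx in ji.
exists (fun i => mps_coef v (U_(ord0) *+ i)%MM); apply: series_in_xw_y => m m1 mw.
have mE : m = (U_(ord0) *+ m ord0)%MM.
  by apply: mn2_eq; rewrite mulmnE mnm1E ?mul1n // m1 mul0n.
rewrite mcoefB mcoef_sum (bigD1 (Ordinal mw)) //= mcoefZ xi_coef -mE eqxx mulr1.
rewrite big1 ?addr0 ?subrr // => j /eqP jm; rewrite mcoefZ xi_coef; case: eqVneq => [me|_]; last exact: mulr0.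
by case: jm; apply: val_inj; rewrite /= me mulmnE mnm1E mul1n.
Qed.

End Restriction.

Section ReducedCurve.
Variables (K : fieldType) (f : mps 2 K) (w : nat).
Local Notation F0 := (py K * f + px K ^+ w).
Local Notation I0 := (ideal_gen [set F0]).
Local Notation fx := (mps_deriv ord0 F0).
Hypothesis w0 : (0 < w)%N.
Hypothesis char0 : forall n, n.+1%:R != 0 :> K.
Hypothesis red : forall g n, I0 (g ^+ n) -> I0 g.

Let hI0 : is_ideal I0 := @ideal_genP _ _.
Let hIea : is_ideal (Iea F0) := @ideal_genP _ _.

Lemma deriv_expM n i (g : mps n K) N : g * mps_deriv i (g ^+ N) = g ^+ N * mps_deriv i g *+ N.
Proof.
elim: N => [|N IHN]; first by rewrite expr0 mulr0n -[1]scale1r mps_derivA mulr0.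
by rewrite exprS mps_derivM mulrDr IHN mulrnAr !mulrA -exprS -mulrSr.
Qed.

(** The factor is a product of positive integers; writing it as M.+1 lets the hypothesis on the
    characteristic apply. *)
Lemma mcoef_iter_deriv n i (g : mps n K) N j : exists M,
  mps_coef (iter N (mps_deriv i) g) (U_(i) *+ j)%MM = mps_coef g (U_(i) *+ (j + N))%MM *+ M.+1.
Proof.
elim: N j => [|N IHN] j; first by exists 0%N; rewrite addn0.
have [M ME] := IHN j.+1; rewrite iterS mcoef_deriv -mulmSr ME addSnnS -mulrnA.
by exists (M.+1 * ((U_(i) *+ j)%MM i).+1).-1; rewrite prednK ?muln_gt0.
Qed.

(* If g F_x is a multiple of F, then so is g^n F_x^(n) for all n, by derivation;
   for n = w the second factor is a unit. *)
Lemma deriv_x_nzd g : I0 (g * fx) -> I0 g.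
Proof.
move=> gI; pose dn n := iter n (mps_deriv ord0) F0.
have FI : I0 F0 by apply: ideal_gen_sub.
have h n : I0 (g ^+ n * dn n).
  elim: n => [|n IHn]; first by rewrite mul1r.
  have -> : g ^+ n.+1 * dn n.+1 = g * mps_deriv ord0 (g ^+ n * dn n) -
      dn n * (g * mps_deriv ord0 (g ^+ n)).
    by rewrite mps_derivM /dn iterS exprS; ring.
  apply: (idealB hI0); last first.
    have -> : dn n * (g * mps_deriv ord0 (g ^+ n)) = (mps_deriv ord0 g *+ n) * (g ^+ n * dn n).
      by rewrite deriv_expM -mulrnAr; ring.
    exact: (idealM _ hI0).
  have /ideal_gen1P[c ->] := IHn.
  rewrite mps_derivM mulrDr; apply: (idealD hI0).
    by rewrite mulrCA; apply: (idealM _ hI0).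
  by rewrite mulrCA; apply: (idealMr _ hI0).
have [M ME] := mcoef_iter_deriv ord0 F0 w 0.
have [|u wu] := @mps_domain_inv 2 K (dn w).
  move: ME; rewrite mulm0n add0n => ->.
  rewrite mcoefD mcoefXM0; last by rewrite mulmnE mnm1E mul0n.
  rewrite add0r -[px K ^+ w]mulr1 -[(U_(ord0) *+ w)%MM]add0m mcoefXnM mcoef1 eqxx.
  by apply/eqP; rewrite -mulr_natl mulr1 char0.
by apply: (red (n := w)); rewrite -[g ^+ w]mulr1 -wu mulrA; apply: (idealMr _ hI0).
Qed.

(** The equation [mps_low i 1 a = a] expresses that a does not involve X_i; for n = 2 such series
    are those in the other variable. *)
Lemma low_expand n (i : 'I_n) N (g : mps n K) : exists a : 'I_N -> mps n K,
  (forall j, mps_low i 1 (a j) = a j) /\ mps_low i N g = \sum_j a j * mpsX K i ^+ j.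
Proof.
elim: N g => [|N IHN] g.
  exists (fun=> 0); split=> [[]|] //; rewrite big_ord0; exact: mpsext.
have [a [aE sE] ] := IHN (mps_shift i 1 g).
exists (fun j => if unlift ord0 j is Some l then a l else mps_low i 1 g); split=> [j|].
  by case: unliftP => [l|] _ //; apply: mps_low_low.
rewrite big_ord_recl unlift_none expr0 mulr1.
under eq_bigr => l _ do rewrite liftK lift0 exprSr mulrA.
rewrite -mulr_suml -sE mulrC -[X in X * _]expr1 [LHS](mps_low_shift i 1).
congr (_ + _ * _); apply: mpsext => m; first by rewrite !mcoef_low; case: ltnP => // /leq_trans ->.
by rewrite !(mcoef_shift, mcoef_low) mnmDE mulmnE mnm1E eqxx addn1 ltnS.
Qed.

Lemma weierstrass_expand g : exists q (a : 'I_w -> mps 2 K),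
  (forall j, mps_low ord0 1 (a j) = a j) /\ g = q * F0 + \sum_j a j * px K ^+ j.
Proof.
have [q [r ->] ] := weierstrass_div f w g; have [a [aE ->] ] := low_expand ord0 w r.
by exists q, a; split=> //; rewrite [px K ^+ w + _]addrC.
Qed.

(* Cayley-Hamilton for multiplication by F_x on K[[x, y]]/(F), which is free
   over K[[y]] with basis 1, x, ..., x^(w-1). *)
Lemma deriv_integral : exists p : {poly mps 2 K},
  [/\ p != 0, forall i, mps_low ord0 1 p`_i = p`_i & I0 p.[fx] ].
Proof.
have [r rE] := restriction K (isT : (ord0 : 'I_2) != ord_max).
have qaP (i : 'I_w) := weierstrass_expand (fx * px K ^+ i).
have [q /choice[a aP] ] := choice qaP.
pose A := \matrix_(i, j) a i j; exists (char_poly A); split.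
- exact/monic_neq0/char_poly_monic.
- move=> i; rewrite -rE -coef_map map_char_poly; congr ((char_poly _)`_i).
  by apply/matrixP => l j; rewrite !mxE [LHS]rE (aP l).1.
have -> : (char_poly A).[fx] = \det (fx%:M - A).
  rewrite -horner_evalE -det_map_mx; congr (\det _); apply/matrixP => i j.
  by rewrite !mxE /= horner_evalE hornerD hornerN hornerMn hornerX hornerC.
pose v : 'cV[mps 2 K]_w := \col_i px K ^+ i.
have MvE : (fx%:M - A) *m v = \col_i (q i * F0).
  apply/colP => i; rewrite mulmxBl mul_scalar_mx !mxE {1}(aP i).2.
  apply/eqP; rewrite subr_eq; apply/eqP; congr (_ + _).
  by apply: eq_bigr => j _; rewrite !mxE.
have /(congr1 (fun M => (M *m v) (Ordinal w0) 0)) := mul_adj_mx (fx%:M - A).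
rewrite -mulmxA MvE mul_scalar_mx !mxE expr0 mulr1 => <-.
apply: (ideal_sum _ hI0) => i _; rewrite !mxE mulrA; apply: (idealM _ hI0).
exact: ideal_gen_sub.
Qed.

(** In a relation p(F_x) in (F) with p over K[[y]], a zero constant coefficient is removed by
    cancelling F_x, a nonzerodivisor modulo F. The first nonzero constant coefficient c lies in (F,
    F_x), and c is a power of y times a unit. *)
Lemma eliminate : exists N a b, py K ^+ N = a * F0 + b * fx.
Proof.
have [p [p0 pE pI] ] := deriv_integral.
suff [c [c0 cE [a [b ab] ] ] ] : exists c, [/\ c <> 0, mps_low ord0 1 c = c &
    exists a b, c = a * F0 + b * fx].
  have [||N [u [uE u0] ] ] := @low_order K ord0 ord_max c; rewrite ?cE //.
  have [v uv] := mps_domain_inv u0.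
  exists N, (v * a), (v * b); rewrite -[LHS]mulr1 -uv mulrA -uE cE ab; ring.
elim/poly_ind: p p0 pE pI => [|p c IHp]; first by rewrite eqxx.
move=> p0 pE; rewrite hornerMXaddC => pI.
have cE : mps_low ord0 1 c = c by have := pE 0%N; rewrite coefD coefMX coefC add0r.
have [c0|c0] := pselect (c = 0); last first.
  exists c; split=> //; have /ideal_gen1P[d dE] := pI; exists d, (- p.[fx]).
  by rewrite -dE; ring.
apply: IHp => [|i|].
- by apply: contra_neq p0 => ->; rewrite c0 mul0r addr0.
- by have := pE i.+1; rewrite coefD coefMX coefC addr0.
- by apply: deriv_x_nzd; rewrite c0 addr0 in pI.
Qed.

Let J : set (mps 2 K) := [set h | Iea F0 (py K * h)].

Lemma Ilog_ideal : is_ideal J.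
Proof.
split=> [|a b|a b]; rewrite /J /mkset.
- by rewrite mulr0; apply: (ideal0 hIea).
- by move=> Ja Jb; rewrite mulrDr; apply: (idealD hIea).
- by move=> Jb; rewrite mulrCA; apply: (idealM _ hIea).
Qed.

Lemma Ilog_mps_ge : exists d, forall g, mps_ge d g -> J g.
Proof.
have hJ := Ilog_ideal; have [N [a [b abE] ] ] := eliminate.
have FJ : J F0 by apply: (idealM _ hIea); apply: ideal_gen_sub; apply: Or44.
have yJ : J (py K ^+ N).
  rewrite abE; apply: (idealD hJ); first exact: (idealM _ hJ).
  rewrite /J /mkset mulrCA; apply: (idealM _ hIea); apply: ideal_gen_sub; exact: Or42.
have xJ : J (px K ^+ (w * N)).
  (* Modulo F0 the power x^w is -y f, so x^(w N) is (-f)^N y^N; the sum is the cofactor from the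
     factorisation of a difference of N-th powers. *)
  have -> : px K ^+ (w * N) = (\sum_(i < N) (F0 - py K * f) ^+ (N.-1 - i) * (- (py K * f)) ^+ i) * F0
      + (- f) ^+ N * py K ^+ N.
    have -> : (- f) ^+ N * py K ^+ N = (- (py K * f)) ^+ N by rewrite -exprMn mulrC mulrN.
    have e : px K ^+ w = F0 - py K * f by rewrite addrC addKr.
    rewrite exprM [in LHS]e; apply/eqP.
    by rewrite -subr_eq subrXX opprK subrK mulrC.
  by apply: (idealD hJ); apply: (idealM _ hJ).
(* A monomial of at least this degree is divisible by x^(w N) or by y^N. *)
exists (w * N + N)%N => g gd; rewrite (mps_low_shift ord0 (w * N) g); apply: (idealD hJ); last first.
  exact: (idealMr _ hJ).
rewrite (@mps_shiftP _ _ ord_max N (mps_low ord0 (w * N) g)); first exact: (idealMr _ hJ).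
move=> m mN; rewrite mcoef_low; case: ltnP => // mw; apply: gd.
by rewrite mdegE (big_ord2 _ ord_max2) -addSn leq_add // ltnW.
Qed.

Lemma Ilog_codim : exists k, codim J k.
Proof.
have hJ := Ilog_ideal; have [d dJ] := Ilog_mps_ge.
apply: (@codim_exists K (mps 2 K) J #|{: 'X_{1..2 < d}}| (fun i => mps_mon K (bmnm (enum_val i)))).
  move=> g; exists (fun i => mps_coef g (bmnm (enum_val i))); apply: dJ => m md.
  rewrite mcoefB mcoef_sum (bigD1 (enum_rank (BMultinom md))) //= mcoefZ mcoef_mon enum_rankK eqxx mulr1.
  rewrite big1 ?addr0 ?subrr // => i im; rewrite mcoefZ mcoef_mon.
  case: eqVneq => [me|_]; last exact: mulr0.
  by case/eqP: im; apply: enum_val_inj; rewrite enum_rankK; apply: val_inj.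
split; [exact: (ideal0 hJ)|exact: (fun u v => idealD hJ)|move=> c u Ju].
by rewrite -mulr_algl; apply: (idealM _ hJ).
Qed.

End ReducedCurve.

(** * Surface pairs and curves in coordinates *)

Section Pair.
Variables (K : fieldType) (OS OD OC : comAlgType K).
Variables (delta : {lrmorphism OS -> OD}) (rho : {lrmorphism OS -> OC}).
Variables (Phi : {lrmorphism OS -> mps 2 K}) (F : OS) (w : nat).
Hypothesis char0 : forall n, n.+1%:R != 0 :> K.
Hypothesis cPhi : coordinates delta Phi.
Hypothesis cF : curve_on_pair delta rho F w.
Local Notation F0 f := (py K * f + px K ^+ w).

(** Since D is not in C, setting y = 0 in the equation gives x^N times a unit u; division by u
    brings it to the form y f + x^N. Then N = w because both are the dimension of the same quotient,
    and w > 0 because F is not a unit. *)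
Lemma curve_equation : exists f u v, [/\ (0 < w)%N, u * v = 1 & Phi F = u * F0 f].
Proof.
have [PhiB kdelta] := cPhi; have [[_ Fm] [rhoS krho] _ nsub cdim] := cF.
have [Phi1 [PhiK Phi1K] ] := inv_lrmorph PhiB.
set G := Phi F; have GE : G = mps_low ord_max 1 G + py K * mps_shift ord_max 1 G.
  exact: (mps_low_shift ord_max 1 G).
have [l0|/low_order h] := pselect (mps_low ord_max 1 G = 0).
  case: nsub; rewrite krho; apply: ideal_gen_min; first exact: ker_ideal.
  move=> _ ->; rewrite kdelta; apply/ideal_gen1P; exists (mps_shift ord_max 1 G).
  by rewrite -/G {1}GE l0 add0r mulrC.
have [//|N [u [uE u0] ] ] := h ord0; have [v uv] := mps_domain_inv u0.
pose f := v * mps_shift ord_max 1 G.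
have GfE : G = u * (py K * f + px K ^+ N).
  have -> : u * (py K * f + px K ^+ N) = px K ^+ N * u + u * v * (py K * mps_shift ord_max 1 G).
    by rewrite /f; ring.
  by rewrite uv mul1r -uE.
have JE : ideal_add (kerset rho) (kerset delta) =
    Phi @^-1` [set g | exists a b, g = a * px K ^+ N + b * py K].
  apply/seteqP; split=> s.
    case=> p pr [d dd <-]; move: pr dd; rewrite krho kdelta => /ideal_gen1P[c ->] /ideal_gen1P[e eE].
    exists (Phi c * u), (Phi c * u * f + e).
    by rewrite rmorphD rmorphM /= -/G GfE eE; ring.
  case=> a [b sE]; exists (Phi1 (a * v) * F); first by rewrite krho; apply/ideal_gen1P; eexists.
  exists (Phi1 ((b - a * f) * py K)).
    by rewrite kdelta /preimage /mkset Phi1K; apply/ideal_gen1P; exists (b - a * f).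
  apply: (can_inj PhiK); rewrite rmorphD rmorphM /= !Phi1K -/G GfE sE.
  have -> : a * v * (u * (py K * f + px K ^+ N)) = a * (u * v) * (py K * f + px K ^+ N) by ring.
  by rewrite uv; ring.
have wN : w = N.
  have [g [gf gs] ] := codim_xw_y K N.
  apply: (codim_unique (J := ideal_add (kerset rho) (kerset delta))) cdim _.
    rewrite JE; split=> [|s t [a [b sE] ] [c [d tE] ]|k s [a [b sE] ] ].
    - by exists 0, 0; rewrite rmorph0; ring.
    - by exists (a + c), (b + d); rewrite rmorphD /= sE tE; ring.
    - by exists (k *: a), (k *: b); rewrite linearZ /= sE scalerDr !scalerAl.
  rewrite JE; exists (Phi1 \o g); split=> [c|s].
    rewrite /preimage /mkset rmorph_sum; under eq_bigr => i _ do rewrite /= linearZ /= Phi1K.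
    exact: gf.
  have [c cE] := gs (Phi s); exists c; rewrite /preimage /mkset rmorphB rmorph_sum.
  by under [X in _ - X]eq_bigr => i _ do rewrite /= linearZ /= Phi1K.
exists f, u, v; split=> //; last by rewrite wN.
rewrite wN lt0n; apply/negP => /eqP N0.
have [|c Gc] := @mps_domain_inv 2 K G.
  rewrite GfE N0 expr0 mcoefM0 mcoefD mcoefM0 mcoefX0 mul0r add0r mcoef1 eqxx mulr1.
  exact: u0.
by apply: Fm; exists (Phi1 c); apply: (can_inj PhiK); rewrite rmorphM /= Phi1K -/G Gc rmorph1.
Qed.

Variables (f u v : mps 2 K).
Hypothesis uv : u * v = 1.
Hypothesis FE : Phi F = u * F0 f.

Lemma ker_rhoE : kerset rho = Phi @^-1` ideal_gen [set F0 f].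
Proof.
have [/inv_lrmorph[Phi1 [PhiK Phi1K] ] _] := cPhi; have [_ [_ ->] _ _ _] := cF.
apply/seteqP; split=> s; first move/ideal_gen1P => [c ->]; last move=> /ideal_gen1P[c sE].
  by apply/ideal_gen1P; exists (Phi c * u); rewrite rmorphM /= FE mulrA.
apply/ideal_gen1P; exists (Phi1 (c * v)); apply: (can_inj PhiK).
rewrite rmorphM /= Phi1K FE sE; have -> : c * v * (u * F0 f) = c * (u * v) * F0 f by ring.
by rewrite uv mulr1.
Qed.

(** The ideal of D is generated by y, so the ideal quotient is tested on y alone; the unit factor of
    F is absorbed by [Iea_unit]. *)
Lemma IlogE : Ilog delta Phi F = Phi @^-1` [set h | Iea (F0 f) (py K * h)].
Proof.
have hI : is_ideal (Iea (F0 f)) := @ideal_genP _ _.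
have [/inv_lrmorph[Phi1 [PhiK Phi1K] ] kdelta] := cPhi.
rewrite /Ilog /colon FE (Iea_unit _ uv); apply/seteqP; split=> s.
  move=> h; have : Iea (F0 f) (Phi (s * Phi1 (py K))).
    apply: h; rewrite kdelta /preimage /mkset Phi1K; apply/ideal_gen1P.
    by exists 1; rewrite mul1r.
  by rewrite rmorphM /= Phi1K [Phi s * _]mulrC.
move=> h b; rewrite kdelta => /ideal_gen1P[c bE]; rewrite /preimage /mkset rmorphM /= bE.
by rewrite mulrCA [Phi s * _]mulrC; apply: (idealM _ hI).
Qed.

Lemma curve_reduced g n : ideal_gen [set F0 f] (g ^+ n) -> ideal_gen [set F0 f] g.
Proof.
have [/inv_lrmorph[Phi1 [PhiK Phi1K] ] _] := cPhi; have [_ _ redC _ _] := cF.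
have kE h : rho (Phi1 h) = 0 <-> ideal_gen [set F0 f] h.
  have : kerset rho (Phi1 h) <-> (Phi @^-1` ideal_gen [set F0 f]) (Phi1 h) by rewrite -ker_rhoE.
  by rewrite /preimage /mkset Phi1K.
by move/kE; rewrite !rmorphXn => /redC/kE.
Qed.

Lemma universal_semiuniversal k (fs : 'I_k -> mps 2 K) : (0 < w)%N ->
  basis_mod [set h | Iea (F0 f) (py K * h)] fs ->
  formally_semiuniversal (Defm delta rho w) (mps k K) (universal_family delta rho Phi f w fs).
Proof.
move=> w0 [ff fsp]; have [PhiB kdelta] := cPhi; have [_ [rhoS _] _ _ _] := cF.
split; first exact: mps_complete_local_noetherian.
- exact: (universal_in_limit _ w0 PhiB kdelta rhoS ker_rhoE).
- exact: (universal_smooth w0 PhiB kdelta rhoS ker_rhoE fsp).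
- exact: (universal_dual w0 PhiB kdelta rhoS ker_rhoE fsp ff).
Qed.

Lemma semiuniversal_exists : (0 < w)%N -> exists k, codim (Ilog delta Phi F) k /\
  exists (Rhat : comAlgType K) (xi : formal_family (Defm delta rho w) Rhat),
    formally_semiuniversal (Defm delta rho w) Rhat xi /\ alg_iso Rhat (mps k K).
Proof.
move=> w0; have [/inv_lrmorph[Phi1 [PhiK Phi1K] ] _] := cPhi.
have [k [fs fsB] ] := Ilog_codim w0 char0 curve_reduced.
exists k; split.
  have [ff fsp] := fsB; rewrite IlogE; exists (Phi1 \o fs); split=> [c|s].
    rewrite /preimage {1}/mkset rmorph_sum; under eq_bigr => i _ do rewrite /= linearZ /= Phi1K.
    exact: ff.
  have [c cE] := fsp (Phi s); exists c; rewrite /preimage {1}/mkset rmorphB rmorph_sum.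
  by under [X in _ - X]eq_bigr => i _ do rewrite /= linearZ /= Phi1K.
exists (mps k K), (universal_family delta rho Phi f w fs); split.
  exact: universal_semiuniversal.
by exists idfun; exists idfun.
Qed.

End Pair.

Theorem theorem1p1 (R : realType) :
  (forall (OS OD OC : comAlgType R[i])
      (delta : {lrmorphism OS -> OD}) (rho : {lrmorphism OS -> OC})
      (F : OS) (w : nat),
    surface_pair delta -> curve_on_pair delta rho F w ->
    [/\ (0 < w)%N,
        exists Phi : {lrmorphism OS -> mps 2 R[i]}, coordinates delta Phi
      & forall Phi : {lrmorphism OS -> mps 2 R[i]}, coordinates delta Phi ->
        exists k : nat, codim (Ilog delta Phi F) k /\
        exists (Rhat : comAlgType R[i]) (xi : formal_family (Defm delta rho w) Rhat),
          formally_semiuniversal (Defm delta rho w) Rhat xi /\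
          alg_iso Rhat (mps k R[i])])
  /\
  (forall (OD OC : comAlgType R[i])
      (delta : {lrmorphism mps 2 R[i] -> OD})
      (rho : {lrmorphism mps 2 R[i] -> OC})
      (f : mps 2 R[i]) (w k : nat) (fs : 'I_k -> mps 2 R[i]),
    let x : mps 2 R[i] := px R[i] in
    let y : mps 2 R[i] := py R[i] in
    let F : mps 2 R[i] := y * f + x ^+ w in
    surj delta -> kerset delta = ideal_gen [set y] ->
    curve_on_pair delta rho F w ->
    basis_mod (colon (Iea F) (kerset delta)) fs ->
    exists xi : formal_family (Defm delta rho w) (mps k R[i]),
      formally_semiuniversal (Defm delta rho w) (mps k R[i]) xi /\
      forall (A : comAlgType R[i]) (q : {lrmorphism mps k R[i] -> A}),
        in_AC A -> surj q ->
        exists X : deform (mps 2 R[i]) OC A,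
          [/\ is_deform delta rho X, xi A q = iso_class delta rho X
            & embedded_by delta X (fun j =>
                j y * (j f + \sum_(i < k) q (mpsX R[i] i) *: j (fs i))
                + j x ^+ w)]).
Proof.
have char0 n : n.+1%:R != 0 :> R[i] by rewrite Num.Theory.pnatr_eq0.
split=> [OS OD OC delta rho F w pr cF|OD OC delta rho f w k fs x y F dS kdelta cF fsB].
  have [Phi cPhi] := coordinates_exist pr.
  have [_ [_ [_ [w0 _ _] ] ] ] := curve_equation cPhi cF.
  split=> // [|{cPhi}Phi cPhi]; first by exists Phi.
  have [f [u [v [_ uv FE] ] ] ] := curve_equation cPhi cF.
  exact: (semiuniversal_exists char0 cPhi cF uv FE w0).
pose Phi : {lrmorphism mps 2 R[i] -> mps 2 R[i]} := idfun.
have cPhi : coordinates delta Phi by split; [exists idfun|rewrite kdelta].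
have [_ [_ [_ [w0 _ _] ] ] ] := curve_equation cPhi cF.
(* The identity serves as coordinates and 1 as the unit relating F to its normal form. *)
have FE : Phi F = 1 * F by rewrite mul1r.
have fsB' : basis_mod [set h | Iea F (y * h)] fs.
  by have -> : [set h | Iea F (y * h)] = _ := esym (IlogE cPhi (mulr1 1) FE).
pose xi := universal_family delta rho Phi f w fs.
exists xi; split; first exact: (universal_semiuniversal cPhi cF (mulr1 1) FE w0 fsB').
move=> A q AC qS; have [PhiB kd] := cPhi; have [_ [rhoS _] _ _ _] := cF.
have krho := ker_rhoE cPhi cF (mulr1 1) FE.
have mq i : maxid A (q (mpsX _ i)) by apply: hom_maxid AC.
have [X [XD XG _] ] := eqn_deform fs w0 PhiB kd rhoS krho AC mq.
exists X; split=> //; first by rewrite (pclassE PhiB kd rhoS krho AC XD XG).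
apply: (presented_embedded PhiB kd rhoS krho AC XD XG) => j0 j jE.
rewrite !jE /eqn rmorphD rmorphM rmorphXn rmorphD rmorph_sum /= !map_mpsX.
by congr (_ * (_ + _) + _); apply: eq_bigr => i _; rewrite linearZ /= jE.
Qed.
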